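(* Let $V$ be a complex vector space of dimension $r$, let $G\subset \mathrm{GL}(V)$ be a complex reflection group and let $N\trianglelefteq G$ be a normal reflection subgroup. Let $H=G/N$ and $E=V/N$, let $\sigma\in\mathrm{Gal}(\mathbb{Q}(\zeta_G)/\mathbb{Q})$, and let $U^N_\sigma$ be the Orlik-Solomon space, i.e. the $G$-module dual to $(\mathcal{C}_N\otimes (V^\sigma)^* )^N$. Then, for a suitable choice of indexing (of the multisets of exponents and degrees involved), we have for all $i=1,\dots,r$ \begin{align*} e_i^N(V^\sigma) + e_i^G(U^N_\sigma) & = e_i^G(V^\sigma),\\ d_i^N \cdot e_i^H(E^\sigma) & = e_i^G(E^\sigma),\\ d_i^N\cdot d_i^H & =d_i^G. \end{align*}
   Context: Reflection groups. A reflection on a finite-dimensional complex vector space $V$ is an element of $\mathrm{GL}(V)$ of finite order fixing some hyperplane pointwise. A complex reflection group $G\subset\mathrm{GL}(V)$ is a finite subgroup generated by reflections; a normal reflection subgroup $N\trianglelefteq G$ is a normal subgroup generated by reflections. $S(V^* )$ is the algebra of polynomial functions on $V$, graded by degree (called $\mathbf{x}$-degree). $S(V^* )^G$ is generated by $r=\dim V$ homogeneous algebraically independent polynomials, whose degrees $d_1^G,\dots,d_r^G$ are the degrees of $G$ (similarly $d_i^N$ for $N$). A $G$-module is a finite-dimensional complex representation of $G$. Harmonic polynomials and exponents. $\mathcal{C}_G\subset S(V^* )$ is the space of $G$-harmonic polynomials (those annihilated by all $G$-invariant constant-coefficient polynomial differential operators with no constant term); it is a graded $G$-stable complement to the ideal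 generated by homogeneous $G$-invariants of positive degree. $\mathcal{C}_N\subset S(V^* )$ is defined likewise for $N$, and is $G$-stable. For a $G$-module $M$ of dimension $m$, the $M$-exponents $e_1^G(M),\dots,e_m^G(M)$ of $G$ are the degrees (as a multiset) of a homogeneous basis of the $m$-dimensional space $(\mathcal{C}_G\otimes M^* )^G$, graded via $\mathcal{C}_G$. The $M$-exponents $e_i^N(M)$ of $N$ are defined in the same way. Quotient. There exist homogeneous algebraically independent generators $N_1,\dots,N_r$ of $S(V^* )^N$ such that $E^*=\mathrm{span}_{\mathbb{C}}\{N_1,\dots,N_r\}$ is $G$-stable. $E$ is the dual of $E^*$, identified with $V/N$, so $S(E^* )=S(V^* )^N$. $N$ acts trivially on $E$, and $H=G/N$ acts on $E$ as a complex reflection group. The degrees $d_i^H$, the $H$-harmonic polynomials $\mathcal{C}_H\subset S(E^* )$ and the exponents $e_i^H(\cdot)$ are those of $H\subset \mathrm{GL}(E)$, where $S(E^* )$ is graded by $\mathbf{N}$-degree (each $N_i$ has degree $1$). Galois twists. $\zeta_G$ is a primitive $|G|$-th root of unity. $V$ can be realized by matrices over $\mathbb{Q}(\zeta_G)$; $V^\sigma$ is the representation of $G$ obtained by applying $\sigma$ to the matrix entries (equivalently, applying an extension of $\sigma$ to a field automorphism of $\mathbb{C}$ to matrix entries in any basis). $E^\sigma$ is the Galois twist of $E$ defined in the same way; it is viewed both as a $G$-module and as an $H$-module. *)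

(* Defs.v *)
From HB Require Import structures.
From mathcomp Require Import all_boot all_order all_fingroup all_algebra.
From mathcomp Require Import all_solvable all_field all_character.
From mathcomp Require Import mpoly complex reals.

Set Implicit Arguments.
Unset Strict Implicit.
Unset Printing Implicit Defensive.

Import GRing.Theory.
Local Open Scope ring_scope.

(* Conventions: a G-module of dimension n is a matrix representation
   rM : mx_representation C G n acting on the left on column vectors, so that
   g e_j = \sum_k (rM g) k j e_k in the standard basis.  For V = 'cV_r the
   variable 'X_i of {mpoly C[r]} is the i-th coordinate function on V, hence
   {mpoly C[r]} is the algebra S(V^* ). *)

Section Reflections.
Variable C : fieldType.

Definition reflection n (A : 'M[C]_n) : Prop :=
  [/\ A \in unitmx,
      exists2 k : nat, (0 < k)%N & A ^+ k = 1%:M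
    & exists2 a : 'rV[C]_n, a != 0 &
        forall v : 'cV[C]_n, a *m v = 0 -> A *m v = v].

Definition complex_reflection_group (gT : finGroupType) (G : {group gT}) n
    (rG : mx_representation C G n) : Prop :=
  mx_faithful rG /\
  exists S : {set gT},
    (forall s, s \in S -> reflection (rG s)) /\ G :=: <<S>>%g.

End Reflections.

Section DualModule.
Variables (C : fieldType) (gT : finGroupType) (G : {group gT}) (n : nat).
Variable rM : mx_representation C G n.

Definition dual_mx (g : gT) : 'M[C]_n := (rM (g^-1)%g)^T.

Lemma dual_mx_repr : mx_repr G dual_mx.
Proof.
split=> [|g h Gg Gh]; first by rewrite /dual_mx invg1 repr_mx1 trmx1.
by rewrite /dual_mx invMg repr_mxM ?groupV // trmx_mul.
Qed.

Definition dual_repr : mx_representation C G n := MxRepresentation dual_mx_repr.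

End DualModule.

Section Invariants.
Variables (C : fieldType) (gT : finGroupType) (G : {group gT}) (r : nat).
Variable rG : mx_representation C G r.

(* (g . p)(v) = p (g^-1 v) *)
Definition polyact (g : gT) (p : {mpoly C[r]}) : {mpoly C[r]} :=
  p \mPo [tuple \sum_j rG (g^-1)%g i j *: 'X_j | i < r].

Definition invariant (p : {mpoly C[r]}) : Prop :=
  forall g, g \in G -> polyact g p = p.

Definition algebraically_independent (f : r.-tuple {mpoly C[r]}) : Prop :=
  forall p : {mpoly C[r]}, p \mPo f = 0 -> p = 0.

Definition basic_invariants (f : r.-tuple {mpoly C[r]}) : Prop :=
  [/\ forall i : 'I_r, exists d : nat, tnth f i \is d.-homog,
      forall i : 'I_r, invariant (tnth f i),
      algebraically_independent f
    & forall q, invariant q -> exists p : {mpoly C[r]}, q = p \mPo f].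

Definition degrees (d : r.-tuple nat) : Prop :=
  exists2 f, basic_invariants f &
    forall i : 'I_r, tnth f i \is (tnth d i).-homog.

(* The constant-coefficient differential operator p(d/dx_1, ..., d/dx_r). *)
Definition diffop (p f : {mpoly C[r]}) : {mpoly C[r]} :=
  \sum_(m <- msupp p) p@_m *: f^`M[m].

End Invariants.

Section Harmonics.
Variables (C : fieldType) (gT : finGroupType) (G : {group gT}) (r : nat).
Variable rG : mx_representation C G r.

(* Conjugation by g sends the derivation along v to the derivation along g v,
   so constant-coefficient operators form the G-module S(V), i.e. the
   polynomial functions on V^*. *)
Definition harmonic (f : {mpoly C[r]}) : Prop :=
  forall p : {mpoly C[r]},
    invariant (dual_repr rG) p -> p@_0%MM = 0 -> diffop p f = 0.

(* The element \sum_j u j (x) w_j of S(V^* ) (x) W, for the standard basis w of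
   W, is encoded by the family u of its coefficients; g acts diagonally. *)
Definition tensact m (rW : mx_representation C G m) (g : gT)
    (u : {ffun 'I_m -> {mpoly C[r]}}) : {ffun 'I_m -> {mpoly C[r]}} :=
  [ffun k => \sum_j rW g k j *: polyact rG g (u j)].

(* Membership in (C_G (x) M^* )^G. *)
Definition invariant_harmonics m (rM : mx_representation C G m)
    (u : {ffun 'I_m -> {mpoly C[r]}}) : Prop :=
  (forall j, harmonic (u j)) /\
  (forall g, g \in G -> tensact (dual_repr rM) g u = u).

End Harmonics.

Definition is_basis (C : fieldType) (W : lmodType C) (P : W -> Prop) k
    (b : 'I_k -> W) : Prop :=
  [/\ forall i, P (b i),
      forall c : 'I_k -> C, \sum_i c i *: b i = 0 -> forall i, c i = 0
    & forall w, P w -> exists c : 'I_k -> C, w = \sum_i c i *: b i].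

(* The length of e is left free: that it is the dimension of M is a theorem. *)
Definition exponents (C : fieldType) (gT : finGroupType) (G : {group gT})
    r (rG : mx_representation C G r) m (rM : mx_representation C G m)
    (e : seq nat) : Prop :=
  exists2 b : 'I_(size e) -> {ffun 'I_m -> {mpoly C[r]}},
    is_basis (invariant_harmonics rG rM) b &
    forall i k, b i k \is (nth 0%N e i).-homog.

Section Quotient.
Variables (C : fieldType) (gT : finGroupType) (G N : {group gT}).
Hypothesis nNG : (N <| G)%g.

Definition res n (rM : mx_representation C G n) : mx_representation C N n :=
  subg_repr rM (normal_sub nNG).

(* A (G / N)-module viewed as a G-module. *)
Definition inflate n (rM : mx_representation C (G / N)%G n) :
    mx_representation C G n :=
  @morphim_repr C gT _ G _ (coset_morphism N) n rM (normal_norm nNG).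

(* The span of the f_j is the G-module dual to E, the f_j being the coordinate
   functions on E; compare polyact on the variables. *)
Definition quotient_module r (rV : mx_representation C G r)
    (f : r.-tuple {mpoly C[r]}) (rE : mx_representation C (G / N)%G r) : Prop :=
  forall g, g \in G -> forall j : 'I_r,
    polyact rV g (tnth f j) =
    \sum_k inflate rE (g^-1)%g j k *: tnth f k.

(* rU is the G-module dual to (C_N (x) M^* )^N, that is, G acts on some basis b
   of this space through the dual of rU. *)
Definition orlik_solomon r (rV : mx_representation C G r)
    m (rM : mx_representation C G m) n (rU : mx_representation C G n) : Prop :=
  exists2 b : 'I_n -> {ffun 'I_m -> {mpoly C[r]}},
    is_basis (invariant_harmonics (res rV) (res rM)) b &
    forall g, g \in G -> forall j,
      tensact rV (dual_repr rM) g (b j) =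
      \sum_k dual_repr rU g k j *: b k.

End Quotient.

(* rM is realized over L by rL, and applying sigma to the entries of rL gives
   rMs, both up to isomorphism. *)
Definition galois_twist (L C : fieldType) (iota : {rmorphism L -> C})
    (sigma : {rmorphism L -> L}) (gT : finGroupType) (G : {group gT})
    n (rM rMs : mx_representation C G n) : Prop :=
  exists2 rL : mx_representation L G n,
    mx_rsim rM (map_repr iota rL) &
    mx_rsim rMs (map_repr (iota \o sigma) rL).

(* Main.v *)
Require Import Defs.
From HB Require Import structures.
From mathcomp Require Import all_boot all_order all_fingroup all_algebra.
From mathcomp Require Import all_solvable all_field all_character.
From mathcomp Require Import mpoly ssrcomplements complex reals boolp.

Set Implicit Arguments.
Unset Strict Implicit.
Unset Printing Implicit Defensive.

Import GRing.Theory Num.Theory Num.Def Order.TTheory.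
Local Open Scope ring_scope.
Local Notation invariant := Defs.invariant.

(** A polynomial is homogeneous of degree d when the Euler derivation E multiplies
    it by d; every degree and exponent below is therefore an eigenvalue.

    For a G-module M the covariants (S(V^* ) (x) M^* )^G form a free module over
    the invariants, and a basis of the harmonic covariants is a basis of it
    ([homog_basis]): the harmonic polynomials complement the Hilbert ideal
    ([harmonic_decomp]), families independent modulo that ideal are independent
    ([chevalley_free], [covariant_free]), and a free orbit of G shows that the rank
    is dim M ([ex_covariant_nonsingular]).  Writing a basis as the rows of a matrix
    B, homogeneity says E B = D B with D diagonal, made of the exponents.  If
    another basis satisfies E W = T W with T invariant, then the base change Z from
    one basis to the other is invertible at the origin, and the constant terms of
    E Z + Z D = T Z show that the exponents are the eigenvalues of the constant
    term T(0).  Each identity now follows by exhibiting a basis W for which T(0) is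
    the sum or the product of two commuting matrices with known integral
    eigenvalues, which are then paired by [joint_spectrum].

    Sum of exponents ([exponents_orlik_solomon]).  Let b be a basis of the
    N-harmonic covariants of V^sigma on which G acts through U, and c a basis of
    the covariants of U.  Then W = c b is a basis of the G-covariants of V^sigma.
    One has E b = N' b with N' constant, diagonalizable with eigenvalues the
    N-exponents, and commuting with G; hence c N' = T c with T invariant, and
    E W = (D + T) W.  As N' is constant, T(0) has the characteristic polynomial of
    N'; comparing degrees in c N' = T c shows that it commutes with D.

    Product of exponents ([exponents_quotient]).  Let f be the basic invariants of
    N, of degrees w_i, and h a basis of the H-covariants of the twist of V/N.  Then
    h o f is a basis of the G-covariants of that twist, and E (h o f) = (E_w h) o f,
    where E_w gives the i-th coordinate of V/N the weight w_i.  Since the root of a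
    reflection s of G divides s p - p for every p, s acts on V/N as a reflection or
    trivially ([quotient_reflection]), hence moves at most one weight space
    ([quotient_generators]).
    The group H thus splits along the weights, and so does its action on the twist
    ([twist_weights]), which carries a scaling Delta with eigenvalues the w_i that
    commutes with H.  Modulo the Hilbert ideal of H one finds E_w h = (E h) Delta
    ([euler_scaling_ideal]).  With h Delta = Theta h, the matrix T of E_w h = T h
    satisfies T(0) = D Theta(0), and Theta(0) has the eigenvalues w_i.

    Product of degrees ([degrees_quotient]).  The same argument is applied to the
    Jacobian matrix J of basic invariants theta of H: the splitting of H gives
    J Delta = Theta J with Delta diagonal, made of the w_i, so that
    E_w theta = Theta D theta with D made of the degrees of H.  The degrees of G are
    compared with it through linear parts of substitutions ([degrees_intertwine]),
    which also shows that the w_i are the degrees of N ([degrees_unique]). *)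

(** * Polynomial calculus *)

Lemma mpoly_ring_ind (C : fieldType) n (P : {mpoly C[n]} -> Prop) :
  (forall c, P c%:MP) -> (forall i, P 'X_i) ->
  (forall p q, P p -> P q -> P (p + q)) ->
  (forall p q, P p -> P q -> P (p * q)) -> forall p, P p.
Proof.
move=> PC PX PD PM p; rewrite [p]mpolyE.
elim/big_ind: _ => [|q q' Pq Pq'|m _]; first by rewrite -(mpolyC0 n); apply: PC.
  exact: PD.
rewrite -mul_mpolyC mpolyXE_id; apply: (PM) => //.
elim/big_ind: _ => [|q q' Pq Pq'|i _]; first by rewrite -(mpolyC1 n); apply: PC.
  exact: PM.
elim: (m i) => [|k IHk]; first by rewrite expr0 -(mpolyC1 n); apply: PC.
by rewrite exprS; apply: PM.
Qed.

Section Calculus.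
Variables (C : fieldType).
Implicit Types (n k : nat).

Lemma subm_self n (m : 'X_{1..n}) : (m - m)%MM = 0%MM.
Proof. by apply/mnmP => i; rewrite mnmBE subnn mnm0E. Qed.

Lemma comp_mpolyM n k (t : n.-tuple {mpoly C[k]}) p q :
  (p * q) \mPo t = (p \mPo t) * (q \mPo t).
Proof. exact: rmorphM. Qed.

Lemma mcoeff0_comp n k (t : n.-tuple {mpoly C[k]}) p :
  (forall i, (tnth t i)@_0%MM = 0) -> (p \mPo t)@_0%MM = p@_0%MM.
Proof.
move=> t0; elim/mpoly_ring_ind: p => [c|i|p q IHp IHq|p q IHp IHq].
- by rewrite comp_mpolyC !mcoeffC !eqxx.
- by rewrite comp_mpolyXU -tnth_nth t0 mcoeffX mnm1_eq0.
- by rewrite raddfD /= !mcoeffD IHp IHq.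
- by rewrite rmorphM /= !rmorphM /= IHp IHq.
Qed.

Lemma mderiv_comp n k (t : n.-tuple {mpoly C[k]}) p i :
  (p \mPo t)^`M(i) = \sum_j (p^`M(j) \mPo t) * (tnth t j)^`M(i).
Proof.
elim/mpoly_ring_ind: p => [c|l|p q IHp IHq|p q IHp IHq].
- rewrite comp_mpolyC mderivC big1 // => j _.
  by rewrite mderivC comp_mpoly0 mul0r.
- rewrite comp_mpolyXU -tnth_nth (bigD1 l) //= big1 ?addr0 => [|j jl].
    by rewrite mderivX mnm1E eqxx scale1r subm_self mpolyX0 comp_mpoly1 mul1r.
  by rewrite mderivX mnm1E eq_sym (negPf jl) scale0r comp_mpoly0 mul0r.
- rewrite raddfD /= mderivD IHp IHq -big_split /=; apply: eq_bigr => j _.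
  by rewrite mderivD raddfD /= mulrDl.
- rewrite rmorphM /= mderivM IHp IHq mulr_suml mulr_sumr -big_split /=.
  apply: eq_bigr => j _.
  by rewrite mderivM raddfD /= !rmorphM /= mulrDl mulrAC mulrA.
Qed.

(** The weighted Euler derivation; on a homogeneous polynomial it multiplies by
    the weight, and so linearizes every statement about degrees below. *)
Definition euler n (w : 'I_n -> C) (p : {mpoly C[n]}) : {mpoly C[n]} :=
  \sum_i w i *: ('X_i * p^`M(i)).

Lemma euler_is_linear n (w : 'I_n -> C) : linear (euler w).
Proof.
move=> c p q; rewrite /euler scaler_sumr -big_split /=; apply: eq_bigr => i _.
by rewrite mderivD mderivZ mulrDr scalerDr -scalerAr !scalerA mulrC.
Qed.

HB.instance Definition _ n (w : 'I_n -> C) :=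
  GRing.isLinear.Build C {mpoly C[n]} {mpoly C[n]} _ (euler w)
    (@euler_is_linear n w).

Lemma eulerZ n (w : 'I_n -> C) c p : euler w (c *: p) = c *: euler w p.
Proof. exact: linearZ. Qed.

Lemma euler_sum n (w : 'I_n -> C) I (s : seq I) (P : pred I) (F : I -> {mpoly C[n]}) :
  euler w (\sum_(i <- s | P i) F i) = \sum_(i <- s | P i) euler w (F i).
Proof. exact: raddf_sum. Qed.

Lemma eulerM n (w : 'I_n -> C) p q :
  euler w (p * q) = euler w p * q + p * euler w q.
Proof.
rewrite /euler mulr_suml mulr_sumr -big_split /=; apply: eq_bigr => i _.
rewrite mderivM mulrDr scalerDr -scalerAl -scalerAr !mulrA.
by rewrite [p * 'X_i]mulrC.
Qed.

Lemma eulerC n (w : 'I_n -> C) c : euler w c%:MP = 0.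
Proof. by rewrite /euler big1 // => i _; rewrite mderivC mulr0 scaler0. Qed.

Lemma euler_coef0 n (w : 'I_n -> C) p : (euler w p)@_0%MM = 0.
Proof.
rewrite raddf_sum big1 //= => i _.
by rewrite mcoeffZ rmorphM /= mcoeffX mnm1_eq0 mul0r mulr0.
Qed.

Lemma eulerX n (w : 'I_n -> C) m :
  euler w 'X_[m] = (\sum_i (m i)%:R * w i) *: 'X_[m].
Proof.
rewrite /euler scaler_suml; apply: eq_bigr => i _.
rewrite mderivX -scalerAr scalerA mulrC.
have [->|mi] := eqVneq (m i) 0%N; first by rewrite mul0r !scale0r.
rewrite -mpolyXD addmC submK //.
by rewrite lep1mP.
Qed.

Lemma eulerXU n (w : 'I_n -> C) i : euler w 'X_i = w i *: 'X_i.
Proof.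
rewrite eulerX (bigD1 i) //= big1 ?addr0 => [|j ji].
  by rewrite mnm1E eqxx mul1r.
by rewrite mnm1E eq_sym (negPf ji) mul0r.
Qed.

Lemma euler_homog n (d : nat) (p : {mpoly C[n]}) :
  p \is d.-homog -> euler (fun _ => 1) p = d%:R *: p.
Proof.
move=> /dhomogP hp; rewrite [p]mpolyE raddf_sum scaler_sumr /=.
apply: eq_big_seq => m /hp dm; rewrite linearZ /= eulerX !scalerA mulrC -dm /= mdegE natr_sum.
congr (_ * _ *: _).
by apply: eq_bigr => i _; rewrite mulr1.
Qed.

Lemma euler_comp n k (w : 'I_k -> C) (v : 'I_n -> C) (t : n.-tuple {mpoly C[k]}) p :
  (forall j, euler w (tnth t j) = v j *: tnth t j) ->
  euler w (p \mPo t) = euler v p \mPo t.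
Proof.
move=> ht; elim/mpoly_ring_ind: p => [c|l|p q IHp IHq|p q IHp IHq].
- by rewrite comp_mpolyC !eulerC comp_mpoly0.
- by rewrite eulerXU comp_mpolyZ comp_mpolyXU -tnth_nth ht.
- by rewrite !raddfD /= IHp IHq.
- by rewrite rmorphM /= !eulerM raddfD /= !rmorphM /= IHp IHq.
Qed.

(** Substitution of linear forms: [lsub A p] is v |-> p (A v). *)
Definition lin_forms n (A : 'M[C]_n) : n.-tuple {mpoly C[n]} :=
  [tuple \sum_j A i j *: 'X_j | i < n].
Definition lsub n (A : 'M[C]_n) (p : {mpoly C[n]}) : {mpoly C[n]} :=
  p \mPo lin_forms A.

HB.instance Definition _ n (A : 'M[C]_n) :=
  GRing.RMorphism.copy (lsub A) (comp_mpoly (lin_forms A)).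
HB.instance Definition _ n (A : 'M[C]_n) :=
  GRing.Linear.copy (lsub A) (comp_mpoly (lin_forms A)).

Lemma tnth_lin_forms n (A : 'M[C]_n) i :
  tnth (lin_forms A) i = \sum_j A i j *: 'X_j.
Proof. by rewrite tnth_mktuple. Qed.

Lemma lsubXU n (A : 'M[C]_n) i : lsub A 'X_i = \sum_j A i j *: 'X_j.
Proof. by rewrite /lsub comp_mpolyXU -tnth_nth tnth_lin_forms. Qed.

Lemma lsubC n (A : 'M[C]_n) c : lsub A c%:MP = c%:MP.
Proof. exact: comp_mpolyC. Qed.

Lemma lsubM n (A B : 'M[C]_n) p : lsub A (lsub B p) = lsub (B *m A) p.
Proof.
elim/mpoly_ring_ind: p => [c|l|p q IHp IHq|p q IHp IHq].
- by rewrite !lsubC.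
- rewrite !lsubXU raddf_sum /=.
  under eq_bigr do rewrite linearZ /= lsubXU scaler_sumr.
  rewrite exchange_big /=; apply: eq_bigr => j _.
  by rewrite mxE scaler_suml; apply: eq_bigr => i _; rewrite scalerA.
- by rewrite !raddfD /= IHp IHq.
- by rewrite !rmorphM /= IHp IHq.
Qed.

Lemma lsub1 n (p : {mpoly C[n]}) : lsub 1%:M p = p.
Proof.
elim/mpoly_ring_ind: p => [c|l|p q IHp IHq|p q IHp IHq].
- exact: lsubC.
- rewrite lsubXU (bigD1 l) //= mxE eqxx scale1r big1 ?addr0 // => j jl.
  by rewrite mxE eq_sym (negPf jl) scale0r.
- by rewrite raddfD /= IHp IHq.
- by rewrite rmorphM /= IHp IHq.
Qed.

Lemma lsubK n (A : 'M[C]_n) : A \in unitmx -> cancel (lsub A) (lsub (invmx A)).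
Proof. by move=> uA p; rewrite lsubM mulmxV // lsub1. Qed.

Lemma lsub_coef0 n (A : 'M[C]_n) p : (lsub A p)@_0%MM = p@_0%MM.
Proof.
apply: mcoeff0_comp => i; rewrite tnth_lin_forms raddf_sum big1 //= => j _.
by rewrite mcoeffZ mcoeffX mnm1_eq0 mulr0.
Qed.

Lemma lin_form_homog n (a : 'I_n -> C) : \sum_j a j *: 'X_j \is [in C[n], 1.-homog].
Proof.
apply: rpred_sum => j _; apply: rpredZ.
by rewrite dhomogX /= mdeg1.
Qed.

Lemma comp_homog n k (t : n.-tuple {mpoly C[k]}) d (p : {mpoly C[n]}) :
  (forall i, tnth t i \is 1.-homog) -> p \is d.-homog -> p \mPo t \is d.-homog.
Proof.
move=> ht /dhomogP hp; rewrite comp_mpolyE big_seq.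
apply: rpred_sum => m /hp <-; apply: rpredZ; rewrite /= mdegE.
elim/big_rec2: _ => [|i q e _ IH]; first exact: dhomog1.
apply: dhomogM => //; rewrite -[X in X.-homog]mul1n; exact: dhomogMn.
Qed.

Lemma lsub_homog n (A : 'M[C]_n) d p : p \is d.-homog -> lsub A p \is d.-homog.
Proof.
by apply: comp_homog => i; rewrite tnth_lin_forms lin_form_homog.
Qed.

Lemma lsub_meval n (A : 'M[C]_n) p (v : 'I_n -> C) :
  (lsub A p).@[v] = p.@[fun i => \sum_j A i j * v j].
Proof.
rewrite comp_mpoly_meval; apply: meval_eq => i.
rewrite tnth_lin_forms raddf_sum /=; apply: eq_bigr => j _.
by rewrite mevalZ mevalXU.
Qed.

Lemma lsub_msize n (A : 'M[C]_n) p : (msize (lsub A p) <= msize p)%N.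
Proof.
rewrite /lsub comp_mpolyEX (leq_trans (msize_sum _ _ _)) //.
apply/bigmax_leqP_seq => m mp _; rewrite (leq_trans (msizeZ_le _ _)) //.
have : lsub A 'X_[m] \is (mdeg m).-homog by apply: lsub_homog; rewrite dhomogX.
move=> /dhomogP hm; rewrite (leq_trans _ (msize_mdeg_lt mp)) //.
rewrite msizeE; apply/bigmax_leqP_seq => l lp _.
by rewrite ltnS; move/hm: lp => /= ->.
Qed.

Lemma euler_lsub n (w : 'I_n -> C) (A : 'M[C]_n) p :
  (forall i j, A i j != 0 -> w i = w j) ->
  euler w (lsub A p) = lsub A (euler w p).
Proof.
move=> hA; apply: euler_comp => i; rewrite tnth_lin_forms raddf_sum scaler_sumr /=.
apply: eq_bigr => j _; rewrite linearZ /= eulerXU !scalerA mulrC.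
by have [->|/hA ->] := eqVneq (A i j) 0; rewrite ?mulr0.
Qed.

Lemma mderiv_lsub n (A : 'M[C]_n) p i :
  (lsub A p)^`M(i) = \sum_j A j i *: lsub A p^`M(j).
Proof.
rewrite mderiv_comp; apply: eq_bigr => j _.
suff -> : (tnth (lin_forms A) j)^`M(i) = (A j i)%:MP by rewrite mulrC mul_mpolyC.
rewrite tnth_lin_forms [LHS]raddf_sum /= (bigD1 i) //= [X in _ + X]big1.
  by rewrite mderivZ mderivX mnm1E eqxx scale1r subm_self mpolyX0 addr0 alg_mpolyC.
by move=> l li; rewrite mderivZ mderivX mnm1E (negPf li) scale0r scaler0.
Qed.

End Calculus.

(** * Orthogonality and the apolar pairing *)

Section FiniteBasis.
Variables (C : fieldType) (W : lmodType C).

Lemma free_family_leq N t (x : 'I_N -> W) (e : 'I_t -> W) :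
  (forall j, exists c : 'I_N -> C, e j = \sum_l c l *: x l) ->
  (forall c : 'I_t -> C, \sum_i c i *: e i = 0 -> forall i, c i = 0) ->
  (t <= N)%N.
Proof.
move=> /fin_all_exists[c ec] fe; pose M := \matrix_(j, l) c j l.
rewrite leqNgt; apply/negP => ltNt.
have /rowV0Pn[v /sub_kermxP vM /eqP vN0] : kermx M != 0.
  rewrite kermx_eq0; apply/negP => /eqP rM.
  by have := rank_leq_col M; rewrite rM leqNgt ltNt.
apply: vN0; apply/rowP => i; rewrite mxE; apply: (fe (v 0)).
under eq_bigr do rewrite ec scaler_sumr.
rewrite exchange_big big1 //= => l _.
under eq_bigr do rewrite scalerA.
rewrite -scaler_suml; move/matrixP/(_ 0 l): vM; rewrite !mxE => vM.
rewrite (_ : \sum_i _ = 0) ?scale0r // -[RHS]vM.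
by apply: eq_bigr => j _; rewrite mxE.
Qed.

(** A free family in P of maximal size. *)
Lemma ex_basis N (x : 'I_N -> W) (P : W -> Prop) :
  P 0 -> (forall c u v, P u -> P v -> P (c *: u + v)) ->
  (forall u, P u -> exists c : 'I_N -> C, u = \sum_l c l *: x l) ->
  exists t (e : 'I_t -> W), is_basis P e.
Proof.
move=> P0 PL Px.
suff H k t (e : 'I_t -> W) : (N - t <= k)%N -> (forall i, P (e i)) ->
    (forall c : 'I_t -> C, \sum_i c i *: e i = 0 -> forall i, c i = 0) ->
    exists t' (e' : 'I_t' -> W), is_basis P e'.
  apply: (H N 0%N (fun _ => 0)); first exact: leq_subr.
    by case.
  by move=> c _ [].
elim: k t e => [|k IHk] t e Nt Pe fe.
all: have [sp|] := EM (forall u, P u -> exists c : 'I_t -> C, u = \sum_i c i *: e i);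
  first by exists t, e.
all: move=> /existsNP[u /not_implyP[Pu nu]].
all: pose e' (i : 'I_t.+1) := if unlift ord0 i is Some j then e j else u.
all: have Pe' i : P (e' i) by rewrite /e'; case: unlift.
all: have fe' (c : 'I_t.+1 -> C) : \sum_i c i *: e' i = 0 -> forall i, c i = 0.
1,3: rewrite big_ord_recl {1}/e' unlift_none.
1,2: under eq_bigr do rewrite /e' liftK.
1,2: move=> c0; have c00 : c ord0 = 0.
1,3: apply/eqP; apply: contrapT => /negP c0N; apply: nu.
1,2: exists (fun i => - (c ord0)^-1 * c (lift ord0 i)).
1,2: under eq_bigr do rewrite -scalerA.
1,2: rewrite -scaler_sumr; apply: (scalerI c0N).
1,2: by rewrite scalerA mulrN mulfV // scaleN1r; apply/eqP; rewrite -addr_eq0 c0.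
1,2: move=> i; case: (unliftP ord0 i) => [j|] -> //.
1,2: by apply: (fe (fun j => c (lift ord0 j))); rewrite -[RHS]c0 c00 scale0r add0r.
  have := free_family_leq (fun j => Px _ (Pe' j)) fe'.
  by rewrite ltnNge -subn_eq0 (eqP (_ : N - t == 0)%N) // -leqn0.
apply: (IHk _ e') => //.
have := free_family_leq (fun j => Px _ (Pe' j)) fe' => ltN.
by rewrite subnS -ltnS prednK // subn_gt0.
Qed.

End FiniteBasis.

(** Orthogonal projection onto a finite-dimensional subspace for an anisotropic
    sesquilinear form: the Gram matrix of a basis is invertible. *)
Lemma ortho_proj (C : numClosedFieldType) (W : lmodType C) (h : W -> W -> C)
    N (x : 'I_N -> W) (P : W -> Prop) :
  (forall u c v w, h u (c *: v + w) = c * h u v + h u w) ->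
  (forall u c v w, h (c *: u + v) w = c^* * h u w + h v w) ->
  (forall u, h u u = 0 -> u = 0) ->
  P 0 -> (forall c u v, P u -> P v -> P (c *: u + v)) ->
  (forall u, P u -> exists c : 'I_N -> C, u = \sum_l c l *: x l) ->
  forall q, exists2 i, P i & forall p, P p -> h p (q - i) = 0.
Proof.
move=> hr hl h0 P0 PL Px q; have [t [e [Pe fe se]]] := ex_basis P0 PL Px.
have hr0 u : h u 0 = 0.
  by have := hr u (-1) 0 0; rewrite scaler0 add0r mulN1r addNr.
have hl0 w : h 0 w = 0.
  by have := hl 0 (-1) 0 w; rewrite scaler0 add0r rmorphN1 mulN1r addNr.
have hrs u (s : seq 'I_t) (c : 'I_t -> C) (E : 'I_t -> W) :
    h u (\sum_(i <- s) c i *: E i) = \sum_(i <- s) c i * h u (E i).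
  by elim: s => [|i s IHs]; rewrite ?big_nil ?hr0 // !big_cons hr IHs.
have hls w (s : seq 'I_t) (c : 'I_t -> C) (E : 'I_t -> W) :
    h (\sum_(i <- s) c i *: E i) w = \sum_(i <- s) (c i)^* * h (E i) w.
  by elim: s => [|i s IHs]; rewrite ?big_nil ?hl0 // !big_cons hl IHs.
have Ps (c : 'I_t -> C) (s : seq 'I_t) : P (\sum_(i <- s) c i *: e i).
  by elim: s => [|i s IHs]; rewrite ?big_nil // big_cons; apply: PL.
pose Gm := \matrix_(i, j) h (e i) (e j).
have uG : Gm \in unitmx.
  rewrite unitmxE unitfE; apply/negP => /det0P[v /eqP vN0 vG]; apply: vN0.
  apply/rowP => i; rewrite mxE; apply/eqP; rewrite -conjC_eq0; apply/eqP.
  apply: (fe (fun i => (v 0 i)^*)).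
  apply: h0; rewrite hrs big1 // => j _.
  rewrite hls; move/matrixP/(_ 0 j): vG; rewrite !mxE => vG.
  suff -> : \sum_i (v 0 i)^*^* * h (e i) (e j) = 0 by rewrite mulr0.
  by rewrite -[RHS]vG; apply: eq_bigr => l _; rewrite conjCK mxE.
pose c := invmx Gm *m \col_i h (e i) q.
exists (\sum_i c i 0 *: e i) => [|p /se[d ->]]; first exact: Ps.
rewrite hls big1 // => i _.
rewrite -scaleN1r addrC hr hrs mulN1r.
have /matrixP/(_ i 0) : Gm *m c = \col_i h (e i) q by rewrite mulKVmx.
rewrite !mxE => <-; rewrite (_ : - _ + _ = 0) ?mulr0 //.
by apply/eqP; rewrite addrC subr_eq0; apply/eqP/eq_bigr => j _; rewrite mxE mulrC.
Qed.

Section Pairing.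
Variables (C : fieldType) (n : nat).
Implicit Types (p q f : {mpoly C[n]}).

Lemma sum_msuppE (W : lmodType C) p k (F : 'X_{1..n} -> W) : (msize p <= k)%N ->
  \sum_(m <- msupp p) p@_m *: F m = \sum_(m : 'X_{1..n < k}) p@_m *: F m.
Proof.
move=> lt_pk; pose I : subFinType _ := 'X_{1..n < k}.
rewrite (big_mksub I) //=; first last.
- by move=> x /msize_mdeg_lt /leq_trans; apply.
- by rewrite msupp_uniq.
by rewrite big_rmcond //= => i; move/memN_msupp_eq0 ->; rewrite scale0r.
Qed.

Lemma diffop_linl f : linear (diffop (C := C) (r := n) ^~ f).
Proof.
move=> c p q; rewrite /diffop.
pose k := maxn (msize (c *: p + q)) (maxn (msize p) (msize q)).
rewrite !(@sum_msuppE _ _ k) ?leq_max ?leqnn ?orbT //.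
rewrite scaler_sumr -big_split /=; apply: eq_bigr => m _.
by rewrite mcoeffD mcoeffZ scalerDl scalerA.
Qed.

Lemma diffop_is_linear p : linear (diffop (C := C) (r := n) p).
Proof.
move=> c f g; rewrite /diffop scaler_sumr -big_split /=; apply: eq_bigr => m _.
by rewrite linearP scalerDr !scalerA mulrC.
Qed.

HB.instance Definition _ p :=
  GRing.isLinear.Build C {mpoly C[n]} {mpoly C[n]} _ (diffop (C := C) (r := n) p)
    (diffop_is_linear p).

Lemma diffop0l f : diffop 0 f = 0.
Proof. by rewrite /diffop msupp0 big_nil. Qed.

Lemma diffopDl p q f : diffop (p + q) f = diffop p f + diffop q f.
Proof. by have := diffop_linl f 1 p q; rewrite !scale1r. Qed.

Lemma diffopZl c p f : diffop (c *: p) f = c *: diffop p f.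
Proof. by have := diffop_linl f c p 0; rewrite !addr0 diffop0l addr0. Qed.

Lemma diffopXl m f : diffop 'X_[m] f = f^`M[m].
Proof. by rewrite /diffop msuppX big_seq1 mcoeffX eqxx scale1r. Qed.

Lemma diffopCl c f : diffop c%:MP f = c *: f.
Proof. by rewrite -alg_mpolyC diffopZl -mpolyX0 diffopXl mderivm0m. Qed.

Lemma diffopM p q f : diffop (p * q) f = diffop p (diffop q f).
Proof.
elim/mpolyind: p => [|c m p _ _ IHp]; first by rewrite mul0r !diffop0l.
rewrite mulrDl !diffopDl IHp -scalerAl !diffopZl; congr (_ *: _ + _).
elim/mpolyind: q {IHp} => [|d l q _ _ IHq]; first by rewrite mulr0 !diffop0l linear0.
rewrite mulrDr !diffopDl linearD IHq -scalerAr !diffopZl; congr (_ + _).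
by rewrite linearZ /= -mpolyXD !diffopXl addmC mderivmDm.
Qed.

Lemma mderivm_comp_lsub (X : 'M[C]_n) p f :
  lsub X (diffop (lsub X^T p) f) = diffop p (lsub X f).
Proof.
elim/mpoly_ring_ind: p f => [c|i|p q IHp IHq|p q IHp IHq] f.
- by rewrite lsubC !diffopCl linearZ.
- rewrite lsubXU diffopXl mderivmU1m mderiv_lsub.
  rewrite (big_morph (fun p => diffop p f) (fun p q => diffopDl p q f) (diffop0l f)) raddf_sum /=.
  by apply: eq_bigr => j _; rewrite diffopZl linearZ /= diffopXl mderivmU1m mxE.
- by rewrite raddfD /= !diffopDl raddfD /= IHp IHq.
- by rewrite rmorphM /= !diffopM -IHq -IHp.
Qed.

(** The apolar pairing between polynomials on V and on its dual. *)
Definition pairing p f := (diffop p f)@_0%MM.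

Lemma pairing_lsub (X : 'M[C]_n) p f :
  pairing (lsub X^T p) f = pairing p (lsub X f).
Proof. by rewrite /pairing -mderivm_comp_lsub lsub_coef0. Qed.

Lemma pairingE p f : pairing p f =
  \sum_(m <- msupp p) p@_m * f@_m * (\prod_(i < n) (m i)`!)%:R.
Proof.
rewrite /pairing /diffop raddf_sum; apply: eq_bigr => m _ /=.
rewrite mcoeffZ mcoeff_mderivm addm0 -mulrA -[X in _ * X = _]mulr_natr.
by congr (_ * (_ * _%:R)); apply: eq_bigr => i _; rewrite ffactnn.
Qed.

Lemma pairing_homog p f d e :
  p \is d.-homog -> f \is e.-homog -> d != e -> pairing p f = 0.
Proof.
move=> /dhomogP hp hf de; rewrite pairingE big_seq big1 // => m /hp dm.
by rewrite (dhomog_nemf_coeff hf) ?mulr0 ?mul0r // dm.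
Qed.

Lemma pairingXl m f : pairing 'X_[m] f = f@_m * (\prod_(i < n) (m i)`!)%:R.
Proof. by rewrite pairingE msuppX big_seq1 mcoeffX eqxx mul1r. Qed.

End Pairing.

Section PositiveDefinite.
Local Open Scope sesquilinear_scope.

(** The spectral theorem gives positive eigenvalues, which have square roots. *)
Lemma posdef_factor (C : numClosedFieldType) n (A : 'M[C]_n) :
  A^t* = A -> (forall v : 'rV_n, v != 0 -> 0 < (v *m A *m v^t*) 0 0) ->
  exists2 B : 'M_n, B \in unitmx & A = B^t* *m B.
Proof.
move=> hA posA; have nA : A \is normalmx by apply/normalmxP; rewrite hA.
have uP := spectral_unitarymx A; have := orthomx_spectralP nA.
move: (spectralmx A) (spectral_diag A) uP => P d uP; rewrite invmx_unitary // => eA.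
have d0 i : 0 < d 0 i.
  have /unitarymxP PP := uP.
  have eD : P *m A *m P^t* = diag_mx d by rewrite eA -!mulmxA PP mulmx1 mulmxA PP mul1mx.
  have PN0 : row i P != 0.
    apply/eqP => Pi0; have /matrixP/(_ i i) := PP.
    rewrite !mxE eqxx big1 => [/eqP|j _]; first by rewrite eq_sym oner_eq0.
    by move/rowP/(_ j): Pi0; rewrite !mxE => ->; rewrite mul0r.
  have := posA _ PN0; have /matrixP/(_ i i) := eD.
  rewrite mxE [RHS]mxE eqxx mulr1n => <-; rewrite -row_mul mxE.
  by congr (0 < _); apply: eq_bigr => j _; rewrite !mxE.
exists (diag_mx (map_mx sqrtC d) *m P).
  rewrite unitmx_mul (unitarymx_unit uP) andbT unitmxE det_diag unitfE.
  apply/prodf_neq0 => i _; rewrite mxE sqrtC_eq0; exact: lt0r_neq0.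
rewrite trmx_mul map_mxM tr_diag_mx map_diag_mx eA -!mulmxA; congr (_ *m _).
rewrite mulmxA mulmx_diag; congr (diag_mx _ *m _).
apply/rowP => i; rewrite !mxE /= geC0_conj ?sqrtC_ge0 ?ltW //.
by rewrite -expr2 sqrtCK.
Qed.

End PositiveDefinite.

(** * Group actions on polynomials *)

Section PolyAction.
Variables (C : numClosedFieldType) (gT : finGroupType) (G : {group gT}) (n : nat).
Variable rG : mx_representation C G n.
Implicit Types (p q : {mpoly C[n]}) (g h : gT).

HB.instance Definition _ g :=
  GRing.RMorphism.copy (polyact rG g) (lsub (rG g^-1%g)).
HB.instance Definition _ g :=
  GRing.Linear.copy (polyact rG g) (lsub (rG g^-1%g)).

Lemma polyactE g p : polyact rG g p = lsub (rG g^-1%g) p.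
Proof. by []. Qed.

Lemma polyactC g c : polyact rG g c%:MP = c%:MP.
Proof. exact: lsubC. Qed.

Lemma polyact_sum g I (s : seq I) (P : pred I) (F : I -> {mpoly C[n]}) :
  polyact rG g (\sum_(i <- s | P i) F i) = \sum_(i <- s | P i) polyact rG g (F i).
Proof. exact: raddf_sum. Qed.

Lemma polyact_add g p q : polyact rG g (p + q) = polyact rG g p + polyact rG g q.
Proof. exact: raddfD. Qed.

Lemma polyact_mul g p q : polyact rG g (p * q) = polyact rG g p * polyact rG g q.
Proof. exact: rmorphM. Qed.

Lemma polyact_scale g c p : polyact rG g (c *: p) = c *: polyact rG g p.
Proof. exact: linearZ. Qed.

Lemma polyact0 g : polyact rG g 0 = 0.
Proof. exact: raddf0. Qed.

Lemma polyactM g h p : g \in G -> h \in G ->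
  polyact rG (g * h) p = polyact rG g (polyact rG h p).
Proof. by move=> Gg Gh; rewrite !polyactE lsubM invMg repr_mxM ?groupV. Qed.

Lemma polyact1 p : polyact rG 1 p = p.
Proof. by rewrite polyactE invg1 repr_mx1 lsub1. Qed.

Lemma polyactK g : g \in G -> cancel (polyact rG g) (polyact rG g^-1).
Proof. by move=> Gg p; rewrite -polyactM ?groupV // mulVg polyact1. Qed.

Lemma polyact_coef0 g p : (polyact rG g p)@_0%MM = p@_0%MM.
Proof. exact: lsub_coef0. Qed.

Lemma polyact_homog g d p : p \is d.-homog -> polyact rG g p \is d.-homog.
Proof. exact: lsub_homog. Qed.

Lemma polyact_eq0 g p : g \in G -> (polyact rG g p == 0) = (p == 0).
Proof.
move=> Gg; apply/eqP/eqP => [e|->]; last exact: raddf0.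
by rewrite -[p](polyactK Gg) e raddf0.
Qed.

Lemma euler_polyact g (w : 'I_n -> C) p : 
  (forall i j, rG g^-1%g i j != 0 -> w i = w j) ->
  euler w (polyact rG g p) = polyact rG g (euler w p).
Proof. exact: euler_lsub. Qed.

Lemma invariantC c : invariant rG c%:MP.
Proof. by move=> g _; rewrite polyactC. Qed.

Lemma invariant0 : invariant rG 0.
Proof. by rewrite -(mpolyC0 n); apply: invariantC. Qed.

Lemma invariantD p q : invariant rG p -> invariant rG q -> invariant rG (p + q).
Proof. by move=> ip iq g Gg; rewrite raddfD /= ip ?iq. Qed.

Lemma invariantM p q : invariant rG p -> invariant rG q -> invariant rG (p * q).
Proof. by move=> ip iq g Gg; rewrite rmorphM /= ip ?iq. Qed.

Lemma invariantZ c p : invariant rG p -> invariant rG (c *: p).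
Proof. by move=> ip g Gg; rewrite linearZ /= ip. Qed.

Lemma polyact_pihomog g d p :
  polyact rG g (pihomog mdeg d p) = pihomog mdeg d (polyact rG g p).
Proof.
have -> : pihomog mdeg d (polyact rG g p) =
    \sum_(i < msize p) pihomog mdeg d (polyact rG g (pihomog mdeg i p)).
  rewrite [p in LHS](pihomog_partitionE (leqnn (msize p))) polyact_sum.
  by rewrite (raddf_sum (pihomog mdeg d)).
have e (i : nat) : pihomog mdeg d (polyact rG g (pihomog mdeg i p)) =
    if i == d then polyact rG g (pihomog mdeg i p) else 0.
  have h : polyact rG g (pihomog mdeg i p) \is i.-homog by apply/polyact_homog/pihomogP.
  by case: eqVneq h => [->|id] h; [apply: pihomog_dE | apply: pihomog_ne0 h].
under eq_bigr do rewrite e.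
have [ltd|led] := ltnP d (msize p).
  rewrite (bigD1 (Ordinal ltd)) //= eqxx big1 ?addr0 // => i.
  by rewrite -val_eqE /= => /negPf ->.
rewrite big1 => [|i _]; last by rewrite ltn_eqF // (leq_trans (ltn_ord i) led).
rewrite pihomogE big_seq_cond big1 ?raddf0 // => m /andP[mp /eqP /= em].
by move: (msize_mdeg_lt mp); rewrite em ltnNge led.
Qed.

Lemma invariant_pihomog d p : invariant rG p -> invariant rG (pihomog mdeg d p).
Proof. by move=> ip g Gg; rewrite polyact_pihomog ip. Qed.

Definition reynolds p := #|G|%:R^-1 *: \sum_(g in G) polyact rG g p.

Lemma cardG_neq0 : #|G|%:R != 0 :> C.
Proof. by rewrite pnatr_eq0 -lt0n cardG_gt0. Qed.

Lemma reynolds_is_linear : linear reynolds.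
Proof.
move=> c p q; rewrite /reynolds scalerA mulrC -scalerA -scalerDr; congr (_ *: _).
rewrite scaler_sumr -big_split /=; apply: eq_bigr => g _.
by rewrite linearP.
Qed.

HB.instance Definition _ :=
  GRing.isLinear.Build C {mpoly C[n]} {mpoly C[n]} _ reynolds reynolds_is_linear.

Lemma reynoldsZ c p : reynolds (c *: p) = c *: reynolds p.
Proof. exact: linearZ. Qed.

Lemma reynolds_sum I (s : seq I) (P : pred I) (F : I -> {mpoly C[n]}) :
  reynolds (\sum_(i <- s | P i) F i) = \sum_(i <- s | P i) reynolds (F i).
Proof. exact: raddf_sum. Qed.

Lemma reynolds_inv p : invariant rG (reynolds p).
Proof.
move=> h Gh; rewrite linearZ /= polyact_sum; congr (_ *: _).
rewrite [RHS](reindex_inj (mulgI h)) /=; apply: eq_big => [g|g Gg].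
  by rewrite groupMl.
by rewrite polyactM.
Qed.

Lemma reynoldsM a p : invariant rG a -> reynolds (a * p) = a * reynolds p.
Proof.
move=> ia; rewrite /reynolds -scalerAr mulr_sumr; congr (_ *: _).
by apply: eq_bigr => g Gg; rewrite rmorphM /= ia.
Qed.

Lemma reynolds_id p : invariant rG p -> reynolds p = p.
Proof.
move=> ip; rewrite /reynolds (eq_bigr (fun _ => p)) // sumr_const -scaler_nat.
by rewrite scalerA mulVf ?cardG_neq0 // scale1r.
Qed.

Lemma reynolds_coef0 p : (reynolds p)@_0%MM = p@_0%MM.
Proof.
rewrite mcoeffZ raddf_sum /= (eq_bigr (fun _ => p@_0%MM)); last first.
  by move=> g _; rewrite polyact_coef0.
by rewrite sumr_const -[X in _ * X = _]mulr_natl mulKf // cardG_neq0.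
Qed.

(** The Hilbert ideal, generated by the invariants without constant term. *)
Definition hilbert_ideal p := exists2 s : seq ({mpoly C[n]} * {mpoly C[n]}),
  forall x, x \in s -> invariant rG x.1 /\ x.1@_0%MM = 0 &
  p = \sum_(x <- s) x.1 * x.2.

Lemma hilbert_ideal0 : hilbert_ideal 0.
Proof. by exists [::] => //; rewrite big_nil. Qed.

Lemma hilbert_idealD p q : hilbert_ideal p -> hilbert_ideal q -> hilbert_ideal (p + q).
Proof.
move=> [s hs ->] [t ht ->]; exists (s ++ t); last by rewrite big_cat.
by move=> x; rewrite mem_cat => /orP[/hs|/ht].
Qed.

Lemma hilbert_idealMr p q : hilbert_ideal p -> hilbert_ideal (p * q).
Proof.
move=> [s hs ->]; exists [seq (x.1, x.2 * q) | x <- s].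
  by move=> x /mapP[y /hs hy ->].
by rewrite big_map mulr_suml; apply: eq_bigr => x _; rewrite mulrA.
Qed.

Lemma hilbert_idealMl p q : hilbert_ideal q -> hilbert_ideal (p * q).
Proof. by rewrite mulrC; apply: hilbert_idealMr. Qed.

Lemma hilbert_idealZ c p : hilbert_ideal p -> hilbert_ideal (c *: p).
Proof. by rewrite -mul_mpolyC; apply: hilbert_idealMl. Qed.

Lemma hilbert_idealB p q : hilbert_ideal p -> hilbert_ideal q -> hilbert_ideal (p - q).
Proof.
by move=> ip iq; rewrite -scaleN1r; apply/hilbert_idealD/hilbert_idealZ.
Qed.

Lemma hilbert_ideal_sum I (s : seq I) (P : pred I) (F : I -> {mpoly C[n]}) :
  (forall i, P i -> hilbert_ideal (F i)) -> hilbert_ideal (\sum_(i <- s | P i) F i).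
Proof.
move=> iF; elim/big_ind: _ => //; [exact: hilbert_ideal0|exact: hilbert_idealD].
Qed.

Lemma hilbert_ideal_gen a p : invariant rG a -> a@_0%MM = 0 -> hilbert_ideal (a * p).
Proof.
move=> ia a0; exists [:: (a, p)]; last by rewrite big_seq1.
by move=> x; rewrite inE => /eqP ->.
Qed.

Lemma hilbert_ideal_polyact g p : g \in G ->
  hilbert_ideal p -> hilbert_ideal (polyact rG g p).
Proof.
move=> Gg [s hs ->]; rewrite polyact_sum big_seq.
elim/big_ind: _ => [||x xs]; [exact: hilbert_ideal0|exact: hilbert_idealD|].
have [ix x0] := hs x xs; rewrite rmorphM /= ix //; exact: hilbert_ideal_gen.
Qed.

End PolyAction.

(** * Harmonic polynomials *)

Section ConjPoly.
Variables (C : numClosedFieldType) (n : nat).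
Implicit Types (p q : {mpoly C[n]}).

Definition conjp p : {mpoly C[n]} := map_mpoly conjC p.
HB.instance Definition _ := GRing.RMorphism.copy conjp (map_mpoly (n := n) conjC).

Lemma conjp_coef p m : (conjp p)@_m = (p@_m)^*.
Proof. exact: mcoeff_map_mpoly. Qed.

Lemma conjpK : involutive conjp.
Proof. by move=> p; apply/mpolyP => m; rewrite !conjp_coef conjCK. Qed.

Lemma conjpZ c p : conjp (c *: p) = c^* *: conjp p.
Proof. by apply/mpolyP => m; rewrite conjp_coef !mcoeffZ conjp_coef rmorphM. Qed.

Lemma conjpC c : conjp c%:MP = (c^*)%:MP.
Proof. exact: map_mpolyC. Qed.

Lemma conjpX m : conjp 'X_[m] = 'X_[m].
Proof. by apply/mpolyP => l; rewrite conjp_coef !mcoeffX conjC_nat. Qed.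

Lemma conjp_homog d p : p \is d.-homog -> conjp p \is d.-homog.
Proof.
move=> /dhomogP hp; apply/dhomogP => m; rewrite mcoeff_msupp conjp_coef conjC_eq0.
by rewrite -mcoeff_msupp; apply: hp.
Qed.

Lemma conjp_lsub (A : 'M[C]_n) p :
  conjp (lsub A p) = lsub (map_mx conjC A) (conjp p).
Proof.
elim/mpoly_ring_ind: p => [c|i|p q IHp IHq|p q IHp IHq].
- by rewrite lsubC conjpC lsubC.
- rewrite conjpX !lsubXU (raddf_sum conjp); apply: eq_bigr => j _ /=.
  by rewrite conjpZ conjpX mxE.
- by rewrite !raddfD /= IHp IHq.
- by rewrite !rmorphM /= IHp IHq.
Qed.

Lemma pairing_conj_eq0 p : pairing (conjp p) p = 0 -> p = 0.
Proof.
move/eqP; rewrite pairingE psumr_eq0 => [/allP h|m _]; last first.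
  by rewrite conjp_coef mulrC -normCKC mulr_ge0 ?ler0n ?exprn_ge0.
apply/mpolyP => m; rewrite mcoeff0; apply/eqP; apply: contraT => pm.
have /h : m \in msupp (conjp p) by rewrite mcoeff_msupp conjp_coef conjC_eq0.
rewrite /= conjp_coef !mulf_eq0 conjC_eq0 !(negPf pm) /= pnatr_eq0 eqn0Ngt.
by rewrite prodn_cond_gt0 // => i _; apply: fact_gt0.
Qed.

End ConjPoly.

Section HarmonicComplement.
Variables (C : numClosedFieldType) (gT : finGroupType) (G : {group gT}) (n : nat).
Variable rG : mx_representation C G n.
Implicit Types (p q : {mpoly C[n]}) (g h : gT).
Local Open Scope sesquilinear_scope.

(** The Gram matrix of an invariant hermitian inner product. *)
Definition inv_gram : 'M[C]_n := \sum_(g in G) (rG g)^t* *m rG g.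

Lemma inv_gramJ g : g \in G -> (rG g)^t* *m inv_gram *m rG g = inv_gram.
Proof.
move=> Gg; rewrite mulmx_sumr mulmx_suml [RHS](reindex_inj (mulIg g)) /=.
apply: eq_big => [h|h Gh]; first by rewrite groupMr.
by rewrite repr_mxM // trmx_mul map_mxM !mulmxA.
Qed.

Lemma inv_gram_herm : inv_gram^t* = inv_gram.
Proof.
rewrite !raddf_sum; apply: eq_bigr => g _ /=.
by rewrite trmx_mul map_mxM trmxCK.
Qed.

Lemma inv_gram_pos (v : 'rV_n) : v != 0 -> 0 < (v *m inv_gram *m v^t*) 0 0.
Proof.
move=> vN0; rewrite mulmx_sumr mulmx_suml summxE (bigD1 1%g) //=.
have e g : (v *m ((rG g)^t* *m rG g) *m v^t*) 0 0 =
    \sum_i `|(v *m (rG g)^t*) 0 i| ^+ 2.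
  rewrite mulmxA -[_ *m rG g *m _]mulmxA -[rG g]trmxCK -map_mxM -trmx_mul trmxCK.
  by rewrite mxE; apply: eq_bigr => i _; rewrite normCK !mxE.
apply: ltr_wpDr.
  by apply: sumr_ge0 => g _; rewrite e; apply: sumr_ge0 => i _; rewrite exprn_ge0.
rewrite e repr_mx1 trmx1 map_mx1 mulmx1.
have [i vi] := rV0Pn _ vN0; rewrite (bigD1 i) //= ltr_wpDr ?sumr_ge0 //.
  by move=> j _; rewrite exprn_ge0.
by rewrite exprn_gt0 // normr_gt0.
Qed.

Lemma inv_gram_factor : exists2 B : 'M_n, B \in unitmx & inv_gram = B^t* *m B.
Proof. exact: posdef_factor inv_gram_herm inv_gram_pos. Qed.

Lemma inv_gram_unit : inv_gram \in unitmx.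
Proof.
have [B uB ->] := inv_gram_factor.
by rewrite unitmx_mul uB andbT map_unitmx unitmx_tr.
Qed.

(** The conjugate-linear, multiplicative identification of the polynomials on V
    with those on the dual of V given by the invariant inner product. *)
Definition dualize p := lsub (invmx inv_gram)^T (conjp p).
Definition undualize q := conjp (lsub inv_gram^T q).

HB.instance Definition _ := GRing.RMorphism.copy dualize
  (lsub (invmx inv_gram)^T \o @conjp C n).
HB.instance Definition _ := GRing.RMorphism.copy undualize
  (@conjp C n \o lsub inv_gram^T).

Lemma dualizeK : cancel dualize undualize.
Proof.
move=> p; rewrite /dualize /undualize lsubM -trmx_mul mulmxV ?inv_gram_unit //.
by rewrite trmx1 lsub1 conjpK.
Qed.

Lemma undualizeK : cancel undualize dualize.
Proof.
move=> p; rewrite /dualize /undualize conjpK lsubM -trmx_mul mulVmx ?inv_gram_unit //.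
by rewrite trmx1 lsub1.
Qed.

Lemma dualizeZ c p : dualize (c *: p) = c^* *: dualize p.
Proof. by rewrite /dualize conjpZ linearZ. Qed.

Lemma dualize_polyact g p : g \in G ->
  dualize (polyact rG g p) = polyact (dual_repr rG) g (dualize p).
Proof.
move=> Gg; rewrite polyactE /dualize conjp_lsub polyactE /= /dual_mx invgK !lsubM.
congr lsub; apply: trmx_inj; rewrite trmx_mul map_trmx trmxK.
rewrite trmx_mul !trmxK; apply: (can_inj (mulmxK inv_gram_unit)).
rewrite mulmxKV ?inv_gram_unit //.
apply: (can_inj (mulKmx inv_gram_unit)).
rewrite !mulmxA mulmxV ?inv_gram_unit // mul1mx.
have := inv_gramJ (groupVr Gg) => e.
by rewrite -[inv_gram in RHS]e -[RHS]mulmxA -repr_mxM ?groupV // mulVg repr_mx1 mulmx1.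
Qed.

Lemma dualize_inv p : invariant rG p -> invariant (dual_repr rG) (dualize p).
Proof. by move=> ip g Gg; rewrite -dualize_polyact // ip. Qed.

Lemma undualize_inv p : invariant (dual_repr rG) p -> invariant rG (undualize p).
Proof.
move=> ip g Gg; apply: (can_inj dualizeK).
by rewrite dualize_polyact // undualizeK ip.
Qed.

Lemma dualize_coef0 p : (dualize p)@_0%MM = (p@_0%MM)^*.
Proof. by rewrite lsub_coef0 conjp_coef. Qed.

Lemma undualize_coef0 p : (undualize p)@_0%MM = (p@_0%MM)^*.
Proof. by rewrite conjp_coef lsub_coef0. Qed.

Lemma dualize_homog d p : p \is d.-homog -> dualize p \is d.-homog.
Proof. by move=> /conjp_homog; apply: lsub_homog. Qed.

Lemma undualize_homog d p : p \is d.-homog -> undualize p \is d.-homog.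
Proof. by move=> /lsub_homog hp; apply/conjp_homog/hp. Qed.

(** The Fischer inner product is anisotropic: in coordinates orthonormal for the
    invariant form it is the sum of the |p_m|^2 m!. *)
Lemma pairing_dualize_eq0 p : pairing (dualize p) p = 0 -> p = 0.
Proof.
have [B uB eA] := inv_gram_factor; pose X := invmx B.
have uX : X \in unitmx by rewrite unitmx_inv.
have -> : dualize p = lsub (X *m X^t*)^T (conjp p).
  congr (lsub _^T _); apply: (can_inj (mulmxK inv_gram_unit)).
  rewrite mulVmx ?inv_gram_unit // eA -mulmxA (mulmxA _ (B^t*)).
  by rewrite -map_mxM -trmx_mul mulmxV // trmx1 map_mx1 mul1mx mulVmx.
rewrite pairing_lsub -lsubM -{1}[X^t*]trmxK -pairing_lsub map_trmx.
rewrite trmxK -conjp_lsub trmxK => /pairing_conj_eq0 h.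
by rewrite -[p](lsubK uX) h raddf0.
Qed.

(** Writing p as the sum of the a x with a invariant without constant term, the
    operator dual to a kills p, so p is orthogonal to itself. *)
Lemma harmonic_ideal_eq0 p : harmonic rG p -> hilbert_ideal rG p -> p = 0.
Proof.
move=> hp [s hs ep]; apply: pairing_dualize_eq0.
rewrite {1}ep (raddf_sum dualize) /pairing.
rewrite (big_morph (fun q => diffop q p) (fun a b => diffopDl a b p) (diffop0l p)).
rewrite raddf_sum big_seq big1 // => x /hs[ix x0] /=.
rewrite rmorphM mulrC diffopM hp ?linear0 ?mcoeff0 //; first exact: dualize_inv.
by rewrite dualize_coef0 x0 conjC0.
Qed.

Lemma harmonic_polyact g p : g \in G -> harmonic rG p -> harmonic rG (polyact rG g p).
Proof.
move=> Gg hp a ia a0; rewrite polyactE -mderivm_comp_lsub.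
have -> : lsub (rG g^-1%g)^T a = a.
  have := ia _ (groupVr Gg); rewrite polyactE /= /dual_mx invgK => ->.
  by [].
by rewrite hp // raddf0.
Qed.

Lemma harmonic_linear c p q : harmonic rG p -> harmonic rG q -> harmonic rG (c *: p + q).
Proof. by move=> hp hq a ia a0; rewrite linearP /= hp // hq // scaler0 addr0. Qed.

Lemma harmonic0 : harmonic rG 0.
Proof. by move=> a _ _; rewrite linear0. Qed.

Lemma pihomog0_eq0 p : p@_0%MM = 0 -> pihomog mdeg 0 p = 0.
Proof.
move=> p0; rewrite pihomogE big_seq_cond big1 // => m /andP[mp].
rewrite mdeg_eq0 => /eqP m0.
by move: mp; rewrite m0 mcoeff_msupp p0 eqxx.
Qed.

(** Harmonic polynomials complement the Hilbert ideal: the orthogonal of its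
    degree k part consists of harmonic polynomials. *)
Lemma harmonic_decomp k q : q \is k.-homog -> exists c (s : seq ({mpoly C[n]} * {mpoly C[n]})),
  [/\ harmonic rG c, c \is k.-homog,
      forall x, x \in s -> [/\ invariant rG x.1, x.1@_0%MM = 0 &
         exists2 d, (d < k)%N & x.2 \is d.-homog]
    & q = c + \sum_(x <- s) x.1 * x.2].
Proof.
(* P is the part of degree k of the Hilbert ideal. *)
move=> hq; pose P p := exists2 s : seq ({mpoly C[n]} * {mpoly C[n]}),
  forall x, x \in s -> exists d, [/\ (d < k)%N, invariant rG x.1,
      x.1 \is (k - d).-homog & x.2 \is d.-homog] & p = \sum_(x <- s) x.1 * x.2.
have Phom p : P p -> p \is k.-homog.
  move=> [s hs ->]; rewrite big_seq; apply: rpred_sum => x /hs[d [dk _ h1 h2]].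
  by rewrite -(subnK (ltnW dk)); apply: dhomogM.
pose N := #|{: 'X_{1..n < k.+1}}|.
pose ev (l : 'I_N) : 'X_{1..n < k.+1} := enum_val l.
pose X (l : 'I_N) : {mpoly C[n]} := 'X_[ev l].
have [||||||i Pi hi] := @ortho_proj C _ (fun p q => pairing (dualize p) q) N X P _ _ _ _ _ _ q.
- by move=> u c v w; rewrite /pairing linearP /= mcoeffD mcoeffZ.
- move=> u c v w; rewrite /pairing raddfD /= dualizeZ diffopDl diffopZl.
  by rewrite mcoeffD mcoeffZ.
- exact: pairing_dualize_eq0.
- by exists [::] => //; rewrite big_nil.
- move=> c u v [s hs ->] [t ht ->].
  exists ([seq (c *: x.1, x.2) | x <- s] ++ t).
    move=> x; rewrite mem_cat => /orP[/mapP[y /hs[d [dk iy h1 h2]] ->]|/ht //].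
    by exists d; split=> //; [apply: invariantZ|apply: rpredZ].
  rewrite big_cat big_map scaler_sumr; congr (_ + _).
  by apply: eq_bigr => x _; rewrite -scalerAl.
- move=> u /Phom hu; have su : (msize u <= k.+1)%N.
    rewrite msizeE; apply/bigmax_leqP_seq => m mu _.
    by rewrite ltnS; move/dhomogP: hu => /(_ m mu) /= ->.
  exists (fun l => u@_(ev l)); rewrite {1}(mpolywE su).
  by rewrite (big_enum_val (fun m : 'X_{1..n < k.+1} => u@_m *: 'X_[m])).
pose c := q - i.
have hc : c \is k.-homog by apply: rpredB => //; apply: Phom.
have [s hs ei] := Pi; exists c, s; split=> //; last by rewrite -ei subrK.
(* Up to m!, the coefficient of a(d)c at m is the pairing of the dual of b y with c,
   where b is invariant without constant term: the part of degree k of b y lies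
   in P, and the other parts pair to 0 with c. *)
- move=> a ia a0; apply/mpolyP => m; rewrite mcoeff0; apply/eqP.
  have fN0 : (\prod_(i < n) (m i)`!)%:R != 0 :> C.
    by rewrite pnatr_eq0 -lt0n prodn_cond_gt0 // => l _; apply: fact_gt0.
  rewrite -[_ == 0]orbF -(negPf fN0) -mulf_eq0 -pairingXl /pairing -diffopM; apply/eqP.
  pose y := undualize 'X_[m]; pose b := undualize a.
  have hy : y \is (mdeg m).-homog by apply: undualize_homog; rewrite dhomogX.
  have ib : invariant rG b by apply: undualize_inv.
  have b0 : b@_0%MM = 0 by rewrite undualize_coef0 a0 conjC0.
  have -> : 'X_[m] * a = dualize (b * y) by rewrite rmorphM /= !undualizeK mulrC.
  rewrite {1}(pihomog_partitionE (leqnn (msize b))) mulr_suml (raddf_sum dualize).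
  rewrite (big_morph (fun q => diffop q c) (fun p q => diffopDl p q c) (diffop0l c)).
  rewrite raddf_sum big1 // => d _ /=.
  have hbd : pihomog mdeg d b \is d.-homog by apply: pihomogP.
  have hd : pihomog mdeg d b * y \is (d + mdeg m).-homog by apply: dhomogM.
  have [ek|nk] := eqVneq (d + mdeg m)%N k; last first.
    by apply: pairing_homog nk => //; apply: dualize_homog.
  have [d0|dN0] := eqVneq (d : nat) 0%N.
    by rewrite d0 pihomog0_eq0 // mul0r raddf0 diffop0l mcoeff0.
  apply: hi; exists [:: (pihomog mdeg d b, y)]; last by rewrite big_seq1.
  move=> x; rewrite inE => /eqP -> /=; exists (mdeg m); split=> //.
  + by rewrite -ek -{1}[mdeg m]add0n ltn_add2r lt0n.
  + exact: invariant_pihomog.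
  + by rewrite -ek addnK.
- move=> x /hs[d [dk ix h1 h2]]; split=> //; last by exists d.
  by apply: (dhomog_nemf_coeff h1); rewrite /= mdeg0 eq_sym -lt0n subn_gt0.
Qed.

End HarmonicComplement.

(** * Chevalley's freeness argument *)

Lemma comp_mpoly_congr (C : fieldType) n k (l : {mpoly C[k]})
    (t t' : n.-tuple {mpoly C[k]}) p :
  (forall i, exists q, tnth t i - tnth t' i = l * q) ->
  exists q, (p \mPo t) - (p \mPo t') = l * q.
Proof.
move=> tt'; elim/mpoly_ring_ind: p => [c|i|p q [p1 e1] [q1 e2]|p q [p1 e1] [q1 e2]].
- by exists 0; rewrite !comp_mpolyC subrr mulr0.
- by rewrite !comp_mpolyXU -!tnth_nth.
- by exists (p1 + q1); rewrite !comp_mpolyD opprD addrACA e1 e2 mulrDr.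
- exists (p1 * (q \mPo t) + (p \mPo t') * q1).
  rewrite mulrDr mulrA -e1 (mulrCA l) -e2 !rmorphM /=.
  by rewrite mulrBl mulrBr addrA subrK.
Qed.

Lemma gen_ind (gT : finGroupType) (G : {group gT}) (S : {set gT}) (P : gT -> Prop) :
  G :=: <<S>>%g -> P 1%g ->
  (forall g h, g \in G -> h \in G -> P g -> P h -> P (g * h)%g) ->
  (forall s, s \in S -> P s) -> forall g, g \in G -> P g.
Proof.
move=> GS P1 PM PS; pose K := [set g in G | `[< P g >]].
have gK : group_set K.
  apply/group_setP; split=> [|g h]; first by rewrite inE group1; apply/asboolP.
  rewrite !inE => /andP[Gg /asboolP Pg] /andP[Gh /asboolP Ph].
  by rewrite groupM //; apply/asboolP/PM.
have : <<S>>%g \subset Group gK.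
  rewrite gen_subG; apply/subsetP => s Ss.
  by rewrite inE GS mem_gen //=; apply/asboolP/PS.
by move=> /subsetP sGK g; rewrite GS => /sGK; rewrite inE => /andP[_ /asboolP].
Qed.

Section Chevalley.
Variables (C : numClosedFieldType) (gT : finGroupType) (G : {group gT}) (n : nat).
Variable rG : mx_representation C G n.
Implicit Types (p q : {mpoly C[n]}) (g h : gT).

(** The identity is allowed among the generators, so that the property passes to
    quotients. *)
Definition reflection_generated := exists2 S : {set gT}, G :=: <<S>>%g &
  forall s, s \in S -> exists (x : 'cV_n) (a : 'rV_n), rG s^-1%g = 1%:M + x *m a.

(** The two substitutions s and 1 agree on the hyperplane fixed by s. *)
Lemma reflection_dvd g (x : 'cV_n) (a : 'rV_n) p : rG g^-1%g = 1%:M + x *m a ->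
  exists q, polyact rG g p - p = (\sum_j a 0 j *: 'X_j) * q.
Proof.
move=> eg; rewrite -[X in _ - X]lsub1; apply: comp_mpoly_congr => i.
exists (x i 0)%:MP; rewrite !tnth_lin_forms -sumrB mulrC mul_mpolyC scaler_sumr.
apply: eq_bigr => j _; rewrite -scalerBl eg scalerA mxE addrAC subrr add0r.
by rewrite mxE big_ord1.
Qed.

Lemma mcoeffM_low (a b : {mpoly C[n]}) mu :
  (forall m, (mdeg m < mdeg mu)%N -> a@_m = 0) -> (a * b)@_mu = a@_mu * b@_0%MM.
Proof.
move=> a0; rewrite mcoeffM.
have h0 : (mdeg (0%MM : 'X_{1..n}) < (mdeg mu).+1)%N by rewrite mdeg0.
rewrite (bigD1 (BMultinom (ltnSn (mdeg mu)), BMultinom h0)) /= ?addm0 //.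
rewrite [X in _ + X]big1 ?addr0 // => -[[m1 h1] [m2 h2]] /= /andP[/eqP em ne].
have [m20|m2N] := eqVneq m2 0%MM.
  have e1 : m1 = mu by rewrite em m20 addm0.
  by move: ne; rewrite xpair_eqE -!val_eqE /= e1 m20 !eqxx.
by rewrite a0 ?mul0r // em mdegD -{1}[mdeg m1]addn0 ltn_add2l lt0n mdeg_eq0.
Qed.

(** A linear relation with invariant coefficients yields relations modulo the
    Hilbert ideal between its other factors: the reflections lower the degree of
    the [h i], and averaging treats the constant term. *)
Lemma chevalley_relation : reflection_generated -> forall N (a h : 'I_N -> {mpoly C[n]}) mu,
  (forall i, invariant rG (a i)) ->
  (forall i m, (mdeg m < mdeg mu)%N -> (a i)@_m = 0) ->
  \sum_i a i * h i = 0 -> hilbert_ideal rG (\sum_i (a i)@_mu *: h i).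
Proof.
move=> [S GS hS] N a h mu ia a0.
suff H k : (forall i, (msize (h i) <= k)%N) -> \sum_i a i * h i = 0 ->
    hilbert_ideal rG (\sum_i (a i)@_mu *: h i).
  by apply: (H (\max_i msize (h i))%N) => i; apply: leq_bigmax.
elim: k h => [|k IHk] h hk ah.
  rewrite big1 => [|i _]; first exact: hilbert_ideal0.
  by move: (hk i); rewrite leqn0 msize_poly_eq0 => /eqP ->; rewrite scaler0.
pose H := \sum_i (a i)@_mu *: h i; rewrite -/H.
have actH g : polyact rG g H = \sum_i (a i)@_mu *: polyact rG g (h i).
  by rewrite polyact_sum; apply: eq_bigr => i _; rewrite linearZ.
(* Dividing s h_i - h_i by the root of s keeps the relation and lowers the degree. *)
have HS s : s \in S -> hilbert_ideal rG (polyact rG s H - H).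
  move=> Ss; have [x [v es]] := hS s Ss; pose l := \sum_j v 0 j *: 'X_j : {mpoly C[n]}.
  have Gs : s \in G by rewrite GS mem_gen.
  have /fin_all_exists[h' eh] i := reflection_dvd (h i) es.
  have eH : polyact rG s H - H = l * \sum_i (a i)@_mu *: h' i.
    rewrite actH -sumrB mulr_sumr; apply: eq_bigr => i _.
    by rewrite -scalerBr eh scalerAr.
  rewrite eH; have [->|lN0] := eqVneq l 0; first by rewrite mul0r; apply: hilbert_ideal0.
  apply: hilbert_idealMl; apply: IHk => [i|].
    have [->|hN0] := eqVneq (h' i) 0; first by rewrite msize0.
    have sl : msize l = 2%N.
      rewrite -mlead_deg //; have := mlead_supp lN0.
      by move/dhomogP: (lin_form_homog (v 0)) => /[apply] /= ->.
    have := msizeM lN0 hN0; rewrite sl -eh add2n /= => es'.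
    rewrite -ltnS -es' (leq_trans (msizeD_le _ _)) // geq_max msizeN hk andbT.
    exact: leq_trans (lsub_msize _ _) (hk i).
  apply: (mulfI lN0); rewrite mulr0 mulr_sumr.
  under eq_bigr do rewrite mulrCA -eh mulrBr.
  rewrite sumrB ah subr0 -[RHS](polyact0 rG s) -[X in polyact _ _ X]ah polyact_sum.
  by apply: eq_bigr => i _; rewrite rmorphM /= ia.
have HG g : g \in G -> hilbert_ideal rG (polyact rG g H - H).
  move: g; apply: (gen_ind GS) => [|g1 g2 G1 G2 H1 H2|//].
    by rewrite polyact1 subrr; apply: hilbert_ideal0.
  rewrite (polyactM _ _ G1 G2) -(subrK (polyact rG g1 H) (polyact rG g1 _)) -addrA.
  rewrite -(raddfB (polyact rG g1)).
  exact: hilbert_idealD (hilbert_ideal_polyact G1 H2) H1.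
have HR : hilbert_ideal rG (reynolds rG H - H).
  have -> : reynolds rG H - H = #|G|%:R^-1 *: \sum_(g in G) (polyact rG g H - H).
    rewrite sumrB sumr_const scalerBr -[H *+ _]scaler_nat scalerA.
    by rewrite mulVf ?cardG_neq0 // scale1r.
  by apply/hilbert_idealZ/hilbert_ideal_sum => g Gg; apply: HG.
(* The average of H is invariant; in the averaged relation, the coefficient of mu
   involves only the constant terms of the averages, as the a_i start at mu. *)
have R0 : (reynolds rG H)@_0%MM = 0.
  have e : \sum_i a i * reynolds rG (h i) = 0.
    under eq_bigr do rewrite -reynoldsM //.
    by rewrite -reynolds_sum ah raddf0.
  rewrite /H reynolds_sum raddf_sum -[RHS](mcoeff0 C mu) -[X in mcoeff _ X]e.
  rewrite raddf_sum /=; apply: eq_bigr => i _.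
  by rewrite reynoldsZ mcoeffZ mcoeffM_low //; apply: a0.
rewrite -[H](subKr (reynolds rG H)); apply: hilbert_idealB => //.
rewrite -[reynolds _ _]mulr1; apply: hilbert_ideal_gen => //; exact: reynolds_inv.
Qed.

End Chevalley.

(** * Covariants *)

Section Matrices.
Variables (C : fieldType) (n : nat).

Definition cmx m k (A : 'M[C]_(m, k)) : 'M[{mpoly C[n]}]_(m, k) :=
  map_mx (@mpolyC n C) A.

Lemma cmxM m k l (A : 'M[C]_(m, k)) (B : 'M_(k, l)) : cmx (A *m B) = cmx A *m cmx B.
Proof. exact: map_mxM. Qed.

Lemma cmx1 m : cmx (1%:M : 'M_m) = 1%:M.
Proof. exact: map_mx1. Qed.

Lemma cmxD m k (A B : 'M[C]_(m, k)) : cmx (A + B) = cmx A + cmx B.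
Proof. exact: map_mxD. Qed.

Lemma cmx_inj m k : injective (@cmx m k).
Proof.
move=> A B /matrixP e; apply/matrixP => i j; have := e i j; rewrite !mxE.
by move/eqP; rewrite mpolyC_eq => /eqP.
Qed.

Definition mx0 m k (A : 'M[{mpoly C[n]}]_(m, k)) : 'M[C]_(m, k) :=
  map_mx (mcoeff 0%MM) A.

Lemma mx0M m k l (A : 'M[{mpoly C[n]}]_(m, k)) (B : 'M_(k, l)) :
  mx0 (A *m B) = mx0 A *m mx0 B.
Proof. exact: map_mxM. Qed.

Lemma mx0D m k (A B : 'M[{mpoly C[n]}]_(m, k)) : mx0 (A + B) = mx0 A + mx0 B.
Proof. exact: map_mxD. Qed.

Lemma mx0_char_poly m (A : 'M[{mpoly C[n]}]_m) :
  char_poly (mx0 A) = map_poly (mcoeff 0%MM) (char_poly A).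
Proof. by rewrite map_char_poly. Qed.

Lemma mx0K m k (A : 'M[C]_(m, k)) : mx0 (cmx A) = A.
Proof. by apply/matrixP => i j; rewrite !mxE mpolyCK. Qed.

Definition eulermx (w : 'I_n -> C) m k (A : 'M[{mpoly C[n]}]_(m, k)) := map_mx (euler w) A.

Lemma cmxE m k (A : 'M[C]_(m, k)) i j : cmx A i j = (A i j)%:MP.
Proof. exact: mxE. Qed.

Lemma mx0E m k (A : 'M[{mpoly C[n]}]_(m, k)) i j : mx0 A i j = (A i j)@_0%MM.
Proof. exact: mxE. Qed.

Lemma eulermxE w m k (A : 'M[{mpoly C[n]}]_(m, k)) i j : eulermx w A i j = euler w (A i j).
Proof. exact: mxE. Qed.

Lemma eulermxM w m k l (A : 'M[{mpoly C[n]}]_(m, k)) (B : 'M_(k, l)) :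
  eulermx w (A *m B) = eulermx w A *m B + A *m eulermx w B.
Proof.
apply/matrixP => i j; rewrite !mxE raddf_sum -big_split; apply: eq_bigr => s _ /=.
by rewrite eulerM !mxE.
Qed.

Lemma eulermx_cmx w m k (A : 'M[C]_(m, k)) : eulermx w (cmx A) = 0.
Proof. by apply/matrixP => i j; rewrite !mxE eulerC. Qed.

Lemma mx0_eulermx w m k (A : 'M[{mpoly C[n]}]_(m, k)) : mx0 (eulermx w A) = 0.
Proof. by apply/matrixP => i j; rewrite !mxE euler_coef0. Qed.

Lemma eulermx_cmxl w m k l (A : 'M[C]_(m, k)) (B : 'M_(k, l)) :
  eulermx w (cmx A *m B) = cmx A *m eulermx w B.
Proof. by rewrite eulermxM eulermx_cmx mul0mx add0r. Qed.

Lemma eulermx_cmxr w m k l (A : 'M_(m, k)) (B : 'M[C]_(k, l)) :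
  eulermx w (A *m cmx B) = eulermx w A *m cmx B.
Proof. by rewrite eulermxM eulermx_cmx mulmx0 addr0. Qed.

End Matrices.
Arguments cmx {C} n {m k} A.
Arguments mx0 {C n m k} A.
Arguments eulermx {C n} w {m k} A.

Global Opaque cmx mx0 eulermx.

Lemma mulmx_detI (R : idomainType) m n (B : 'M[R]_n) (A A' : 'M[R]_(m, n)) :
  \det B != 0 -> A *m B = A' *m B -> A = A'.
Proof.
move=> dB /(congr1 (mulmx^~ (\adj B))); rewrite -!mulmxA mul_mx_adj !mul_mx_scalar.
exact: scalemx_inj.
Qed.

Lemma det_mul_pid0 (R : comNzRingType) n k (A : 'M[R]_(n, k)) :
  (k < n)%N -> \det (A *m (pid_mx k : 'M_(k, n))) = 0.
Proof.
case: n A => // n A kn; rewrite (expand_det_col _ ord_max) big1 // => i _.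
rewrite mxE big1 ?mul0r // => j _; rewrite !mxE /=.
by rewrite ltn_eqF ?mulr0 // (leq_trans (ltn_ord j)).
Qed.

Section Covariants.
Variables (C : numClosedFieldType) (gT : finGroupType) (G : {group gT}) (n : nat).
Variable rG : mx_representation C G n.
Implicit Types (p q : {mpoly C[n]}) (g h : gT).
Local Notation S := {mpoly C[n]}.

Definition actmx g m k (A : 'M[S]_(m, k)) : 'M[S]_(m, k) := map_mx (polyact rG g) A.
Lemma actmxE g m k (A : 'M[S]_(m, k)) i j : actmx g A i j = polyact rG g (A i j).
Proof. exact: mxE. Qed.

Lemma actmx_sum g m k I (s : seq I) (P : pred I) (F : I -> 'M[S]_(m, k)) :
  actmx g (\sum_(i <- s | P i) F i) = \sum_(i <- s | P i) actmx g (F i).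
Proof. exact: (raddf_sum (map_mx (polyact rG g))). Qed.

Lemma actmxZ g m k p (A : 'M[S]_(m, k)) : actmx g (p *: A) = polyact rG g p *: actmx g A.
Proof. exact: map_mxZ. Qed.

Lemma actmx_comp g h m k (A : 'M[S]_(m, k)) : g \in G -> h \in G ->
  actmx (g * h) A = actmx g (actmx h A).
Proof. by move=> Gg Gh; apply/matrixP => i j; rewrite !actmxE (polyactM _ _ Gg Gh). Qed.

Definition invmat m k (A : 'M[S]_(m, k)) := forall g, g \in G -> actmx g A = A.

Lemma actmxM g m k l (A : 'M[S]_(m, k)) (B : 'M_(k, l)) :
  actmx g (A *m B) = actmx g A *m actmx g B.
Proof. exact: map_mxM. Qed.

Lemma actmx_cmx g m k (A : 'M[C]_(m, k)) : actmx g (cmx n A) = cmx n A.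
Proof. by apply/matrixP => i j; rewrite !mxE polyactC. Qed.

Lemma invmatP m k (A : 'M[S]_(m, k)) :
  invmat A <-> forall i j, invariant rG (A i j).
Proof.
split=> [iA i j g Gg|iA g Gg]; first by move/matrixP/(_ i j): (iA g Gg); rewrite mxE.
by apply/matrixP => i j; rewrite mxE iA.
Qed.

Lemma invmatM m k l (A : 'M[S]_(m, k)) (B : 'M_(k, l)) :
  invmat A -> invmat B -> invmat (A *m B).
Proof. by move=> iA iB g Gg; rewrite actmxM iA ?iB. Qed.

Lemma invmat_cmx m k (A : 'M[C]_(m, k)) : invmat (cmx n A).
Proof. by move=> g _; rewrite actmx_cmx. Qed.

Opaque actmx.
Definition mxsE := (mxE, cmxE, mx0E, eulermxE, actmxE).

Section Module.
Variables (m : nat) (rM : mx_representation C G m).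

(** The rows of a covariant matrix are the elements of (S(V^* ) (x) M^* )^G. *)
Definition covariant k (W : 'M[S]_(k, m)) :=
  forall g, g \in G -> actmx g W = W *m cmx n (rM g).

Lemma cmx_reprK g : g \in G -> cmx n (rM g) *m cmx n (rM g^-1%g) = 1%:M.
Proof. by move=> Gg; rewrite -cmxM -repr_mxM ?groupV // mulgV repr_mx1 cmx1. Qed.

Lemma cmx_reprVK g : g \in G -> cmx n (rM g^-1%g) *m cmx n (rM g) = 1%:M.
Proof. by move=> Gg; rewrite -cmxM -repr_mxM ?groupV // mulVg repr_mx1 cmx1. Qed.

Lemma cmx_repr_inj g k (A B : 'M[S]_(k, m)) : g \in G ->
  A *m cmx n (rM g) = B *m cmx n (rM g) -> A = B.
Proof.
move=> Gg /(congr1 (mulmx^~ (cmx n (rM g^-1%g)))) /=.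
by rewrite -!mulmxA cmx_reprK // !mulmx1.
Qed.

Lemma tensact_mx g (u : {ffun 'I_m -> S}) :
  \row_k tensact rG (dual_repr rM) g u k = actmx g (\row_j u j) *m cmx n (rM g^-1%g).
Proof.
apply/rowP => k; rewrite !mxsE ffunE; apply: eq_bigr => j _.
by rewrite !mxsE mulrC mul_mpolyC.
Qed.

Lemma tensact_covariant (u : {ffun 'I_m -> S}) :
  (forall g, g \in G -> tensact rG (dual_repr rM) g u = u) <->
  covariant (\row_j u j).
Proof.
split=> h g Gg.
  by rewrite -[LHS]mulmx1 -(cmx_reprVK Gg) mulmxA -tensact_mx h.
apply/ffunP => k; have /rowP/(_ k) := tensact_mx g u.
by rewrite h // -mulmxA cmx_reprK // mulmx1 !mxsE.
Qed.

Lemma eulermx_act g k l (A : 'M[S]_(k, l)) :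
  eulermx (fun _ => 1) (actmx g A) = actmx g (eulermx (fun _ => 1) A).
Proof. by apply/matrixP => i j; rewrite !mxsE; apply: euler_polyact. Qed.

Definition norm_poly p := \prod_(g in G) polyact rG g p.

Lemma norm_poly_inv p : invariant rG (norm_poly p).
Proof.
move=> h Gh; rewrite rmorph_prod /= [RHS](reindex_inj (mulgI h)) /=.
by apply: eq_big => [g|g Gg]; [rewrite groupMl | rewrite (polyactM _ _ Gh Gg)].
Qed.

Lemma norm_poly_eq0 p : norm_poly p = 0 -> p = 0.
Proof.
by move=> /eqP /prodf_eq0 [g Gg]; rewrite polyact_eq0 // => /eqP.
Qed.

(** Covariants independent over the invariants are independent over all
    polynomials: multiply one coefficient into a norm, then average. *)
Lemma covariant_free k (B : 'M[S]_(k, m)) : covariant B ->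
  (forall a : 'rV_k, invmat a -> a *m B = 0 -> a = 0) ->
  forall v : 'rV_k, v *m B = 0 -> v = 0.
Proof.
move=> cB fB v vB; apply/eqP; apply: contraT => /rV0Pn[i0 vi].
(* The other conjugates of v_i0: averaging q v keeps its entry at i0, a norm. *)
pose q := \prod_(g in G | g != 1%g) polyact rG g (v 0 i0).
have qv : q * v 0 i0 = norm_poly (v 0 i0).
  by rewrite /norm_poly (bigD1 1%g) //= polyact1 mulrC.
pose a := map_mx (reynolds rG) (q *: v).
have ia : invmat a by apply/invmatP => i j; rewrite mxsE; apply: reynolds_inv.
have aB : a *m B = 0.
  have e g : g \in G -> actmx g (q *: v) *m B = 0.
    move=> Gg; have : actmx g (q *: v *m B) = 0.
      by rewrite -scalemxAl vB scaler0; apply/matrixP => i j; rewrite !mxsE polyact0.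
    rewrite actmxM cB // => /(congr1 (mulmx^~ (cmx n (rM g^-1%g)))).
    by rewrite /= -!mulmxA cmx_reprK // mulmx1 mul0mx.
  have -> : a = (#|G|%:R^-1)%:MP *: \sum_(g in G) actmx g (q *: v).
    apply/rowP => i; rewrite !mxsE summxE mul_mpolyC; congr (_ *: _).
    by apply: eq_bigr => g _; rewrite !mxsE.
  by rewrite -scalemxAl mulmx_suml big1 ?scaler0 // => g Gg; apply: e.
have /rowP/(_ i0) := fB a ia aB; rewrite !mxsE qv reynolds_id; last exact: norm_poly_inv.
by move/norm_poly_eq0 => v0; rewrite v0 eqxx in vi.
Qed.

Definition indep_mod_hilbert k (B : 'M[S]_(k, m)) := forall c : 'rV[C]_k,
  (forall j, hilbert_ideal rG ((cmx n c *m B) 0 j)) -> c = 0.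

(** Independence modulo the Hilbert ideal lifts to independence over the
    invariants: look at the lowest-degree coefficients of a relation. *)
Lemma chevalley_free k (B : 'M[S]_(k, m)) : reflection_generated rG ->
  indep_mod_hilbert B -> forall a : 'rV_k, invmat a -> a *m B = 0 -> a = 0.
Proof.
move=> refl hB a /invmatP ia aB; apply/eqP; apply: contraT => /rV0Pn[i0 ai].
pose P d := [exists i, has (fun l => mdeg l == d) (msupp (a 0 i))].
have exP : exists d, P d.
  have := mlead_supp ai => hl; exists (mdeg (mlead (a 0 i0))); apply/existsP.
  by exists i0; apply/hasP; exists (mlead (a 0 i0)).
case: (ex_minnP exP) => d /existsP[i /hasP[mu mui /eqP emu]] dmin.
have lowa j l : (mdeg l < mdeg mu)%N -> (a 0 j)@_l = 0.
  rewrite emu ltnNge => ld; apply/eqP; apply: contraNT ld => al; apply: dmin.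
  by apply/existsP; exists j; apply/hasP; exists l => //; rewrite mcoeff_msupp.
have c0 : \row_j (a 0 j)@_mu = 0.
  apply: hB => j; rewrite mxsE.
  rewrite (eq_bigr (fun s => (a 0 s)@_mu *: B s j)); last first.
    by move=> s _; rewrite !mxsE mul_mpolyC.
  apply: chevalley_relation => //.
  by move/matrixP/(_ 0 j): aB; rewrite !mxsE.
by move/rowP/(_ i): c0 mui; rewrite !mxsE mcoeff_msupp => ->; rewrite eqxx.
Qed.

End Module.
End Covariants.

Global Opaque actmx.

(** * Regular points and nonsingular covariants *)

Lemma ex_nonroot (C : numFieldType) (p : {poly C}) : p != 0 -> exists t, p.[t] != 0.
Proof.
move=> pN0; apply/not_existsP => h.
pose rs := [seq (i%:R : C) | i <- iota 0 (size p)].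
have : (size rs < size p)%N.
  apply: max_poly_roots => //.
    apply/allP => _ /mapP[i _ ->]; apply/rootP/eqP.
    by apply: contraT => /(h _).
  rewrite map_inj_uniq ?iota_uniq // => i j /eqP.
  by rewrite eqr_nat => /eqP.
by rewrite size_map size_iota ltnn.
Qed.

Section Generic.
Variables (C : numClosedFieldType) (gT : finGroupType) (G : {group gT}) (n : nat).
Variable rG : mx_representation C G n.
Hypothesis faithG : forall g, g \in G -> rG g = 1%:M -> g = 1%g.
Implicit Types (p q : {mpoly C[n]}) (g h : gT).

(** A point of the moment curve t |-> (1, t, t^2, ...): each equation g v = v
    excludes finitely many t. *)
Lemma ex_regular_point : exists v : 'I_n -> C,
  forall g, g \in G -> g != 1%g -> exists i, \sum_j rG g i j * v j != v i.
Proof.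
pose f g i : {poly C} := \sum_(j < n) (rG g i j - (i == j)%:R)%:P * 'X^j.
have fN0 g : g \in G -> g != 1%g -> exists i, f g i != 0.
  move=> Gg gN1; apply: contrapT => /forallNP h; move: gN1 => /eqP; apply.
  apply: faithG => //; apply/matrixP => i j; rewrite !mxsE.
  have /negP := h i; rewrite negbK => /eqP /(congr1 (fun p : {poly C} => p`_j)).
  rewrite coef_sum coef0 (bigD1 j) //= coefCM coefXn eqxx mulr1 big1 => [|l lj].
    by rewrite addr0 => /eqP; rewrite subr_eq0 => /eqP.
  rewrite coefCM coefXn (_ : (j == l :> nat) = false) ?mulr0 //.
  by apply: contraNF lj => /eqP e; apply/eqP/val_inj.
have /choice[F hF] g : exists q : {poly C}, g \in G -> g != 1%g -> q != 0 /\ exists i, q = f g i.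
  have [Gg|nGg] := boolP (g \in G); last by exists 1.
  have [->|gN1] := eqVneq g 1%g; first by exists 1.
  by have [i hi] := fN0 g Gg gN1; exists (f g i) => _ _; split=> //; exists i.
have PN0 : \prod_(g in G | g != 1%g) F g != 0.
  by apply/prodf_neq0 => g /andP[Gg gN1]; case: (hF g Gg gN1).
have [t] := ex_nonroot PN0; rewrite horner_prod => /prodf_neq0 ht.
exists (fun i => t ^+ i) => g Gg gN1; have [_ [i eF]] := hF g Gg gN1; exists i.
have := ht g; rewrite Gg gN1 eF => /(_ isT).
apply: contraNneq => e; rewrite horner_sum.
under eq_bigr do rewrite hornerM hornerC hornerXn mulrBl.
rewrite sumrB e (bigD1 i) //= eqxx mul1r big1 ?addr0 ?subrr // => j ji.
by rewrite eq_sym (negPf ji) mul0r.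
Qed.

(** Averages of multiples of z have prescribed values at v, since only the term of
    the identity survives there. *)
Lemma ex_separating : exists (v : 'I_n -> C) z, z.@[v] != 0 /\
  forall g, g \in G -> g != 1%g -> (polyact rG g z).@[v] = 0.
Proof.
have [v hv] := ex_regular_point.
exists v, (\prod_(g in G | g != 1%g)
  \prod_(i | \sum_j rG g i j * v j != v i) ('X_i - (\sum_j rG g i j * v j)%:MP)).
split.
  rewrite rmorph_prod; apply/prodf_neq0 => g _; rewrite rmorph_prod.
  by apply/prodf_neq0 => i hi; rewrite /= mevalB mevalXU mevalC subr_eq0 eq_sym.
move=> g Gg gN1; rewrite lsub_meval rmorph_prod.
rewrite (bigD1 g^-1%g) /= ?groupV ?Gg ?invg_eq1 //.
have [i hi] := hv g^-1%g (groupVr Gg) (eqbRL (f_equal negb (invg_eq1 g)) gN1).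
rewrite [X in X * _](_ : _ = 0) ?mul0r // rmorph_prod (bigD1 i) //=.
by rewrite mevalB mevalXU mevalC subrr mul0r.
Qed.

(** At v, the covariant average of the scalar matrix z is z(v). *)
Lemma ex_covariant_nonsingular m (rM : mx_representation C G m) :
  exists2 W : 'M[{mpoly C[n]}]_m, covariant rG rM W & \det W != 0.
Proof.
have [v [z [zv z0]]] := ex_separating.
pose W := \sum_(g in G) polyact rG g z *: cmx n (rM g^-1%g).
exists W.
  move=> h Gh; rewrite /W mulmx_suml actmx_sum.
  rewrite [RHS](reindex_inj (mulgI h)) /=; apply: eq_big => [g|g Gg].
    by rewrite groupMl.
  rewrite -scalemxAl -cmxM -repr_mxM ?groupV ?groupM // invMg mulgKV.
  by rewrite actmxZ actmx_cmx polyactM.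
have eW : map_mx (meval v) W = (z.@[v])%:M.
  rewrite raddf_sum (bigD1 1%g) //= big1 => [|g /andP[Gg gN1]].
    rewrite polyact1 invg1 repr_mx1 cmx1 addr0.
    by apply/matrixP => i j; rewrite !mxsE rmorphM rmorph_nat mulr_natr.
  by apply/matrixP => i j; rewrite !mxsE rmorphM /= z0 // mul0r.
apply: contraNneq zv => dW0; have := det_map_mx (meval v) W.
rewrite dW0 eW det_scalar rmorph0 => /eqP.
by rewrite expf_eq0 => /andP[_].
Qed.

End Generic.

(** * Bases of covariants *)

Section CovariantBasis.
Variables (C : numClosedFieldType) (gT : finGroupType) (G : {group gT}) (n : nat).
Variable rG : mx_representation C G n.
Implicit Types (p q : {mpoly C[n]}) (g h : gT).
Local Notation S := {mpoly C[n]}.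

Section Reynolds.
Variables (m : nat) (rM : mx_representation C G m).

Definition reymx k (w : 'M[S]_(k, m)) : 'M[S]_(k, m) :=
  (#|G|%:R^-1)%:MP *: \sum_(g in G) actmx rG g w *m cmx n (rM g^-1%g).

Lemma reymx_covariant k (w : 'M[S]_(k, m)) : covariant rG rM (reymx w).
Proof.
move=> h Gh; have actZ (c : C) (A : 'M[S]_(k, m)) :
    actmx rG h (c%:MP *: A) = c%:MP *: actmx rG h A.
  by apply/matrixP => i j; rewrite !mxsE rmorphM /= polyactC.
rewrite actZ -scalemxAl; congr (_ *: _).
rewrite mulmx_suml actmx_sum [RHS](reindex_inj (mulgI h)) /=.
apply: eq_big => [g|g Gg]; first by rewrite groupMl.
rewrite -mulmxA -cmxM -repr_mxM ?groupV ?groupM // invMg mulgKV.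
by rewrite actmxM actmx_cmx actmx_comp.
Qed.

Lemma reymx_id k (w : 'M[S]_(k, m)) : covariant rG rM w -> reymx w = w.
Proof.
move=> cw; rewrite /reymx (eq_bigr (fun _ => w)) => [|g Gg]; last first.
  by rewrite cw // -mulmxA cmx_reprK // mulmx1.
rewrite sumr_const -scaler_nat scalerA -mpolyC_nat -mpolyCM mulVf ?cardG_neq0 //.
by rewrite mpolyC1 scale1r.
Qed.

Lemma reymxD k (w w' : 'M[S]_(k, m)) : reymx (w + w') = reymx w + reymx w'.
Proof.
rewrite /reymx -scalerDr -big_split /=; congr (_ *: _); apply: eq_bigr => g _.
by rewrite -mulmxDl; congr (_ *m _); apply/matrixP => i j; rewrite !mxsE raddfD.
Qed.

Lemma reymx0 k : reymx (0 : 'M[S]_(k, m)) = 0.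
Proof. by have := reymxD (0 : 'M[S]_(k, m)) 0; rewrite addr0 -[LHS]addr0 => /addrI. Qed.

Lemma reymx_sum k I (s : seq I) (F : I -> 'M[S]_(k, m)) :
  reymx (\sum_(i <- s) F i) = \sum_(i <- s) reymx (F i).
Proof. exact: (big_morph _ (@reymxD k) (reymx0 k)). Qed.

Lemma reymxZ k a (w : 'M[S]_(k, m)) : invariant rG a -> reymx (a *: w) = a *: reymx w.
Proof.
move=> ia; rewrite /reymx scalerA mulrC -scalerA; congr (_ *: _).
rewrite scaler_sumr; apply: eq_bigr => g Gg; rewrite scalemxAl.
by congr (_ *m _); apply/matrixP => i j; rewrite !mxsE rmorphM /= ia.
Qed.

Lemma reymx_closed (P : S -> Prop) k (w : 'M[S]_(k, m)) :
  P 0 -> (forall c p q, P p -> P q -> P (c *: p + q)) ->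
  (forall g p, g \in G -> P p -> P (polyact rG g p)) ->
  (forall i j, P (w i j)) -> forall i j, P (reymx w i j).
Proof.
move=> P0 PL PG Pw i j; rewrite mxsE mul_mpolyC.
have PZ c p : P p -> P (c *: p) by move=> Pp; rewrite -[c *: p]addr0; apply: PL.
have PD p q : P p -> P q -> P (p + q) by rewrite -{2}[p]scale1r; apply: PL.
apply: (PZ); rewrite summxE; elim/big_ind: _ => // g Gg.
rewrite mxsE; elim/big_ind: _ => // l _.
by rewrite !mxsE mulrC mul_mpolyC; apply/PZ/PG.
Qed.

(** If B accounts for the harmonic covariants then it generates all covariants:
    induct on the degree with S = C_G + (Hilbert ideal). *)
Lemma covariant_span k (B : 'M[S]_(k, m)) : covariant rG rM B ->
  (forall c : 'rV[S]_m, covariant rG rM c -> (forall j, harmonic rG (c 0 j)) ->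
     exists c0 : 'rV[C]_k, c = cmx n c0 *m B) ->
  forall w : 'rV[S]_m, covariant rG rM w ->
  exists2 a : 'rV[S]_k, invmat rG a & w = a *m B.
Proof.
move=> cB hB; pose Q (w : 'rV[S]_m) := exists2 a : 'rV[S]_k, invmat rG a & w = a *m B.
have Q0 : Q 0 by exists 0; rewrite ?mul0mx //; apply/invmatP => i j; rewrite mxsE; apply: invariant0.
have QD w w' : Q w -> Q w' -> Q (w + w').
  move=> [a /invmatP ia ->] [b /invmatP ib ->]; exists (a + b); last by rewrite mulmxDl.
  by apply/invmatP => i j; rewrite mxsE; apply: invariantD.
have QZ c w : invariant rG c -> Q w -> Q (c *: w).
  move=> ic [a /invmatP ia ->]; exists (c *: a); last by rewrite scalemxAl.
  by apply/invmatP => i j; rewrite mxsE; apply: invariantM.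
have Qhom d w : covariant rG rM w -> (forall j, w 0 j \is d.-homog) -> Q w.
  elim/ltn_ind: d w => d IHd w cw hw.
  have /fin_all_exists[c hc] j := harmonic_decomp rG (hw j).
  have /fin_all_exists[s hs] j := hc j.
  have ew : w = \row_j c j +
      \sum_j \sum_(x <- s j) x.1 *: (x.2 *: delta_mx 0 j : 'rV[S]_m).
    rewrite [LHS]row_sum_delta [X in X + _]row_sum_delta -big_split /=.
    apply: eq_bigr => j _; have [_ _ _ ->] := hs j; rewrite mxsE scalerDl; congr (_ + _).
    by rewrite scaler_suml; apply: eq_bigr => x _; rewrite scalerA.
  (* As w is its own average, the harmonic part may be averaged to a harmonic
     covariant, and the coefficients x.2 to covariants of smaller degree. *)
  rewrite -(reymx_id cw) ew reymxD reymx_sum; apply: (QD).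
    have [|c0 ->] := hB _ (@reymx_covariant _ (\row_j c j)).
      apply: reymx_closed; [exact: harmonic0|exact: harmonic_linear| |].
        by move=> g p; apply: harmonic_polyact.
      by move=> i j; rewrite mxsE; case: (hs j).
    by exists (cmx n c0) => //; apply: invmat_cmx.
  apply: (big_ind Q Q0 QD) => j _; rewrite reymx_sum big_seq.
  apply: (big_ind Q Q0 QD) => x xs; have [_ _ hx _] := hs j.
  have [ix x0 [e ed he]] := hx x xs; rewrite reymxZ //; apply: (QZ) => //.
  apply: IHd ed _ _ _; first exact: reymx_covariant.
  move=> l; apply: (@reymx_closed (fun p => p \is e.-homog)).
  - exact: rpred0.
  - by move=> a p q hp hq; apply: rpredD => //; apply: rpredZ.
  - by move=> g p _; apply: polyact_homog.
  - move=> a b; rewrite !mxsE; case: (_ && _); last by rewrite mulr0 rpred0.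
    by rewrite mulr1.
move=> w cw; pose K := (\max_j msize (w ord0 j))%N.
have -> : w = \sum_(d < K) map_mx (pihomog mdeg d) w.
  apply/rowP => j; rewrite summxE.
  rewrite {1}(@pihomog_partitionE _ _ mdeg K (w 0 j)) ?leq_bigmax //.
  by apply: eq_bigr => d _; rewrite mxsE.
apply: (big_ind Q Q0 QD) => d _; apply: (@Qhom d) => [g Gg|j]; last first.
  by rewrite mxsE; apply: pihomogP.
apply/rowP => j; rewrite !mxsE polyact_pihomog.
have /rowP/(_ j) := cw g Gg; rewrite !mxsE => ->; rewrite raddf_sum /=.
apply: eq_bigr => l _; rewrite !mxsE -[RHS]mulrC mul_mpolyC mulrC mul_mpolyC.
by rewrite linearZ.
Qed.

End Reynolds.

Hypothesis faithG : forall g, g \in G -> rG g = 1%:M -> g = 1%g.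
Hypothesis reflG : reflection_generated rG.

(** Independence is recorded over all polynomials, by the determinant, and modulo
    the Hilbert ideal, where it determines constant terms of coefficients. *)
Record covariant_basis m (rM : mx_representation C G m) (B : 'M[S]_m) (D : 'I_m -> nat) := {
  cb_cov : covariant rG rM B;
  cb_euler : eulermx (fun _ => 1) B = cmx n (diag_mx (\row_i (D i)%:R)) *m B;
  cb_det : \det B != 0;
  cb_span : forall k (W : 'M[S]_(k, m)), covariant rG rM W ->
    exists2 A : 'M[S]_(k, m), invmat rG A & W = A *m B;
  cb_indep : indep_mod_hilbert rG B }.

(** There are at most m basis elements, being independent over polynomials, and at
    least m, since they span the rows of a nonsingular matrix. *)
Lemma basis_card m (rM : mx_representation C G m) k (b : 'I_k -> {ffun 'I_m -> S}) :
  is_basis (invariant_harmonics rG rM) b ->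
  [/\ k = m, covariant rG rM (\matrix_(i, j) b i j),
    indep_mod_hilbert rG (\matrix_(i, j) b i j),
    forall v : 'rV_k, v *m (\matrix_(i, j) b i j) = 0 -> v = 0 &
    forall l (W : 'M[S]_(l, m)), covariant rG rM W ->
    exists2 A : 'M[S]_(l, k), invmat rG A & W = A *m \matrix_(i, j) b i j].
Proof.
move=> [Pb fb sb]; pose B := \matrix_(i, j) b i j; rewrite -/B.
have cB : covariant rG rM B.
  move=> g Gg; apply/row_matrixP => i.
  have [_ /tensact_covariant/(_ g Gg) e] := Pb i.
  rewrite row_mul (_ : row i B = \row_j b i j); last by apply/rowP => j; rewrite !mxsE.
  by rewrite -e; apply/rowP => j; rewrite !mxsE.
have iB : indep_mod_hilbert rG B.
  move=> c hc; apply/rowP => i; rewrite mxsE; apply: fb.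
  apply/ffunP => j; rewrite ffunE sum_ffunE.
  have e : \sum_l (c 0 l *: b l) j = (cmx n c *m B) 0 j.
    by rewrite mxsE; apply: eq_bigr => l _; rewrite ffunE !mxsE mul_mpolyC.
  rewrite e; apply: harmonic_ideal_eq0 (hc j).
  rewrite -e; elim/big_ind: _ => [|p q hp hq|l _]; first exact: harmonic0.
    by rewrite -[p]scale1r; apply: harmonic_linear.
  rewrite ffunE -[_ *: _]addr0; apply: harmonic_linear; last exact: harmonic0.
  by case: (Pb l).
have fB : forall v : 'rV_k, v *m B = 0 -> v = 0.
  by apply: covariant_free cB _; apply: chevalley_free.
have spanB l (W : 'M[S]_(l, m)) : covariant rG rM W ->
    exists2 A : 'M[S]_(l, k), invmat rG A & W = A *m B.
  move=> cW; have rowW i : covariant rG rM (row i W).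
    by move=> g Gg; rewrite -row_mul -cW //; apply/rowP => j; rewrite !mxsE.
  have H i : exists a : 'rV[S]_k, invmat rG a /\ row i W = a *m B.
    have [|a ia e] := @covariant_span _ rM _ _ cB _ _ (rowW i); last by exists a.
    move=> c cc hc.
    have [|c0 ec] := sb [ffun j => c 0 j].
      split=> [j|]; first by rewrite ffunE.
      apply/tensact_covariant; rewrite (_ : \row_j _ = c) //.
      by apply/rowP => j; rewrite mxsE ffunE.
    exists (\row_i c0 i); apply/rowP => j.
    move/ffunP/(_ j): ec; rewrite ffunE => ->; rewrite sum_ffunE mxsE.
    by apply: eq_bigr => s _; rewrite ffunE !mxsE mul_mpolyC.
  have /fin_all_exists[A hA] := H; exists (\matrix_i A i).
    by apply/invmatP => i j; rewrite mxsE; case: (hA i) => /invmatP.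
  by apply/row_matrixP => i; rewrite row_mul rowK; case: (hA i).
split=> //; apply/eqP; rewrite eqn_leq; apply/andP; split; rewrite leqNgt; apply/negP => lt.
  have /det0P[v /eqP vN0 vB] : \det (B *m (pid_mx m : 'M_(m, k))) == 0.
    by rewrite det_mul_pid0.
  apply: vN0; apply: fB; have := congr1 (mulmx^~ (pid_mx m : 'M_(k, m))) vB.
  rewrite mul0mx -!mulmxA mul_pid_mx minnn (minn_idPr (ltnW lt)) pid_mx_1 mulmx1.
  by [].
have [W cW dW] := ex_covariant_nonsingular faithG rM.
have [A _ eW] := spanB _ _ cW; move/eqP: dW; apply; rewrite eW.
have -> : A *m B = (A *m (pid_mx k : 'M_(k, m))) *m ((pid_mx k : 'M_(m, k)) *m B).
  by rewrite mulmxA -(mulmxA A) mul_pid_mx minnn (minn_idPr (ltnW lt)) pid_mx_1 mulmx1.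
by rewrite det_mulmx det_mul_pid0 // mul0r.
Qed.

Lemma homog_basis m (rM : mx_representation C G m) k (b : 'I_k -> {ffun 'I_m -> S}) d :
  is_basis (invariant_harmonics rG rM) b -> (forall i j, b i j \is (d i).-homog) ->
  exists (e : m = k) (B : 'M[S]_m), covariant_basis rM B (d \o cast_ord e) /\
    is_basis (invariant_harmonics rG rM) (fun i => [ffun j => B i j]).
Proof.
move=> bb hb; have [em cB iB fB spanB] := basis_card bb.
subst m; exists erefl, (\matrix_(i, j) b i j); split; last first.
  congr is_basis: bb; apply/funext => i.
  by apply/ffunP => j; rewrite ffunE mxsE.
split=> //.
  apply/matrixP => i j; rewrite !mxsE (bigD1 i) //= !mxsE eqxx mulr1n cast_ord_id.
  rewrite (euler_homog (hb i j)) mul_mpolyC big1 ?addr0 // => l li.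
  by rewrite !mxsE eq_sym (negPf li) mul0r.
by apply/negP => /det0P[v /eqP vN0 /fB].
Qed.

Lemma exponents_basis m (rM : mx_representation C G m) e : exponents rG rM e ->
  exists (B : 'M[S]_m) (t : m.-tuple nat), [/\ tval t = e, covariant_basis rM B (tnth t) &
    is_basis (invariant_harmonics rG rM) (fun i => [ffun j => B i j])].
Proof.
move=> [b bb hb]; have [em [B [cB bB]]] := homog_basis bb hb.
have es : size e == m by rewrite em.
exists B, (Tuple es); split=> //.
by congr covariant_basis: cB; apply/funext => i; rewrite (tnth_nth 0%N).
Qed.

End CovariantBasis.

(** * Spectra of commuting matrices *)

Lemma char_poly_intertwine (R : idomainType) n (P A B : 'M[R]_n) :
  \det P != 0 -> P *m A = B *m P -> char_poly A = char_poly B.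
Proof.
move=> dP PAB; pose Q := map_mx (@polyC R) P.
have dQ : \det Q != 0 by rewrite det_map_mx polyC_eq0.
have e : Q *m char_poly_mx A = char_poly_mx B *m Q.
  rewrite /char_poly_mx mulmxBr mulmxBl -!map_mxM PAB; congr (_ - _).
  by rewrite scalar_mxC.
by move/(congr1 determinant): e; rewrite !det_mulmx mulrC => /(mulIf dQ).
Qed.

Definition natdiag (C : fieldType) r (d : 'I_r -> nat) : 'M[C]_r :=
  diag_mx (\row_i (d i)%:R).

Definition has_spectrum (C : fieldType) r (A : 'M[C]_r) (d : 'I_r -> nat) :=
  char_poly A = \prod_i ('X - (d i)%:R%:P).

Section Spectrum.
Variables (C : numClosedFieldType) (r : nat).
Implicit Types (A T : 'M[C]_r) (d t : r.-tuple nat).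

Lemma natdiag_spectrum (d : 'I_r -> nat) : has_spectrum (natdiag C d) d.
Proof.
rewrite /has_spectrum char_poly_trig ?diag_mx_is_trig //.
by apply: eq_bigr => i _; rewrite !mxE eqxx mulr1n.
Qed.

Lemma spectrum_perm A d t : has_spectrum A (tnth d) -> has_spectrum A (tnth t) ->
  perm_eq d t.
Proof.
move=> hd ht; have e (u : r.-tuple nat) : \prod_i ('X - (tnth u i)%:R%:P : {poly C}) =
    \prod_(x <- [seq (i%:R : C) | i <- u]) ('X - x%:P).
  by rewrite big_map big_tuple.
move: hd; rewrite /has_spectrum (ht : char_poly _ = _) !e => /prod_XsubC_eq h.
have injn : injective (fun i : nat => i%:R : C).
  by move=> i j /eqP; rewrite eqr_nat => /eqP.
by rewrite perm_sym; apply: perm_map_inj injn _ _ h.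
Qed.

Lemma trig_spectrum A (P : 'M[C]_r) t : P \in unitmx -> is_trig_mx (conjmx P A) ->
  has_spectrum A (tnth t) -> exists2 t' : r.-tuple nat, perm_eq t' t &
    forall i, conjmx P A i i = (tnth t' i)%:R.
Proof.
move=> uP trA ht; pose a := [tuple conjmx P A i i | i < r].
have : perm_eq a [tuple of [seq (i%:R : C) | i <- t]].
  apply: prod_XsubC_eq; rewrite [RHS]big_map [RHS]big_tuple -(ht : char_poly _ = _).
  rewrite (@char_poly_intertwine _ _ P A (conjmx P A)) ?char_poly_trig //.
  - by rewrite big_tuple; apply: eq_bigr => i _; rewrite tnth_mktuple.
  - by rewrite -unitfE -unitmxE.
  - by rewrite conjumx // mulmxKV.
move=> /tuple_permP[p ep]; exists [tuple tnth t (p i) | i < r].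
  by apply/tuple_permP; exists p.
move=> i; have : tnth a i = tnth [tuple tnth [tuple of [seq (i0%:R : C) | i0 <- t]] (p i) | i < r] i.
  by congr tnth; apply: val_inj.
by rewrite !tnth_mktuple tnth_map.
Qed.

(** Commuting matrices are simultaneously triangular, hence their eigenvalues
    are naturally paired. *)
Lemma joint_spectrum A T d t : A *m T = T *m A ->
  has_spectrum A (tnth d) -> has_spectrum T (tnth t) ->
  exists d' t' : r.-tuple nat, [/\ perm_eq d' d, perm_eq t' t,
    has_spectrum (A + T) (fun i => tnth d' i + tnth t' i)%N &
    has_spectrum (A *m T) (fun i => tnth d' i * tnth t' i)%N].
Proof.
move=> AT hA hT; have [P /unitarymx_unit uP /andP[trA trT]] := cotrigonalization2 AT.
have [d' pd ed] := trig_spectrum uP trA hA.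
have [t' pt et] := trig_spectrum uP trT hT.
exists d', t'; split=> //.
  rewrite /has_spectrum (@char_poly_intertwine _ _ P _ (conjmx P A + conjmx P T)).
  - rewrite char_poly_trig; last first.
      apply/is_trig_mxP => i j ij; rewrite mxE.
      by rewrite (is_trig_mxP trA) // (is_trig_mxP trT) // addr0.
    by apply: eq_bigr => i _; rewrite mxE ed et natrD.
  - by rewrite -unitfE -unitmxE.
  - by rewrite mulmxDl mulmxDr !conjumx // !mulmxKV.
rewrite /has_spectrum (@char_poly_intertwine _ _ P _ (conjmx P A *m conjmx P T)).
- have h (i j : 'I_r) : (i <= j)%N -> (conjmx P A *m conjmx P T) i j =
      (i == j)%:R * (conjmx P A i i * conjmx P T i i).
    move=> ij; rewrite mxE (bigD1 i) //= big1 ?addr0 => [|l li].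
      have [->|nij] := eqVneq i j; first by rewrite mul1r.
      rewrite (is_trig_mxP trT i j) ?mulr0 ?mul0r //.
      by rewrite ltn_neqAle ij andbT -val_eqE in nij *.
    have [lti|lel] := ltnP i l; first by rewrite (is_trig_mxP trA) ?mul0r.
    rewrite (is_trig_mxP trT) ?mulr0 // (leq_trans _ ij) // ltn_neqAle lel andbT.
    by rewrite val_eqE.
  rewrite char_poly_trig; last first.
    by apply/is_trig_mxP => i j ij; rewrite h 1?ltnW // (_ : (i == j) = false) ?mul0r //;
    apply: contraTF ij => /eqP ->; rewrite ltnn.
  by apply: eq_bigr => i _; rewrite h // eqxx mul1r ed et natrM.
- by rewrite -unitfE -unitmxE.
- by rewrite !conjumx // !mulmxA !mulmxKV.
Qed.

End Spectrum.

(** * Exponents and Orlik-Solomon spaces *)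

(** Over the field of fractions T is similar to a constant matrix, so that its
    characteristic polynomial may be evaluated at the origin. *)
Lemma char_poly_const (C : fieldType) n r (c T : 'M[{mpoly C[n]}]_r) (N : 'M[C]_r) :
  \det c != 0 -> c *m cmx n N = T *m c -> char_poly (mx0 T) = char_poly N.
Proof.
by move=> dc e; rewrite mx0_char_poly -(char_poly_intertwine dc e) -mx0_char_poly mx0K.
Qed.

Lemma reflection_mx (C : fieldType) n (A : 'M[C]_n) : reflection A ->
  exists (x : 'cV_n) (a : 'rV_n), invmx A = 1%:M + x *m a.
Proof.
move=> [uA _ [a _ ha]].
have /submxP[x ex] : (invmx A - 1%:M <= a)%MS.
  rewrite submxE; apply/eqP/matrixP => i j.
  have aj : a *m col j (cokermx a) = 0.
    by rewrite colE mulmxA mulmx_coker mul0mx.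
  have : (invmx A - 1%:M) *m col j (cokermx a) = 0.
    by rewrite mulmxBl mul1mx -{1}(ha _ aj) mulKmx // subrr.
  by rewrite colE mulmxA -colE => /matrixP/(_ i 0); rewrite !mxsE.
by exists x, a; rewrite -ex addrC subrK.
Qed.

Section ReflectionGroup.
Variables (C : fieldType) (gT : finGroupType) (G : {group gT}) (n : nat).
Variable rG : mx_representation C G n.
Hypothesis hG : complex_reflection_group rG.

Lemma reflection_group_faithful g : g \in G -> rG g = 1%:M -> g = 1%g.
Proof.
move=> Gg eg; have [/subsetP fG _] := hG.
by apply/set1P/fG; apply/rkerP.
Qed.

End ReflectionGroup.

Lemma reflection_group_generated (C : numClosedFieldType) (gT : finGroupType) (G : {group gT})
  n (rG : mx_representation C G n) : complex_reflection_group rG -> reflection_generated rG.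
Proof.
move=> [_ [S [hS GS]]]; exists S => // s Ss.
by rewrite repr_mxV ?GS ?mem_gen //; apply: reflection_mx; apply: hS.
Qed.

Section OrlikSolomon.
Variables (C : numClosedFieldType) (gT : finGroupType) (G N : {group gT}).
Variables (nNG : (N <| G)%g) (r m u : nat).
Variables (rV : mx_representation C G r).
Hypothesis (hG : complex_reflection_group rV) (hN : complex_reflection_group (res nNG rV)).
Variables (rM : mx_representation C G m) (rU : mx_representation C G u).
Hypothesis hU : orlik_solomon nNG rV rM rU.
Local Notation S := {mpoly C[r]}.
Local Notation E := (eulermx (fun _ : 'I_r => 1)).

Lemma exponents_orlik_solomon eNV eGU eGV :
  exponents (res nNG rV) (res nNG rM) eNV -> exponents rV rU eGU -> exponents rV rM eGV ->
  exists a b c : m.-tuple nat, [/\ perm_eq a eNV, perm_eq b eGU, perm_eq c eGV &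
    forall i, (tnth a i + tnth b i = tnth c i)%N].
Proof.
have fG := reflection_group_faithful hG; have gG := reflection_group_generated hG.
have fN := reflection_group_faithful hN; have gN := reflection_group_generated hN.
have [b bb actb] := hU.
have [um cb _ freeb spanb] := basis_card fN gN bb.
subst u.
move=> /(exponents_basis fN gN)[BN [tN [<- cN bN]]].
move=> /(exponents_basis fG gG)[c [tU [<- cU _]]].
move=> /(exponents_basis fG gG)[v [tV [<- cV _]]].
set B := \matrix_(i, j) b i j in cb freeb spanb.
have dB : \det B != 0 by apply/negP => /det0P[x /eqP xN0 /freeb].
have actB g : g \in G -> actmx rV g B = cmx r (rU g^-1%g) *m B *m cmx r (rM g).
  move=> Gg; apply/row_matrixP => j; rewrite row_mul.
  have e : \row_k tensact rV (dual_repr rM) g (b j) k = row j (cmx r (rU g^-1%g) *m B).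
    rewrite actb //; apply/rowP => k; rewrite !mxsE sum_ffunE; apply: eq_bigr => l _.
    by rewrite ffunE !mxsE mul_mpolyC.
  rewrite -e tensact_mx -mulmxA cmx_reprVK // mulmx1.
  by apply/rowP => k; rewrite !mxsE.
have [Q eQ] : exists Q : 'M[C]_m, B = cmx r Q *m BN.
  have [Pb _ _] := bb; have [_ _ sN] := bN.
  have /fin_all_exists[q hq] i := sN (b i) (Pb i).
  exists (\matrix_(i, j) q i j); apply/matrixP => i j.
  rewrite !mxsE hq sum_ffunE; apply: eq_bigr => l _.
  by rewrite !ffunE !mxsE mul_mpolyC.
have dQ : \det Q != 0.
  by apply: contraNneq dB => dQ; rewrite eQ det_mulmx det_map_mx dQ rmorph0 mul0r.
have uQ : Q \in unitmx by rewrite unitmxE unitfE.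
have [N' eN'] : exists N', N' = Q *m natdiag C (tnth tN) *m invmx Q by eexists.
have EB : E B = cmx r N' *m B.
  rewrite eQ eulermx_cmxl (cb_euler cN) !mulmxA -!cmxM; congr (_ *m _).
  by rewrite eN' mulmxKV.
have commN' g : g \in G -> N' *m rU g = rU g *m N'.
  suff H h : h \in G -> N' *m rU h^-1%g = rU h^-1%g *m N'.
    by move=> Gg; have := H _ (groupVr Gg); rewrite invgK.
  move=> Gh; have := congr1 E (actB h Gh).
  rewrite eulermx_act EB actmxM actmx_cmx actB // eulermx_cmxr eulermx_cmxl EB.
  rewrite !mulmxA -!cmxM => /(cmx_repr_inj Gh).
  by move/(mulmx_detI dB)/cmx_inj.
have [|T iT eT] := cb_span cU (_ : covariant rV rU (c *m cmx r N')).
  move=> g Gg; rewrite actmxM actmx_cmx (cb_cov cU Gg).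
  by rewrite -!mulmxA -!cmxM commN'.
have cw : covariant rV rM (c *m B).
  move=> g Gg; rewrite actmxM (actB g Gg) (cb_cov cU Gg) !mulmxA.
  by rewrite -(mulmxA c) (cmx_reprK r rU Gg) mulmx1.
(* c B is a basis because v has coefficients on it: by freeness of B, those over
   the N-invariants form a covariant for rU. *)
have [X iX eX] : exists2 X, invmat (res nNG rV) X & v = X *m B.
  apply: spanb => g Ng; apply: (cb_cov cV); exact: (subsetP (normal_sub nNG)).
have cX : covariant rV rU X.
  move=> g Gg; have := cb_cov cV Gg; rewrite {1}eX actmxM (actB g Gg) !mulmxA eX.
  move=> /(cmx_repr_inj Gg).
  move/(mulmx_detI dB) => e; rewrite -[in RHS]e.
  by rewrite -mulmxA (cmx_reprVK r rU Gg) mulmx1.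
have [Y iY eY] := cb_span cU cX.
have [Z iZ eZ] := cb_span cV cw.
have YZ : Y *m Z = 1%:M.
  by apply: (mulmx_detI (cb_det cV)); rewrite -mulmxA -eZ mulmxA -eY -eX mul1mx.
have dZ : \det (mx0 Z) != 0.
  have := congr1 (fun A => \det (mx0 A)) YZ; rewrite mx0M det_mulmx -cmx1 mx0K det1.
  by move=> e; apply: contra_eq_neq e => ->; rewrite mulr0 eq_sym oner_eq0.
have e1 : mx0 Z *m natdiag C (tnth tV) = (natdiag C (tnth tU) + mx0 T) *m mx0 Z.
  have e : E Z + Z *m cmx r (natdiag C (tnth tV)) = (cmx r (natdiag C (tnth tU)) + T) *m Z.
    apply: (mulmx_detI (cb_det cV)).
    rewrite mulmxDl -(mulmxA Z) -(cb_euler cV) -eulermxM -eZ -mulmxA -eZ.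
    by rewrite eulermxM (cb_euler cU) EB mulmxA eT mulmxDl !mulmxA.
  by have := congr1 mx0 e; rewrite mx0D mx0_eulermx add0r !mx0M mx0D !mx0K.
have e2 : natdiag C (tnth tU) *m mx0 T = mx0 T *m natdiag C (tnth tU).
  have e : cmx r (natdiag C (tnth tU)) *m T = E T + T *m cmx r (natdiag C (tnth tU)).
    apply: (mulmx_detI (cb_det cU)).
    rewrite mulmxDl -!mulmxA -(cb_euler cU) -eulermxM -eT.
    by rewrite eulermx_cmxr (cb_euler cU) !mulmxA.
  by have := congr1 mx0 e; rewrite mx0D mx0_eulermx add0r !mx0M !mx0K.
have sT : has_spectrum (mx0 T) (tnth tN).
  rewrite /has_spectrum (char_poly_const (cb_det cU) eT).
  rewrite -(natdiag_spectrum C (tnth tN)); apply/esym.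
  by apply: (char_poly_intertwine dQ); rewrite eN' mulmxKV.
have [b' [a' [pb pa sab _]]] := joint_spectrum e2 (natdiag_spectrum _ _) sT.
exists a', b', [tuple tnth b' i + tnth a' i | i < m]%N; split=> //.
  apply: (@spectrum_perm C _ (natdiag C (tnth tV))); last exact: natdiag_spectrum.
  rewrite /has_spectrum (char_poly_intertwine dZ e1) (sab : char_poly _ = _).
  by apply: eq_bigr => i _; rewrite tnth_mktuple.
by move=> i; rewrite tnth_mktuple addnC.
Qed.

End OrlikSolomon.

(** * Reflection groups preserving a weight decomposition *)

Section Typed.
Variables (C : numClosedFieldType) (gT : finGroupType) (H : {group gT}) (n : nat).
Variable rH : mx_representation C H n.
Variable w : 'I_n -> nat.
Implicit Types (p q : {mpoly C[n]}) (g h s : gT) (l : nat) (P : pred nat).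
Local Notation S := {mpoly C[n]}.

Definition acts_within P g := [forall j, forall k,
  (rH g j k != (j == k)%:R) ==> (P (w j) && P (w k))].

Lemma acts_withinP P g : reflect
  (forall j k, rH g j k != (j == k)%:R -> P (w j) /\ P (w k)) (acts_within P g).
Proof.
apply: (iffP forallP) => [h j k hjk|h j].
  by move/forallP: (h j) => /(_ k); rewrite hjk => /andP.
by apply/forallP => k; apply/implyP => /h[-> ->].
Qed.

Lemma acts_withinS P Q g : subpred P Q -> acts_within P g -> acts_within Q g.
Proof.
by move=> PQ /acts_withinP h; apply/acts_withinP => j k /h[/PQ ? /PQ ?].
Qed.

Definition within_set P := [set g in H | acts_within P g].

Lemma within_group_set P : group_set (within_set P).
Proof.
apply/group_setP; split=> [|g h]; rewrite !inE.
  by rewrite group1; apply/acts_withinP => j k; rewrite repr_mx1 mxE eqxx.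
move=> /andP[Hg /acts_withinP hg] /andP[Hh /acts_withinP hh]; rewrite groupM //=.
apply/acts_withinP => j k; rewrite repr_mxM //.
apply: contraNP => nP; apply/eqP; have [Pj|Pj] := boolP (P (w j)).
  have {nP}Pk : ~~ P (w k) by apply/negP => Pk; apply: nP.
  have hk i : rH h i k = (i == k)%:R.
    by apply/eqP; apply: contraNT Pk => /hh[].
  have gk : rH g j k = (j == k)%:R by apply/eqP; apply: contraNT Pk => /hg[].
  rewrite mxE (bigD1 k) //= hk eqxx mulr1 gk big1 ?addr0 // => i ik.
  by rewrite hk (negPf ik) mulr0.
have gj i : rH g j i = (j == i)%:R by apply/eqP; apply: contraNT Pj => /hg[].
have hj : rH h j k = (j == k)%:R by apply/eqP; apply: contraNT Pj => /hh[].
rewrite mxE (bigD1 j) //= gj eqxx mul1r hj big1 ?addr0 // => i ij.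
by rewrite gj eq_sym (negPf ij) mul0r.
Qed.

Definition within_group P : {group gT} := Group (within_group_set P).

Lemma within_groupP P g : reflect (g \in H /\ acts_within P g) (g \in within_group P).
Proof. by rewrite inE; apply: andP. Qed.

Lemma within_group_sub P : within_group P \subset H.
Proof. by apply/subsetP => g /within_groupP[]. Qed.

Lemma within_fixXU P g j : g \in within_group P -> ~~ P (w j) -> polyact rH g 'X_j = 'X_j.
Proof.
move=> Pg Pj; have /within_groupP[_ /acts_withinP h] := groupVr Pg.
rewrite polyactE lsubXU (bigD1 j) //= big1 => [|k kj].
  have -> : rH g^-1%g j j = (j == j)%:R by apply/eqP; apply: contraNT Pj => /h[].
  by rewrite eqxx scale1r addr0.
have -> : rH g^-1%g j k = (j == k)%:R by apply/eqP; apply: contraNT Pj => /h[].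
by rewrite eq_sym (negPf kj) scale0r.
Qed.

Definition supported P (m : 'X_{1..n}) := forall j, m j != 0%N -> P (w j).

Lemma polyactXm g (m : 'X_{1..n}) : polyact rH g 'X_[m] = \prod_i polyact rH g 'X_i ^+ m i.
Proof. by rewrite mpolyXE_id rmorph_prod; apply: eq_bigr => i _ /=; rewrite rmorphXn. Qed.

Lemma within_fixXm P Q g (m : 'X_{1..n}) : g \in within_group P -> supported Q m ->
  (forall x, Q x -> ~~ P x) -> polyact rH g 'X_[m] = 'X_[m].
Proof.
move=> Pg Qm PQ; rewrite polyactXm [RHS]mpolyXE_id; apply: eq_bigr => i _.
have [->|mi] := eqVneq (m i) 0%N; first by rewrite !expr0.
by rewrite (within_fixXU Pg) //; apply/PQ/Qm.
Qed.

Variable T : {set gT}.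
Hypothesis HT : H :=: <<T>>%g.
Hypothesis hT : forall s, s \in T -> exists l, acts_within (pred1 l) s.
Hypothesis wH : forall g j k, g \in H -> rH g j k != 0 -> w j = w k.

(** As H preserves the weights, translating a monomial introduces no variable of a
    new weight. *)
Lemma polyact_supported_fix P Q g h (m : 'X_{1..n}) : g \in H -> h \in within_group P ->
  supported Q m -> (forall x, Q x -> ~~ P x) ->
  polyact rH h (polyact rH g 'X_[m]) = polyact rH g 'X_[m].
Proof.
move=> Hg Ph Qm PQ; rewrite polyactXm rmorph_prod; apply: eq_bigr => i _ /=.
have [->|mi] := eqVneq (m i) 0%N; first by rewrite !expr0 rmorph1.
suff e : polyact rH h (polyact rH g 'X_i) = polyact rH g 'X_i.
  by rewrite (rmorphXn (polyact rH h)) /= e.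
rewrite [polyact rH g _]lsubXU polyact_sum; apply: eq_bigr => j _; rewrite linearZ /=.
have [->|gij] := eqVneq (rH g^-1%g i j) 0; first by rewrite !scale0r.
by rewrite (within_fixXU Ph) // -(wH (groupVr Hg) gij); apply/PQ/Qm.
Qed.

Definition away_group l : {group gT} := <<(T :&: within_group (predC1 l))%SET>>%G.

Lemma away_group_within l : away_group l \subset within_group (predC1 l).
Proof. by rewrite gen_subG subsetIr. Qed.

Lemma away_group_sub l : away_group l \subset H.
Proof. exact: subset_trans (away_group_within l) (within_group_sub _). Qed.

Definition away_repr l := subg_repr rH (away_group_sub l).

(** The generators of H outside [away_group l] act within weight l, hence fix every
    translate of a monomial without variables of weight l. *)
Lemma reynolds_within_inv l (m : 'X_{1..n}) : supported (predC1 l) m ->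
  invariant rH (reynolds (away_repr l) 'X_[m]).
Proof.
move=> lm; set q := reynolds _ _.
apply: (gen_ind HT) => [|g h Hg Hh eg eh|s Ts].
- exact: polyact1.
- by rewrite (polyactM _ _ Hg Hh) eh.
have Hs : s \in H by rewrite HT mem_gen.
have [d ds] := hT Ts; have [dl|dl] := eqVneq d l.
  rewrite /q /reynolds linearZ /= polyact_sum; congr (_ *: _); apply: eq_bigr => g Kg.
  apply: (@polyact_supported_fix (pred1 l) (predC1 l)) => //.
  + by apply: (subsetP (away_group_sub _)) Kg.
  + by apply/within_groupP; rewrite -dl.
apply: (@reynolds_inv _ _ _ _ (away_repr l)).
apply: mem_gen; rewrite inE Ts; apply/within_groupP; split=> //.
by apply: acts_withinS ds => x /= /eqP ->.
Qed.

Definition restr_mnm P (m : 'X_{1..n}) : 'X_{1..n} :=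
  [multinom if P (w j) then m j else 0%N | j < n].

Lemma restr_supported P m : supported P (restr_mnm P m).
Proof. by move=> j; rewrite mnmE; case: ifP. Qed.

Lemma restr_split l m : m = (restr_mnm (predC1 l) m + restr_mnm (pred1 l) m)%MM.
Proof.
by apply/mnmP => j; rewrite mnmDE !mnmE /=; case: eqP => _ /=; rewrite ?addn0.
Qed.

(** Averaging over [away_group l] reduces to the averages of monomials m1 m2 with m2
    made of the variables of weight l.  Such an average is the average of m1, an
    invariant of H, times m2; it lies in the Hilbert ideal unless m1 = 1, and then
    the derivation kills it. *)
Lemma euler_within_ideal l p :
  (forall s, s \in T -> acts_within (predC1 l) s -> polyact rH s p = p) ->
  hilbert_ideal rH (euler (fun j => (w j)%:R - l%:R) p).
Proof.
move=> ipT; pose rK := away_repr l; set u := fun j => _.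
have ip g : g \in away_group l -> polyact rH g p = p.
  have gK : away_group l :=: <<T :&: within_group (predC1 l)>>%g by [].
  move: g; apply: (gen_ind gK) => [|g h Kg Kh eg eh|s /setIP[Ts /within_groupP[]]].
  - exact: polyact1.
  - rewrite (polyactM _ _ (subsetP (away_group_sub _) _ Kg) (subsetP (away_group_sub _) _ Kh)).
    by rewrite eh.
  - by move=> _; apply: ipT.
have iE : invariant rK (euler u p).
  move=> g Kg; have Hg := subsetP (away_group_sub _) _ Kg.
  rewrite -[polyact rK g _]/(polyact rH g _) -euler_polyact ?ip // => i j.
  by move/(wH (groupVr Hg)); rewrite /u => ->.
rewrite -(reynolds_id iE) [p]mpolyE (raddf_sum (euler u)) reynolds_sum.
apply: hilbert_ideal_sum => m _ /=; rewrite linearZ /= eulerX !reynoldsZ.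
apply: hilbert_idealZ.
pose m1 := restr_mnm (predC1 l) m; pose m2 := restr_mnm (pred1 l) m.
have [m10|m1N] := eqVneq m1 0%MM.
  rewrite big1 ?scale0r; first exact: hilbert_ideal0.
  move=> i _; have := congr1 (fun m : 'X_{1..n} => m i) m10; rewrite mnmE mnm0E /= /u.
  by case: eqP => [->|_ /= ->]; rewrite ?subrr ?mulr0 ?mul0r.
apply: hilbert_idealZ; rewrite [m](restr_split l) addmC mpolyXD reynoldsM; last first.
  move=> g Kg; apply: (@within_fixXm (predC1 l) (pred1 l)).
  - exact: (subsetP (away_group_within _)) Kg.
  - exact: restr_supported.
  - by move=> x /= ->.
apply: hilbert_idealMl; rewrite -[reynolds _ _]mulr1; apply: hilbert_ideal_gen.
  by apply/reynolds_within_inv/restr_supported.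
by rewrite reynolds_coef0 mcoeffX (negPf m1N).
Qed.

Lemma reynolds_away l p : reynolds rH (reynolds (away_repr l) p) = reynolds rH p.
Proof.
rewrite {2}/reynolds reynoldsZ reynolds_sum.
rewrite (eq_bigr (fun _ => reynolds rH p)) => [|g Kg].
  rewrite sumr_const -scaler_nat scalerA mulVf ?scale1r // pnatr_eq0 -lt0n.
  exact: cardG_gt0.
have Hg := subsetP (away_group_sub _) _ Kg.
rewrite /reynolds; congr (_ *: _); rewrite [RHS](reindex_inj (mulIg g)) /=.
by apply: eq_big => [h|h Hh]; [rewrite groupMr | rewrite (polyactM _ _ Hh Hg)].
Qed.

(** Hence the invariants are generated by those involving a single weight. *)
Lemma reynolds_split l m : reynolds rH 'X_[m] =
  reynolds rH 'X_[restr_mnm (predC1 l) m] * reynolds rH 'X_[restr_mnm (pred1 l) m].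
Proof.
pose rK := away_repr l; set m1 := restr_mnm _ m; set m2 := restr_mnm _ m.
have iq : invariant rH (reynolds rK 'X_[m1]).
  by apply/reynolds_within_inv/restr_supported.
have -> : reynolds rH 'X_[m1] = reynolds rK 'X_[m1].
  by rewrite -(reynolds_away l) reynolds_id.
rewrite {1}[m](restr_split l) -(reynolds_away l) addmC mpolyXD.
rewrite [reynolds (away_repr _) _]reynoldsM; first by rewrite mulrC reynoldsM.
move=> g Kg; apply: (@within_fixXm (predC1 l) (pred1 l)).
- exact: (subsetP (away_group_within _)) Kg.
- exact: restr_supported.
- by move=> x /= ->.
Qed.

Section Gradient.
Variable theta : n.-tuple S.
Hypothesis basic : basic_invariants rH theta.

(** The scaling of the 1-form dp by the weights commutes with H; the point is that
    it stays in the span of the differentials of the basic invariants. *)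
Definition scaled_gradient p := exists2 c : 'I_n -> S,
  forall j, invariant rH (c j) &
  forall k, (w k)%:R *: p^`M(k) = \sum_j c j * (tnth theta j)^`M(k).

Lemma comp_basic_inv p : invariant rH (p \mPo theta).
Proof.
have [_ it _ _] := basic.
elim/mpoly_ring_ind: p => [c|i|p q IHp IHq|p q IHp IHq].
- by rewrite comp_mpolyC; apply: invariantC.
- by rewrite comp_mpolyXU -tnth_nth.
- by rewrite raddfD; apply: invariantD.
- by rewrite rmorphM; apply: invariantM.
Qed.

Lemma gradient_basic p : invariant rH p -> exists2 c : 'I_n -> S,
  forall j, invariant rH (c j) & forall k, p^`M(k) = \sum_j c j * (tnth theta j)^`M(k).
Proof.
have [_ _ _ gen] := basic; move=> /gen[F ->].
exists (fun j => F^`M(j) \mPo theta) => [j|k]; first exact: comp_basic_inv.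
by rewrite mderiv_comp.
Qed.

Lemma scaled_gradientD p q : scaled_gradient p -> scaled_gradient q -> scaled_gradient (p + q).
Proof.
move=> [a ia ea] [b ib eb]; exists (fun j => a j + b j) => [j|k]; first exact: invariantD.
rewrite mderivD scalerDr ea eb -big_split /=; apply: eq_bigr => j _.
by rewrite mulrDl.
Qed.

Lemma scaled_gradientZ c p : scaled_gradient p -> scaled_gradient (c *: p).
Proof.
move=> [a ia ea]; exists (fun j => c *: a j) => [j|k]; first exact: invariantZ.
rewrite mderivZ scalerA mulrC -scalerA ea scaler_sumr; apply: eq_bigr => j _.
by rewrite scalerAl.
Qed.

Lemma scaled_gradientM p q : invariant rH p -> invariant rH q ->
  scaled_gradient p -> scaled_gradient q -> scaled_gradient (p * q).
Proof.
move=> ip iq [a ia ea] [b ib eb]; exists (fun j => q * a j + p * b j) => [j|k].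
  by apply: invariantD; apply: invariantM.
rewrite mderivM scalerDr [_ * q]mulrC 2!scalerAr ea eb.
rewrite !mulr_sumr -big_split /=; apply: eq_bigr => j _.
by rewrite mulrDl !mulrA.
Qed.

Lemma scaled_gradient_pure l p : invariant rH p ->
  (forall k, w k != l -> p^`M(k) = 0) -> scaled_gradient p.
Proof.
move=> ip pl; have [c ic ec] := gradient_basic ip.
exists (fun j => l%:R *: c j) => [j|k]; first exact: invariantZ.
under eq_bigr do rewrite -scalerAl.
rewrite -scaler_sumr -ec; have [->//|/pl ->] := eqVneq (w k) l.
by rewrite !scaler0.
Qed.

Lemma mderiv_supported l m k : supported (pred1 l) m -> w k != l ->
  (reynolds rH 'X_[m])^`M(k) = 0.
Proof.
move=> ml wk; rewrite mderivZ [X in _ *: X]raddf_sum big1 ?scaler0 // => g Hg /=.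
rewrite polyactXm; elim/big_rec: _ => [|i p _ IHp].
  by rewrite -(mpolyC1 n) mderivC.
rewrite mderivM IHp mulr0 addr0.
have [->|mi] := eqVneq (m i) 0%N; first by rewrite expr0 -(mpolyC1 n) mderivC mul0r.
have d0 : (polyact rH g 'X_i)^`M(k) = 0.
  rewrite [polyact rH g _]lsubXU raddf_sum big1 //= => j _.
  rewrite mderivZ mderivX mnm1E; have [jk|] := eqVneq j k; last by rewrite scale0r scaler0.
  have [->|gij] := eqVneq (rH g^-1%g i j) 0; first by rewrite scale0r.
  by move: wk; rewrite -jk -(wH (groupVr Hg) gij) (eqP (ml _ mi)) eqxx.
elim: (m i) {mi} => [|e IHe]; first by rewrite expr0 -(mpolyC1 n) mderivC mul0r.
rewrite exprS mderivM d0 mul0r add0r.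
by rewrite -mulrA IHe mulr0.
Qed.

(** On an invariant of a single weight l the scaling is multiplication by l, and
    these invariants generate all of them, by [reynolds_split]. *)
Lemma scaled_gradient_inv p : invariant rH p -> scaled_gradient p.
Proof.
move=> ip; rewrite -(reynolds_id ip) [p]mpolyE reynolds_sum.
elim/big_ind: _ => [|a b|m _]; [|exact: scaled_gradientD|].
  exists (fun _ => 0) => [_|k]; first exact: invariant0.
  by rewrite mderiv0 scaler0 big1 // => j _; rewrite mul0r.
rewrite reynoldsZ; apply: scaled_gradientZ.
have [d] := ubnP (mdeg m); elim: d m => // d IHd m /ltnSE md.
have [m0|] := eqVneq m 0%MM.
  apply: (@scaled_gradient_pure 0%N); first exact: reynolds_inv.
  by move=> k wk; apply: mderiv_supported wk => j; rewrite m0 mnm0E.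
move/eqP => mN; have [j mj] : exists j, m j != 0%N.
  apply: contrapT => /forallNP h; apply: mN; apply/mnmP => j; rewrite mnm0E.
  by apply/eqP; apply: contraT => /(h j).
rewrite (reynolds_split (w j)); apply: scaled_gradientM; try exact: reynolds_inv.
  apply: IHd; apply: leq_trans md.
  rewrite [X in (_ < mdeg X)%N](restr_split (w j)) mdegD -{1}[mdeg _]addn0 ltn_add2l.
  rewrite lt0n mdeg_eq0; apply: contra mj => /eqP/(congr1 (fun m : 'X_{1..n} => m j)).
  by rewrite mnmE mnm0E /= eqxx => /eqP.
apply: (@scaled_gradient_pure (w j)); first exact: reynolds_inv.
by move=> k wk; apply: (mderiv_supported (@restr_supported (pred1 (w j)) m) wk).
Qed.

End Gradient.
End Typed.

(** * The action on the quotient *)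

Lemma mcoeff_linear_form (C : fieldType) n (a : 'I_n -> C) k :
  (\sum_j a j *: 'X_j : {mpoly C[n]})@_U_(k) = a k.
Proof.
rewrite raddf_sum (bigD1 k) //= mcoeffZ mcoeffXU eqxx mulr1 big1 ?addr0 // => i ik.
by rewrite mcoeffZ mcoeffXU (negPf ik) mulr0.
Qed.

(** A linear form is prime: eliminating one of its variables is a substitution
    whose kernel is the ideal it generates. *)
Lemma linear_form_elim (C : fieldType) n (a : 'I_n -> C) j0 : a j0 != 0 ->
  exists t : n.-tuple {mpoly C[n]},
  [/\ forall p, exists q, p - (p \mPo t) = (\sum_j a j *: 'X_j) * q,
      (\sum_j a j *: 'X_j) \mPo t = 0 &
      forall b : 'I_n -> C, (\sum_j b j *: 'X_j) \mPo t =
         \sum_j b j *: 'X_j - (b j0 / a j0) *: \sum_j a j *: 'X_j].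
Proof.
move=> aN0; set l := \sum_j a j *: 'X_j.
pose t := [tuple 'X_i - ((i == j0)%:R / a j0) *: l | i < n].
have tb (b : 'I_n -> C) : (\sum_j b j *: 'X_j) \mPo t =
    \sum_j b j *: 'X_j - (b j0 / a j0) *: l.
  rewrite [LHS](raddf_sum (comp_mpoly t)) /=.
  under eq_bigr do rewrite comp_mpolyZ comp_mpolyXU -tnth_nth tnth_mktuple scalerBr.
  rewrite sumrB; congr (_ - _); rewrite (bigD1 j0) //= eqxx big1 => [|i ij].
    by rewrite addr0 scalerA mulrA mulr1.
  by rewrite (negPf ij) mul0r scale0r scaler0.
exists t; split=> // [p|]; last by rewrite tb divff // scale1r subrr.
rewrite -{1}[p]comp_mpoly_id; apply: comp_mpoly_congr => i.
exists ((i == j0)%:R / a j0)%:MP; rewrite !tnth_mktuple opprB addrC subrK.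
by rewrite [RHS]mulrC mul_mpolyC.
Qed.

(** Modulo the prime la, a relation q lb^k = r la^k lets one divide q by la, k times,
    unless lb vanishes modulo la, that is, is proportional to it. *)
Lemma linear_forms_coprime (C : fieldType) n (a b : 'I_n -> C) (p q r : {mpoly C[n]}) k :
  let la := \sum_j a j *: 'X_j in let lb := \sum_j b j *: 'X_j in
  (exists j, a j != 0) -> p * q = la ^+ k -> p * r = lb ^+ k ->
  (exists s, p * s = 1) \/ exists c, forall j, b j = c * a j.
Proof.
move=> la lb [j0 aN0] eq er; have [t [tp ta tb]] := linear_form_elim aN0.
have laN0 : la != 0.
  apply: contraNneq aN0 => /(congr1 (mcoeff U_(j0))).
  by rewrite mcoeff0 mcoeff_linear_form => ->.
have [e|tN] := eqVneq (lb \mPo t) 0.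
  right; exists (b j0 / a j0) => j; move: e; rewrite tb => /(congr1 (mcoeff U_(j))).
  rewrite mcoeffB mcoeff0 mcoeffZ !mcoeff_linear_form.
  by move/eqP; rewrite subr_eq0 => /eqP.
left; suff [c ec] : exists c, q = c * la ^+ k.
  exists c; apply: (mulIf (expf_neq0 k laN0)).
  by rewrite -mulrA -ec mul1r.
have : q * lb ^+ k = r * la ^+ k by rewrite -eq -er mulrCA [RHS]mulrCA [q * r]mulrC.
have : (lb ^+ k) \mPo t != 0 by rewrite rmorphXn expf_neq0.
move: (lb ^+ k) => m mN {er eq}; elim: k q r => [|k IHk] q r e.
  by exists q; rewrite expr0 mulr1.
have [q' eq'] := tp q; have q0 : q \mPo t = 0.
  apply: (mulIf mN); rewrite mul0r -rmorphM e exprS mulrCA rmorphM /= -/la.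
  by rewrite [la \mPo t]ta mul0r.
move: eq'; rewrite q0 subr0 => eq'.
have [c ec] : exists c, q' = c * la ^+ k.
  by apply: (IHk q' r); apply: (mulfI laN0); rewrite mulrA -eq' e exprS mulrCA.
by exists c; rewrite eq' ec exprS mulrCA.
Qed.

Lemma alg_indep_inj (C : fieldType) n (f : n.-tuple {mpoly C[n]}) :
  algebraically_independent f -> injective (comp_mpoly f).
Proof.
move=> ai p q e; apply/eqP; rewrite -subr_eq0; apply/eqP.
by apply: ai; rewrite raddfB /= e subrr.
Qed.

(** A homogeneous polynomial with a constant term is constant. *)
Lemma alg_indep_coef0 (C : fieldType) n (f : n.-tuple {mpoly C[n]}) (w : 'I_n -> nat) :
  algebraically_independent f -> (forall i, tnth f i \is (w i).-homog) ->
  forall i, (tnth f i)@_0%MM = 0.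
Proof.
move=> ai hw i; apply/eqP; apply: contraT => fi0.
have w0 : w i = 0%N.
  by move: (hw i) => /dhomogP/(_ 0%MM); rewrite mcoeff_msupp fi0 /= mdeg0 => <-.
have ei : tnth f i = ((tnth f i)@_0%MM)%:MP.
  apply/mpolyP => m; rewrite mcoeffC; have [->|mN] := eqVneq m 0%MM.
    by rewrite mulr1.
  by rewrite mulr0 (dhomog_nemf_coeff (hw i)) // w0 /= mdeg_eq0.
have : 'X_i - ((tnth f i)@_0%MM)%:MP = 0 :> {mpoly C[n]}.
  apply: (alg_indep_inj ai).
  by rewrite comp_mpoly0 raddfB /= comp_mpolyXU -tnth_nth comp_mpolyC -ei subrr.
move/(congr1 (mcoeff U_(i))); rewrite mcoeffB mcoeffXU eqxx mcoeffC mnm1_eq0 mulr0.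
by rewrite subr0 mcoeff0 => /eqP; rewrite oner_eq0.
Qed.

Section Quotient.
Variables (C : numClosedFieldType) (gT : finGroupType) (G N : {group gT}).
Variables (nNG : (N <| G)%g) (r : nat).
Variables (rV : mx_representation C G r).
Hypothesis hG : complex_reflection_group rV.
Variables (f : r.-tuple {mpoly C[r]}) (rE : mx_representation C (G / N)%G r).
Hypothesis hf : basic_invariants (res nNG rV) f.
Hypothesis hE : quotient_module nNG rV f rE.
Local Notation S := {mpoly C[r]}.
Variable w : 'I_r -> nat.
Hypothesis hw : forall i, tnth f i \is (w i).-homog.

Lemma comp_basic_inj : injective (comp_mpoly f).
Proof. by have [_ _ ai _] := hf; apply: alg_indep_inj. Qed.

Lemma basic_coef0 i : (tnth f i)@_0%MM = 0.
Proof. by have [_ _ ai _] := hf; apply: alg_indep_coef0 hw _. Qed.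

Lemma comp_basic_coef0 p : (p \mPo f)@_0%MM = p@_0%MM.
Proof. exact/mcoeff0_comp/basic_coef0. Qed.

Lemma coset_inv g : g \in G -> coset N g^-1%g = (coset N g)^-1%g.
Proof. by move=> Gg; rewrite morphV // (subsetP (normal_norm nNG)). Qed.

Lemma polyact_comp_basic g p : g \in G ->
  polyact rV g (p \mPo f) = polyact rE (coset N g) p \mPo f.
Proof.
move=> Gg; elim/mpoly_ring_ind: p => [c|i|p q IHp IHq|p q IHp IHq].
- by rewrite polyactC !comp_mpolyC polyactC.
- rewrite comp_mpolyXU -tnth_nth hE // [polyact rE _ _]lsubXU -coset_inv //.
  rewrite [RHS](raddf_sum (comp_mpoly f)); apply: eq_bigr => k _ /=.
  by rewrite comp_mpolyZ comp_mpolyXU -tnth_nth.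
- by rewrite comp_mpolyD !polyact_add IHp IHq comp_mpolyD.
- by rewrite comp_mpolyM !polyact_mul IHp IHq comp_mpolyM.
Qed.

Lemma invariant_comp_basic p : invariant rV (p \mPo f) <-> invariant rE p.
Proof.
split=> ip g Gg; last by rewrite polyact_comp_basic // ip // mem_quotient.
have /morphimP[h Nh Gh ->] := Gg.
by apply: comp_basic_inj; rewrite -polyact_comp_basic // ip.
Qed.

Lemma invariant_res p : invariant rV p -> invariant (res nNG rV) p.
Proof. by move=> ip g Ng; apply: ip; apply: (subsetP (normal_sub nNG)). Qed.

Lemma euler_comp_basic p :
  euler (fun _ => 1) (p \mPo f) = euler (fun k => (w k)%:R) p \mPo f.
Proof. by apply: euler_comp => j; apply: euler_homog. Qed.

(** The action of G preserves the degrees of the f_i. *)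
Lemma quotient_weights g j k : g \in (G / N)%G -> rE g j k != 0 -> w j = w k.
Proof.
suff H h : h \in G -> rE (coset N h^-1%g) j k != 0 -> w j = w k.
  move=> /morphimP[h Nh Gh ->]; rewrite -[h]invgK; apply: H; exact: groupVr.
move=> Gh; have := hw j => /(polyact_homog rV h); rewrite hE // => /euler_homog e.
have : \sum_k rE (coset N h^-1%g) j k *: (((w k)%:R - (w j)%:R) *: 'X_k) = 0 :> S.
  apply: comp_basic_inj; rewrite comp_mpoly0 raddf_sum /=.
  under eq_bigr do rewrite !comp_mpolyZ comp_mpolyXU -tnth_nth scalerBl scalerBr.
  rewrite sumrB; apply/eqP; rewrite subr_eq0; apply/eqP.
  rewrite raddf_sum scaler_sumr in e; rewrite [RHS](_ : _ =
     \sum_k (w j)%:R *: (rE (coset N h^-1%g) j k *: tnth f k)); last first.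
    by apply: eq_bigr => i _; rewrite !scalerA mulrC.
  rewrite -e; apply: eq_bigr => i _ /=.
  by rewrite eulerZ (euler_homog (hw i)) !scalerA mulrC.
move/(congr1 (mcoeff U_(k))); rewrite mcoeff0 raddf_sum (bigD1 k) //=.
rewrite !mcoeffZ mcoeffXU eqxx mulr1 big1 ?addr0 => [|i ik]; last first.
  by rewrite !mcoeffZ mcoeffXU (negPf ik) !mulr0.
move/eqP; rewrite mulf_eq0 subr_eq0 eqr_nat => /orP[->//|/eqP->].
by [].
Qed.

(** The average over N of a polynomial separating a regular orbit is a polynomial
    in f that distinguishes the points of the orbit in different N-orbits. *)
Lemma quotient_faithful g : g \in (G / N)%G -> rE g = 1%:M -> g = 1%g.
Proof.
move=> /morphimP[h Nh Gh ->] e1.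
have [v [z [zv z0]]] := ex_separating (reflection_group_faithful hG).
have [_ _ _ gen] := hf.
pose q := reynolds (res nNG rV) z.
have [p ep] : exists p, q = p \mPo f by apply: gen; apply: reynolds_inv.
have hq : polyact rV h q = q.
  rewrite ep polyact_comp_basic // polyactE.
  have := repr_mxV rE (mem_quotient N Gh); rewrite e1 invmx1 => ->.
  by rewrite lsub1.
have sNG x : x \in N -> x \in G by apply: (subsetP (normal_sub nNG)).
have eq : q = #|N|%:R^-1 *: \sum_(x in N) polyact rV x z by [].
have vq k : k \in G -> (polyact rV k q).@[v] =
    #|N|%:R^-1 * \sum_(x in N) (polyact rV (k * x) z).@[v].
  move=> Gk; rewrite eq polyact_scale mevalZ polyact_sum (raddf_sum (meval v)).
  apply: (congr1 ( *%R _)).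
  by apply: eq_bigr => x Nx /=; rewrite (polyactM _ _ Gk (sNG x Nx)).
have cN : #|N|%:R^-1 != 0 :> C by rewrite invr_eq0 pnatr_eq0 -lt0n cardG_gt0.
have v1 : q.@[v] = #|N|%:R^-1 * z.@[v].
  rewrite -(polyact1 rV q) (vq _ (group1 G)) (bigD1 1%g) //= mulg1 (polyact1 rV z).
  rewrite big1 ?addr0 // => x /andP[Nx xN1].
  by rewrite mul1g z0 // sNG.
have hN1 : (h^-1)%g \in N.
  apply: contraT => nNh; have := vq h Gh; rewrite hq v1 big1.
    by rewrite mulr0 => /eqP; rewrite mulf_eq0 (negPf cN) (negPf zv).
  move=> x Nx; apply: z0; first by rewrite groupM // sNG.
  apply: contra nNh => /eqP e; have -> // : (h^-1)%g = x.
  by apply/eqP; rewrite eq_invg_mul e.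
by apply: coset_id; rewrite -groupV.
Qed.

(** A reflection of G acts on E as a reflection or trivially: its root divides
    (s - 1) p for every p; were two linear forms in the basic invariants of this
    shape independent, the norm over N of the root would divide powers of both,
    hence be a unit. *)
Lemma quotient_reflection s (x : 'cV_r) (a : 'rV_r) : s \in G ->
  rV s^-1%g = 1%:M + x *m a ->
  exists (x' : 'cV_r) (a' : 'rV_r), rE (coset N s^-1%g) = 1%:M + x' *m a'.
Proof.
move=> Gs es; pose al := \sum_j a 0 j *: 'X_j : S.
pose X := rE (coset N s^-1%g) - 1%:M.
have XjkE j k : X j k = rE (coset N s^-1%g) j k - (j == k)%:R by rewrite !mxE.
have dvd j : exists q, (\sum_k X j k *: 'X_k) \mPo f = al * q.
  have [q eq] := reflection_dvd (tnth f j) es; exists q; rewrite -eq hE //.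
  rewrite (raddf_sum (comp_mpoly f)) /=.
  under eq_bigr do rewrite comp_mpolyZ comp_mpolyXU -tnth_nth XjkE scalerBl.
  rewrite sumrB; congr (_ - _); rewrite (bigD1 j) //= eqxx scale1r big1 ?addr0 // => k kj.
  by rewrite eq_sym (negPf kj) scale0r.
have XE : rE (coset N s^-1%g) = 1%:M + X by rewrite addrC subrK.
have [X0|/matrix0Pn[j0 [k0 X0]]] := eqVneq X 0.
  by exists 0, 0; rewrite XE X0 mul0mx.
pose rN := res nNG rV; have [_ _ _ gen] := hf.
suff H j : exists c, forall k, X j k = c * X j0 k.
  have /fin_all_exists[c hc] := H; exists (\col_j c j), (row j0 X); rewrite XE.
  by congr (_ + _); apply/matrixP => j k; rewrite hc [RHS]mxE big_ord1 !mxE.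
have [q1 e1] := dvd j0; have [q2 e2] := dvd j.
have [n ena] : exists n, norm_poly rN al = n \mPo f by apply/gen/norm_poly_inv.
have [b1 eb1] : exists b, norm_poly rN q1 = b \mPo f by apply/gen/norm_poly_inv.
have [b2 eb2] : exists b, norm_poly rN q2 = b \mPo f by apply/gen/norm_poly_inv.
have normM p q b : (p \mPo f) = al * q -> norm_poly rN q = b \mPo f -> n * b = p ^+ #|N|.
  move=> ep eb; apply: comp_basic_inj; rewrite rmorphM /= -ena -eb rmorphXn /=.
  rewrite /norm_poly -big_split /= -prodr_const; apply: eq_bigr => g Ng.
  rewrite -rmorphM -ep /= -[polyact _ _ _]/(polyact rV g _).
  rewrite polyact_comp_basic ?(subsetP (normal_sub nNG)) // coset_id //.
  by rewrite polyact1.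
have X0' : exists k, X j0 k != 0 by exists k0.
have [[c nc]|//] := linear_forms_coprime X0' (normM _ _ _ e1 eb1) (normM _ _ _ e2 eb2).
have := congr1 (fun p => (p \mPo f)@_0%MM) nc; rewrite !comp_basic_coef0 mcoeff1 eqxx.
rewrite rmorphM /= -(comp_basic_coef0 n) -ena /norm_poly (bigD1 1%g) //= polyact1.
rewrite rmorphM /= raddf_sum /= big1 ?mul0r => [/eqP|k _]; first by rewrite eq_sym oner_eq0.
by rewrite mcoeffZ mcoeffX mnm1_eq0 mulr0.
Qed.

(** An endomorphism x a of rank 1 that preserves the weights has both its image and
    its form a concentrated in one weight. *)
Lemma quotient_generators : exists2 T : {set coset_of N}, (G / N)%g :=: <<T>>%g &
  forall t, t \in T -> (exists (x : 'cV_r) (a : 'rV_r), rE t^-1%g = 1%:M + x *m a) /\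
    exists l, acts_within rE w (pred1 l) t.
Proof.
have [T0 GT hT] := reflection_group_generated hG.
have sTN : T0 \subset 'N(N)%g.
  by apply: subset_trans (normal_norm nNG); rewrite GT subset_gen.
exists (coset N @* T0)%g; first by rewrite /quotient GT morphim_gen.
move=> _ /morphimP[s Ns Ts ->].
have Gs : s \in G by rewrite GT mem_gen.
have [x [a es]] := hT s Ts.
have [x' [a' es']] := quotient_reflection Gs es.
rewrite -coset_inv //; split; first by exists x', a'.
have [X0|/matrix0Pn[j0 [k0 X0]]] := eqVneq (x' *m a') 0.
  exists 0%N; apply/acts_withinP => j k; rewrite (_ : rE _ = 1%:M) ?mxE ?eqxx //.
  have := repr_mxV rE (mem_quotient N (groupVr Gs)); rewrite coset_inv // invgK => ->.
  by rewrite -coset_inv // es' X0 addr0 invmx1.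
have xa j k : (x' *m a') j k = x' j 0 * a' 0 k by rewrite mxE big_ord1.
have Xw j k : (x' *m a') j k != 0 -> w j = w k.
  move=> Xjk; have [->//|jk] := eqVneq j k.
  apply: (@quotient_weights (coset N s^-1%g)); first exact/mem_quotient/groupVr.
  by rewrite es' mxE mxE (negPf jk) add0r.
exists (w j0).
suff Hs : coset N s^-1%g \in within_group rE w (pred1 (w j0)).
  by have := groupVr Hs; rewrite -coset_inv ?groupV // invgK => /within_groupP[].
apply/within_groupP; split; first exact/mem_quotient/groupVr.
apply/acts_withinP => j k; rewrite es' 2!mxE -subr_eq0 addrAC subrr add0r xa => Xjk.
move: X0; rewrite xa !mulf_eq0 !negb_or in Xjk * => /andP[xj0 ak0].
case/andP: Xjk => xj ak /=.
have -> : w k = w j0 by apply/esym/Xw; rewrite xa mulf_neq0.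
by rewrite eqxx (Xw j k0) ?xa ?mulf_neq0 // (Xw j0 k0) ?xa ?mulf_neq0.
Qed.

Lemma quotient_reflection_generated : reflection_generated rE.
Proof.
by have [T HT hT] := quotient_generators; exists T => // t /hT[].
Qed.

End Quotient.

(** * Galois twists of a weight decomposition *)

Lemma idempotent_diagonalizable (F : fieldType) n (A : 'M[F]_n) :
  A *m A = A -> diagonalizable A.
Proof.
case: n A => [|n] A AA.
  by exists 1%:M; rewrite ?unitmx1 //; apply/diagonalizable_forP; rewrite ?unitmx1 // => -[].
apply/diagonalizableP; exists [:: 0; 1]; first by rewrite /= inE eq_sym oner_eq0.
apply: mxminpoly_min; rewrite !big_cons big_nil mulr1 rmorphM !rmorphB /=.
rewrite !horner_mx_X !horner_mx_C raddf0 subr0 -mulmxE mulmxBr AA.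
by rewrite -[1%:M]/(1 : 'M_n.+1) mulmxE mulr1 subrr.
Qed.

Section Averages.
Variables (F : fieldType) (gT : finGroupType) (H : {group gT}) (n : nat).
Variable rho : mx_representation F H n.
Implicit Types K : {group gT}.

(** The projection onto the complement of the K-fixed vectors, along them. *)
Definition moving K : 'M[F]_n := 1%:M - #|K|%:R^-1 *: \sum_(h in K) rho h.

Hypothesis nat_inj : forall k, (0 < k)%N -> k%:R != 0 :> F.

Lemma moving_fixl K g : K \subset H -> g \in K -> (rho g - 1%:M) *m moving K = rho g - 1%:M.
Proof.
move=> /subsetP sKH Kg; rewrite mulmxBr mulmx1 -scalemxAr mulmxBl mul1mx.
rewrite (_ : rho g *m _ = \sum_(h in K) rho h) ?subrr ?scaler0 ?subr0 //.
rewrite mulmx_sumr [RHS](reindex_inj (mulgI g)) /=.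
by apply: eq_big => [h|h Kh]; [rewrite groupMl | rewrite repr_mxM ?sKH].
Qed.

Lemma moving_fixr K g : K \subset H -> g \in K -> moving K *m (rho g - 1%:M) = rho g - 1%:M.
Proof.
move=> /subsetP sKH Kg; rewrite mulmxBl mul1mx -scalemxAl mulmxBr mulmx1.
rewrite (_ : (\sum_(h in K) rho h) *m _ = \sum_(h in K) rho h) ?subrr ?scaler0 ?subr0 //.
rewrite mulmx_suml [RHS](reindex_inj (mulIg g)) /=.
by apply: eq_big => [h|h Kh]; [rewrite groupMr | rewrite repr_mxM ?sKH].
Qed.

Lemma movingE K : moving K = - (#|K|%:R^-1 *: \sum_(h in K) (rho h - 1%:M)).
Proof.
rewrite sumrB sumr_const -scaler_nat scalerBr scalerA mulVf ?nat_inj ?cardG_gt0 //.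
by rewrite scale1r opprB.
Qed.

Lemma moving_idem K : K \subset H -> moving K *m moving K = moving K.
Proof.
move=> sKH; rewrite {1}movingE mulNmx -scalemxAl mulmx_suml [RHS]movingE.
by congr (- (_ *: _)); apply: eq_bigr => h Kh; apply: moving_fixl.
Qed.

End Averages.

Lemma moving_map (F F' : fieldType) (phi : {rmorphism F -> F'}) gT (H K : {group gT}) n
    (rho : mx_representation F H n) :
  moving (map_repr phi rho) K = map_mx phi (moving rho K).
Proof.
rewrite /moving map_mxB map_mx1 map_mxZ fmorphV rmorph_nat; congr (_ - _ *: _).
by rewrite raddf_sum.
Qed.

Lemma moving_rsim (F : fieldType) gT (H K : {group gT}) n
    (rho rho' : mx_representation F H n) B : K \subset H ->
  (forall g, g \in H -> rho g *m B = B *m rho' g) -> moving rho K *m B = B *m moving rho' K.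
Proof.
move=> /subsetP sKH hB; rewrite mulmxBl mulmxBr mul1mx mulmx1 -scalemxAl -scalemxAr.
by rewrite mulmx_suml mulmx_sumr; congr (_ - _ *: _); apply: eq_bigr => h /sKH/hB.
Qed.

Lemma rsim_unit (F : fieldType) gT (H : {group gT}) n (rho rho' : mx_representation F H n) :
  mx_rsim rho rho' -> exists2 B : 'M_n, B \in unitmx &
    forall g, g \in H -> rho g *m B = B *m rho' g.
Proof. by case=> B _ fB hB; exists B; rewrite // -row_free_unit. Qed.

Section Twist.
Variables (C : numClosedFieldType) (gT : finGroupType) (H : {group gT}) (r : nat).
Variables (L : fieldType) (phi psi : {rmorphism L -> C}).
Variables (rE rM : mx_representation C H r) (rL : mx_representation L H r).
Hypothesis simE : mx_rsim rE (map_repr phi rL).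
Hypothesis simM : mx_rsim rM (map_repr psi rL).
Variable w : 'I_r -> nat.
Implicit Types l : nat.

Definition weight_group l := within_group rE w (pred1 l).
Local Notation Hl := weight_group.
Local Notation ls := (undup (codom w)).

Lemma weight_group_sub l : Hl l \subset H.
Proof. exact: within_group_sub. Qed.

Lemma natC k : (0 < k)%N -> k%:R != 0 :> C.
Proof. by rewrite pnatr_eq0 lt0n. Qed.

Lemma moving_within l j k : moving rE (Hl l) j k != 0 -> w j = l /\ w k = l.
Proof.
rewrite (movingE _ natC) mxE mxE summxE => h.
have : [exists g in Hl l, (rE g - 1%:M) j k != 0].
  apply: contraNT h => /existsPn h; rewrite big1 ?mulr0 ?oppr0 // => g Kg.
  by apply/eqP; have := h g; rewrite Kg negbK.
move=> /existsP[g /andP[/within_groupP[_ /acts_withinP hg]]].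
by rewrite !mxE subr_eq0 => /hg[/eqP -> /eqP ->].
Qed.

(** An expression Q in the projections [moving], natural for field morphisms and
    base changes, takes on both modules the conjugates of its value over L. *)
Lemma moving_transfer (Q : forall F : fieldType, (nat -> 'M[F]_r) -> 'M[F]_r) :
  (forall (F F' : fieldType) (f : {rmorphism F -> F'}) X,
     map_mx f (Q F X) = Q F' (fun l => map_mx f (X l))) ->
  (forall (F : fieldType) X Y (B : 'M[F]_r), B \in unitmx ->
     (forall l, X l *m B = B *m Y l) -> Q F X *m B = B *m Q F Y) ->
  char_poly (Q C (fun l => moving rE (Hl l))) =
    map_poly phi (char_poly (Q L (fun l => moving rL (Hl l)))) /\
  (Q C (fun l => moving rE (Hl l)) = 0 -> Q C (fun l => moving rM (Hl l)) = 0) /\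
  char_poly (Q C (fun l => moving rM (Hl l))) =
    map_poly psi (char_poly (Q L (fun l => moving rL (Hl l)))).
Proof.
move=> Qmap Qsim; have [B uB hB] := rsim_unit simE; have [B' uB' hB'] := rsim_unit simM.
have eE : Q C (fun l => moving rE (Hl l)) *m B =
    B *m map_mx phi (Q L (fun l => moving rL (Hl l))).
  rewrite Qmap; apply: Qsim => // l; rewrite -moving_map; apply: moving_rsim => //.
  exact: weight_group_sub.
have eM : Q C (fun l => moving rM (Hl l)) *m B' =
    B' *m map_mx psi (Q L (fun l => moving rL (Hl l))).
  rewrite Qmap; apply: Qsim => // l; rewrite -moving_map; apply: moving_rsim => //.
  exact: weight_group_sub.
have dB A : A \in unitmx -> \det A != 0 :> C by rewrite unitmxE unitfE.
rewrite !map_char_poly; split; [|split].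
- exact: esym (char_poly_intertwine (dB _ _ uB) (esym eE)).
- move=> E0; move: eE; rewrite E0 mul0mx => /esym/(canRL (mulKmx uB)).
  rewrite mulmx0 => /eqP; rewrite map_mx_eq0 => /eqP L0.
  by move: eM; rewrite L0 map_mx0 mulmx0 => /(canRL (mulmxK uB')); rewrite mul0mx.
- exact: esym (char_poly_intertwine (dB _ _ uB') (esym eM)).
Qed.

Lemma moving_orthoE l l' : l != l' -> moving rE (Hl l) *m moving rE (Hl l') = 0.
Proof.
move=> ll'; apply/matrixP => i j; rewrite mxE [RHS]mxE big1 // => k _.
apply/eqP; apply: contraT; rewrite mulf_eq0 negb_or => /andP[/moving_within[_ e]].
by move=> /moving_within[e' _]; move: ll'; rewrite -e -e' eqxx.
Qed.

Lemma moving_ortho l l' : l != l' -> moving rM (Hl l) *m moving rM (Hl l') = 0.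
Proof.
move=> ll'; have [||_ [h _]] := @moving_transfer (fun F X => X l *m X l').
- by move=> F F' f X; rewrite map_mxM.
- by move=> F X Y B uB h; rewrite -mulmxA h mulmxA h mulmxA.
by apply: h; apply: moving_orthoE.
Qed.

Lemma moving_notin l : l \notin ls -> moving rM (Hl l) = 0.
Proof.
move=> nl; have [||_ [h _]] := @moving_transfer (fun F X => X l) => //; apply: h.
apply/matrixP => i j; rewrite [RHS]mxE; apply/eqP; apply: contraNT nl.
by move=> /moving_within[<- _]; rewrite mem_undup codom_f.
Qed.

(** On the projections of the weight groups its eigenvalues are natural numbers,
    which are not changed by a Galois twist; the shift separates the weight 0 from
    the eigenvalue 0 of fixed vectors. *)
Definition weight_mx (F : fieldType) (X : nat -> 'M[F]_r) : 'M[F]_r := \sum_(l <- ls) l.+1%:R *: X l.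

Local Notation ZE := (weight_mx (fun l => moving rE (Hl l))).
Local Notation ZM := (weight_mx (fun l => moving rM (Hl l))).

Lemma moving_weight t l : t \in Hl l ->
  (rM t - 1%:M) *m ZM = l.+1%:R *: (rM t - 1%:M) /\
  ZM *m (rM t - 1%:M) = l.+1%:R *: (rM t - 1%:M).
Proof.
move=> tl; have sl := weight_group_sub l.
have fl := moving_fixl rM sl tl; have fr := moving_fixr rM sl tl.
have [lls|nl] := boolP (l \in ls); last first.
  by have t0 : rM t - 1%:M = 0; [rewrite -fl moving_notin // mulmx0 | rewrite t0 mul0mx mulmx0 scaler0].
split; rewrite /weight_mx ?mulmx_sumr ?mulmx_suml (bigD1_seq l) ?undup_uniq //= big1 ?addr0.
- by rewrite -scalemxAr fl.
- by move=> l' ll'; rewrite -fl -mulmxA -scalemxAr moving_ortho 1?eq_sym // scaler0 mulmx0.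
- by rewrite -scalemxAl fr.
- by move=> l' ll'; rewrite -fr mulmxA -scalemxAl moving_ortho // scaler0 mul0mx.
Qed.

(** On E the matrix is the product of the commuting diagonal matrix of the shifted
    weights and of the idempotent sum of the projections. *)
Lemma spectrum_weight_mx : exists2 z : r.-tuple nat, has_spectrum ZE (tnth z) &
  exists2 d : r.-tuple nat, perm_eq d [tuple (w i).+1 | i < r] &
    forall i, tnth z i = 0%N \/ tnth z i = tnth d i.
Proof.
pose p := \sum_(l <- ls) moving rE (Hl l); pose W := natdiag C (fun i => (w i).+1).
have Wmul (A : 'M[C]_r) i j : (W *m A) i j = (w i).+1%:R * A i j.
  by rewrite mul_diag_mx !mxE.
have mulW (A : 'M[C]_r) i j : (A *m W) i j = A i j * (w j).+1%:R.
  by rewrite mul_mx_diag !mxE.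
have eZ : ZE = W *m p.
  rewrite mulmx_sumr; apply: eq_bigr => l _; apply/matrixP => i j; rewrite Wmul mxE.
  by have [->|/moving_within[-> _]//] := eqVneq (moving rE (Hl l) i j) 0; rewrite !mulr0.
have pW : p *m W = W *m p.
  rewrite mulmx_sumr mulmx_suml; apply: eq_bigr => l _; apply/matrixP => i j.
  rewrite Wmul mulW mulrC.
  by have [->|/moving_within[-> ->]//] := eqVneq (moving rE (Hl l) i j) 0; rewrite !mulr0.
have pp : p *m p = p.
  rewrite {1}/p mulmx_suml [RHS]big_seq big_seq; apply: eq_bigr => l lls.
  rewrite mulmx_sumr (bigD1_seq l) ?undup_uniq //= big1 ?addr0 => [|l' ll'].
    exact: moving_idem natC _ (weight_group_sub l).
  by rewrite moving_orthoE // eq_sym.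
have [P uP /diagonalizable_forPex[x /(simmxP uP) ePx]] := idempotent_diagonalizable pp.
have xx i : x 0 i = 0 \/ x 0 i = 1.
  have : diag_mx x *m diag_mx x = diag_mx x.
    apply: (can_inj (mulmxK uP)); rewrite -mulmxA -ePx mulmxA -ePx -mulmxA pp.
    by [].
  move/matrixP/(_ i i); rewrite mulmx_diag !mxE eqxx !mulr1n => /eqP.
  rewrite -subr_eq0 -{3}[x 0 i]mulr1 -mulrBr mulf_eq0 subr_eq0.
  by case/orP => /eqP; [left|right].
pose t := [tuple (x 0 i == 1 : nat) | i < r].
have et i : x 0 i = (tnth t i)%:R.
  by rewrite tnth_mktuple; case: (xx i) => ->; rewrite ?eqxx // eq_sym oner_eq0.
have spt : has_spectrum p (tnth t).
  rewrite /has_spectrum -(natdiag_spectrum C (tnth t)).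
  apply: (@char_poly_intertwine _ _ P); first by rewrite -unitfE -unitmxE.
  by rewrite ePx; congr (diag_mx _ *m _); apply/rowP => i; rewrite mxE et.
have spW : has_spectrum W (tnth [tuple (w i).+1 | i < r]).
  rewrite /has_spectrum (natdiag_spectrum C (fun i => (w i).+1)).
  by apply: eq_bigr => i _; rewrite tnth_mktuple.
have [d' [t' [pd pt _ spZ]]] := joint_spectrum (esym pW) spW spt.
exists [tuple tnth d' i * tnth t' i | i < r]%N.
  rewrite eZ /has_spectrum (spZ : char_poly _ = _).
  by apply: eq_bigr => i _; rewrite tnth_mktuple.
exists d' => // i; rewrite tnth_mktuple.
have : tnth t' i \in t by rewrite -(perm_mem pt) mem_tnth.
by move=> /mapP[k _ ->]; case: (_ == _); [right; rewrite muln1|left; rewrite muln0].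
Qed.

(** The projections of the weight groups are commuting idempotents on the twist too,
    so they are diagonal in a common basis.  There [weight_mx] has the integral
    eigenvalues that it has on E, each either 0 or the shift of a weight: this
    assigns a weight to every basis vector, compatibly with the projections. *)
Lemma twist_weights : exists2 P : 'M[C]_r, P \in unitmx &
  exists2 wM : r.-tuple nat, perm_eq wM [tuple w i | i < r] &
  forall t l, t \in Hl l -> forall j k,
    (P *m (rM t - 1%:M) *m invmx P) j k != 0 -> tnth wM j = l /\ tnth wM k = l.
Proof.
pose As := [seq moving rM (Hl l) | l <- ls].
have [P uP dP] : codiagonalizable As.
  apply/codiagonalizableP; split.
    move=> _ _ /mapP[l _ ->] /mapP[l' _ ->]; have [->//|ll'] := eqVneq l l'.
    by rewrite /comm_mx !moving_ortho // eq_sym.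
  move=> _ /mapP[l _ ->]; apply: idempotent_diagonalizable.
  exact: moving_idem natC _ (weight_group_sub l).
have /choice[x hx] l : exists x : 'rV[C]_r, l \in ls ->
    P *m moving rM (Hl l) = diag_mx x *m P.
  have [lls|_] := boolP (l \in ls); last by exists 0.
  have /diagonalizable_forPex[x /(simmxP uP) e] := allP dP _ (map_f _ lls).
  by exists x.
have xx l i : l \in ls -> x l 0 i = 0 \/ x l 0 i = 1.
  move=> lls; have : diag_mx (x l) *m diag_mx (x l) = diag_mx (x l).
    apply: (can_inj (mulmxK uP)); rewrite -mulmxA -hx // mulmxA -hx // -mulmxA.
    by rewrite (moving_idem rM natC (weight_group_sub l)).
  move/matrixP/(_ i i); rewrite mulmx_diag !mxE eqxx !mulr1n => /eqP.
  rewrite -subr_eq0 -{3}[x l 0 i]mulr1 -mulrBr mulf_eq0 subr_eq0.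
  by case/orP => /eqP; [left|right].
pose z := [tuple \sum_(l <- ls) l.+1 * (x l ord0 i == 1%R) | i < r]%N.
have PZ : P *m ZM = natdiag C (tnth z) *m P.
  rewrite /weight_mx mulmx_sumr [LHS]big_seq.
  rewrite (eq_bigr (fun l => l.+1%:R *: diag_mx (x l) *m P)) => [|l lls]; last first.
    by rewrite -scalemxAr hx // scalemxAl.
  rewrite -mulmx_suml -big_seq; congr (_ *m P); apply/matrixP => i j.
  rewrite summxE !mxE tnth_mktuple natr_sum -sumrMnl big_seq [RHS]big_seq.
  apply: eq_bigr => l lls; rewrite !mxE natrM -mulrnAr; congr (_ * (_ *+ _)).
  by case: (xx l i lls) => ->; rewrite ?eqxx // eq_sym oner_eq0.
have [zE spE [d pd zd]] := spectrum_weight_mx.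
have [||eE [_ eM]] := @moving_transfer weight_mx.
- move=> F F' f X; rewrite /weight_mx raddf_sum; apply: eq_bigr => l _ /=.
  by rewrite map_mxZ rmorph_nat.
- move=> F X Y B uB h; rewrite /weight_mx mulmx_suml mulmx_sumr; apply: eq_bigr => l _.
  by rewrite -scalemxAl -scalemxAr h.
have spM : has_spectrum ZM (tnth zE).
  have mapq (f : {rmorphism L -> C}) :
      map_poly f (\prod_i ('X - (tnth zE i)%:R%:P)) = \prod_i ('X - (tnth zE i)%:R%:P).
    rewrite rmorph_prod; apply: eq_bigr => i _ /=.
    by rewrite rmorphB /= map_polyX map_polyC /= rmorph_nat.
  rewrite /has_spectrum eM -(mapq psi); congr map_poly.
  by apply: (map_poly_inj phi); rewrite -eE mapq.
have spM' : has_spectrum ZM (tnth z).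
  rewrite /has_spectrum -(natdiag_spectrum C (tnth z)).
  by apply: (char_poly_intertwine _ PZ); rewrite -unitfE -unitmxE.
have /tuple_permP[pi ez] : perm_eq z zE by apply: (spectrum_perm spM').
have tz i : tnth z i = tnth zE (pi i).
  have -> : z = [tuple tnth zE (pi i) | i < r] by apply: val_inj.
  by rewrite tnth_mktuple.
exists P => //; exists [tuple (tnth d (pi i)).-1 | i < r].
  have h : perm_eq [tuple tnth d (pi i) | i < r] [tuple (w i).+1 | i < r].
    by apply: perm_trans pd; apply/tuple_permP; exists pi.
  have := perm_map predn h; congr perm_eq; rewrite -map_comp; exact: eq_map.
move=> t l tl j k; set Y := P *m _ *m _ => Yjk.
have [e1 e2] := moving_weight tl.
have PZ' : natdiag C (tnth z) = P *m ZM *m invmx P by rewrite PZ mulmxK.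
have Y1 : Y *m natdiag C (tnth z) = l.+1%:R *: Y.
  by rewrite PZ' /Y !mulmxA mulmxKV // -(mulmxA P) e1 -scalemxAr -scalemxAl.
have Y2 : natdiag C (tnth z) *m Y = l.+1%:R *: Y.
  by rewrite PZ' /Y !mulmxA mulmxKV // -(mulmxA P ZM) e2 -scalemxAr -scalemxAl.
have wz i : tnth z i = l.+1 -> tnth [tuple (tnth d (pi i)).-1 | i < r] i = l.
  by rewrite tz tnth_mktuple; case: (zd (pi i)) => -> // ->.
clearbody Y; split; apply: wz; apply/eqP; rewrite -(eqr_nat C).
  move/matrixP/(_ j k): Y2; rewrite mul_diag_mx !mxE => /(mulIf Yjk) ->.
  by [].
move/matrixP/(_ j k): Y1; rewrite mul_mx_diag !mxE mulrC => /(mulIf Yjk) ->.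
by [].
Qed.

End Twist.

(** * Degrees *)

Section Coefficients.
Variables (C : fieldType).

Lemma mcoeff_euler n (w : 'I_n -> C) p m :
  (euler w p)@_m = (\sum_i (m i)%:R * w i) * p@_m.
Proof.
rewrite [p in LHS]mpolyE euler_sum [p in RHS]mpolyE !raddf_sum mulr_sumr.
apply: eq_bigr => l _ /=; rewrite eulerZ eulerX !mcoeffZ mcoeffX.
by have [->|] := eqVneq l m; rewrite ?mulr0 // mulrCA.
Qed.

Lemma mcoeff_mderiv0 n (p : {mpoly C[n]}) k : (p^`M(k))@_0%MM = p@_U_(k).
Proof. by rewrite mcoeff_mderiv add0m mnm0E. Qed.

Lemma mcoeffM_linear n (p q : {mpoly C[n]}) k : q@_0%MM = 0 ->
  (p * q)@_U_(k) = p@_0%MM * q@_U_(k).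
Proof.
move=> q0; rewrite -mcoeff_mderiv0 mderivM mcoeffD !rmorphM /= q0 mulr0 add0r.
by rewrite mcoeff_mderiv0.
Qed.

Lemma mcoeff_comp_linear n k (t : n.-tuple {mpoly C[k]}) p i :
  (forall j, (tnth t j)@_0%MM = 0) ->
  (p \mPo t)@_U_(i) = \sum_j p@_U_(j) * (tnth t j)@_U_(i).
Proof.
move=> t0; rewrite -mcoeff_mderiv0 mderiv_comp raddf_sum; apply: eq_bigr => j _ /=.
by rewrite rmorphM /= mcoeff0_comp // !mcoeff_mderiv0.
Qed.

Lemma comp_mpolyA n k l (p : {mpoly C[n]}) (t : n.-tuple {mpoly C[k]}) (s : k.-tuple {mpoly C[l]}) :
  (p \mPo t) \mPo s = p \mPo [tuple tnth t i \mPo s | i < n].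
Proof.
elim/mpoly_ring_ind: p => [c|i|p q IHp IHq|p q IHp IHq].
- by rewrite !comp_mpolyC.
- by rewrite !comp_mpolyXU -!tnth_nth tnth_mktuple.
- by rewrite !comp_mpolyD IHp IHq.
- by rewrite !comp_mpolyM IHp IHq.
Qed.

Lemma euler_mderiv_homog n (p : {mpoly C[n]}) d k : p \is d.-homog ->
  euler (fun _ => 1) p^`M(k) = (d%:R - 1) *: p^`M(k).
Proof.
move=> hp; apply/mpolyP => m; rewrite mcoeff_euler mcoeffZ.
have [->|mN] := eqVneq ((p^`M(k))@_m) 0; first by rewrite !mulr0.
congr (_ * _); have pm : p@_(m + U_(k)) != 0.
  by apply: contraNneq mN => e; rewrite mcoeff_mderiv e mul0rn.
have := dhomogP _ _ _ hp (m + U_(k))%MM; rewrite mcoeff_msupp pm /= mdegD mdeg1.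
move=> /(_ isT) <-; rewrite natrD addrK mdegE natr_sum.
by apply: eq_bigr => i _; rewrite mulr1.
Qed.

End Coefficients.

Section Degrees.
Variables (C : numClosedFieldType) (gT : finGroupType) (K : {group gT}) (n : nat).
Variable rK : mx_representation C K n.
Local Notation S := {mpoly C[n]}.

(** Phi and W are expressed in each other by substitutions with mutually inverse
    linear parts.  Applying the Euler derivation to W = F o Phi and taking linear
    parts intertwines the degrees of Phi with the constant term of T. *)
Lemma degrees_intertwine (Phi W : n.-tuple S) d (T : 'M[S]_n) :
  basic_invariants rK Phi -> (forall i, tnth Phi i \is (d i).-homog) ->
  (forall i, invariant rK (tnth W i)) -> injective (comp_mpoly W) ->
  (forall i, (tnth W i)@_0%MM = 0) ->
  (forall q, invariant rK q -> exists p, q = p \mPo W) ->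
  (forall i j, invariant rK (T i j)) ->
  (forall i, euler (fun _ => 1) (tnth W i) = \sum_j T i j * tnth W j) ->
  char_poly (mx0 T) = char_poly (natdiag C d).
Proof.
move=> [_ iPhi aPhi genPhi] hd iW injW W0 genW iT ET.
have injPhi := alg_indep_inj aPhi; have Phi0 := alg_indep_coef0 aPhi hd.
have /fin_all_exists[F eF] i := genPhi _ (iW i).
have /fin_all_exists[Gt eG] j := genW _ (iPhi j).
have /fin_all_exists[tau etau] i : exists t : 'I_n -> S, forall j, T i j = t j \mPo Phi.
  by apply: (@fin_all_exists _ _ (fun j p => T i j = p \mPo Phi)) => j; apply: genPhi.
have F0 i : (F i)@_0%MM = 0 by rewrite -(mcoeff0_comp _ Phi0) -eF W0.
have G0 j : (Gt j)@_0%MM = 0 by rewrite -(mcoeff0_comp _ W0) -eG Phi0.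
pose ga := \matrix_(i, j) (F i)@_U_(j); pose ga' := \matrix_(i, j) (Gt i)@_U_(j).
have FG i : F i \mPo [tuple Gt j | j < n] = 'X_i.
  apply: injW; rewrite comp_mpolyA comp_mpolyXU -tnth_nth eF; congr (_ \mPo _).
  by apply: eq_from_tnth => j; rewrite !tnth_mktuple -eG.
have gg' : ga *m ga' = 1%:M.
  apply/matrixP => i k; rewrite !mxE -(mcoeffXU C) -FG mcoeff_comp_linear; last first.
    by move=> j; rewrite tnth_mktuple.
  by apply: eq_bigr => j _; rewrite !mxE tnth_mktuple.
have dga : \det ga != 0.
  have := congr1 determinant gg'; rewrite det_mulmx det1 => e.
  by apply: contra_eq_neq e => ->; rewrite mul0r eq_sym oner_eq0.
apply/esym; apply: (char_poly_intertwine dga); apply/matrixP => i l.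
have e : euler (fun k => (d k)%:R) (F i) = \sum_j tau i j * F j.
  apply: injPhi; rewrite -(euler_comp _ (w := fun _ => 1)) => [|j]; last exact: euler_homog.
  rewrite -eF ET (raddf_sum (comp_mpoly Phi)); apply: eq_bigr => j _ /=.
  by rewrite comp_mpolyM -eF -etau.
have := congr1 (mcoeff U_(l)) e; rewrite mcoeff_euler (bigD1 l) //= mnm1E eqxx mul1r.
rewrite big1 ?addr0 => [e1|j jl]; last by rewrite mnm1E eq_sym (negPf jl) mul0r.
rewrite /natdiag mul_mx_diag !mxE mulrC e1 raddf_sum; apply: eq_bigr => j _ /=.
by rewrite mcoeffM_linear // mx0E mxE etau mcoeff0_comp.
Qed.

Definition jacobian (theta : n.-tuple S) : 'M[S]_n :=
  \matrix_(i, k) (tnth theta i)^`M(k).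

(** Invariants with prescribed gradient at a regular point, obtained by averaging,
    show that the gradients of basic invariants are independent there. *)
Lemma jacobian_det (theta : n.-tuple S) :
  (forall g, g \in K -> rK g = 1%:M -> g = 1%g) ->
  basic_invariants rK theta -> \det (jacobian theta) != 0.
Proof.
move=> fK bt; have [v [z [zv z0]]] := ex_separating fK.
(* The square makes all translates of z^2 (X_k - v_k) but one vanish to order 2 at v,
   while the remaining one has gradient z(v)^2 e_k. *)
pose p k := reynolds rK (z ^+ 2 * ('X_k - (v k)%:MP)).
have /fin_all_exists[c hc] k : exists c : 'I_n -> S, forall l,
    (p k)^`M(l) = \sum_j c j * (tnth theta j)^`M(l).
  by have [c _ ec] := gradient_basic bt (reynolds_inv rK (z ^+ 2 * ('X_k - (v k)%:MP))); exists c.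
have ePJ : \matrix_(k, l) (p k)^`M(l) = (\matrix_(k, j) c k j) *m jacobian theta.
  by apply/matrixP => k l; rewrite !mxE hc; apply: eq_bigr => j _; rewrite !mxE.
have cardN0 : #|K|%:R^-1 != 0 :> C by rewrite invr_eq0 cardG_neq0.
have ePv : map_mx (meval v) (\matrix_(k, l) (p k)^`M(l)) =
    (#|K|%:R^-1 * z.@[v] ^+ 2)%:M.
  have eg g k l : g \in K -> (polyact rK g (z ^+ 2 * ('X_k - (v k)%:MP)))^`M(l).@[v] =
      (g == 1%g)%:R * (z.@[v] ^+ 2 * (k == l)%:R).
    move=> Kg; have [->|gN1] := eqVneq g 1%g.
      rewrite polyact1 mul1r mderivM mderivB mderivC subr0 mevalD !mevalM mevalB mevalXU.
      rewrite mevalC subrr mulr0 add0r -expr2 mderivX mnm1E.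
      have [->|kl] := eqVneq k l; last by rewrite scale0r meval0.
      by rewrite scale1r subm_self mpolyX0 meval1.
    have zg := z0 g Kg gN1; rewrite mul0r !polyact_mul !mderivM !(mevalD, mevalM) zg.
    by rewrite !(mul0r, mulr0, addr0).
  apply/matrixP => k l; rewrite !mxE /p /reynolds mderivZ mevalZ -mulrnAr.
  rewrite [X in X.@[v]]raddf_sum raddf_sum /= (bigD1 1%g) //= eg // eqxx mul1r.
  rewrite big1 ?addr0 ?mulr_natr // => g /andP[Kg gN1].
  by rewrite eg // (negPf gN1) mul0r.
have : \det (map_mx (meval v) (\matrix_(k, l) (p k)^`M(l))) != 0.
  by rewrite ePv det_scalar expf_neq0 // mulf_neq0 // expf_neq0.
apply: contraNneq => dJ; rewrite ePJ det_map_mx det_mulmx dJ mulr0.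
by rewrite rmorph0.
Qed.

End Degrees.

(** * Exponents and degrees of the quotient *)

Section Composition.
Variables (C : numClosedFieldType) (n : nat) (f : n.-tuple {mpoly C[n]}).
Local Notation S := {mpoly C[n]}.

Definition compmx m k (A : 'M[S]_(m, k)) : 'M[S]_(m, k) := map_mx (comp_mpoly f) A.

Lemma compmxE m k (A : 'M[S]_(m, k)) i j : compmx A i j = A i j \mPo f.
Proof. exact: mxE. Qed.

Lemma compmxM m k l (A : 'M[S]_(m, k)) (B : 'M_(k, l)) :
  compmx (A *m B) = compmx A *m compmx B.
Proof. exact: map_mxM. Qed.

Lemma compmx_cmx m k (A : 'M[C]_(m, k)) : compmx (cmx n A) = cmx n A.
Proof. by apply/matrixP => i j; rewrite compmxE !mxsE comp_mpolyC. Qed.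

End Composition.
Global Opaque compmx.

Lemma natdiag_comm (C : fieldType) r (A : 'M[C]_r) (d : 'I_r -> nat) :
  (forall j k, A j k != 0 -> d j = d k) -> natdiag C d *m A = A *m natdiag C d.
Proof.
move=> h; apply/matrixP => j k; rewrite mul_diag_mx mul_mx_diag !mxE mulrC.
by have [->|/h ->//] := eqVneq (A j k) 0; rewrite !mul0r.
Qed.

Lemma euler_shift (C : fieldType) n (w : 'I_n -> C) c (p : {mpoly C[n]}) :
  euler (fun i => w i - c) p = euler w p - c *: euler (fun _ => 1) p.
Proof.
apply/mpolyP => m; rewrite mcoeffB mcoeffZ !mcoeff_euler mulrA -mulrBl; congr (_ * _).
rewrite mulr_sumr -sumrB; apply: eq_bigr => i _.
by rewrite mulr1 mulrBr [c * _]mulrC.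
Qed.

(** The invariants without constant term lie in the Hilbert ideal, so modulo it
    invariant coefficients reduce to their constant terms. *)
Lemma mx0_mod_hilbert (C : numClosedFieldType) (gT : finGroupType) (G : {group gT}) n
    (rG : mx_representation C G n) m k l (B : 'M[{mpoly C[n]}]_(m, k)) (A A' : 'M_(l, m)) :
  indep_mod_hilbert rG B -> invmat rG A -> invmat rG A' ->
  (forall i j, hilbert_ideal rG ((A *m B - A' *m B) i j)) -> mx0 A = mx0 A'.
Proof.
move=> iB /invmatP iA /invmatP iA' hAA'; apply/row_matrixP => i; apply/eqP.
rewrite -subr_eq0; apply/eqP/iB => j.
have -> : (cmx n (row i (mx0 A) - row i (mx0 A')) *m B) 0 j = (A *m B - A' *m B) i j -
    \sum_s (A i s - A' i s - ((A i s - A' i s)@_0%MM)%:MP) * B s j.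
  rewrite !mxE -!sumrB; apply: eq_bigr => s _.
  by rewrite !mxsE -mulrBl -mulrBl subKr mcoeffB.
apply: hilbert_idealB (hAA' i j) _; apply: hilbert_ideal_sum => s _.
apply: hilbert_ideal_gen; last by rewrite [LHS]mcoeffB mcoeffC eqxx mulr1 subrr.
rewrite -[A' i s]scale1r -mpolyCN -!scaleNr; apply: invariantD; last exact: invariantC.
by apply: invariantD => //; apply: invariantZ.
Qed.

Section Quotient.
Variables (C : numClosedFieldType) (gT : finGroupType) (G N : {group gT}).
Variables (nNG : (N <| G)%g) (r : nat).
Variables (rV : mx_representation C G r).
Hypothesis hG : complex_reflection_group rV.
Variables (f : r.-tuple {mpoly C[r]}) (rE : mx_representation C (G / N)%G r).
Hypothesis hf : basic_invariants (res nNG rV) f.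
Hypothesis hE : quotient_module nNG rV f rE.
Local Notation S := {mpoly C[r]}.
Variable w : 'I_r -> nat.
Hypothesis hw : forall i, tnth f i \is (w i).-homog.
Local Notation E := (eulermx (fun _ : 'I_r => 1)).
Local Notation Ew := (eulermx (fun i => (w i)%:R)).
Local Notation comp := (compmx f).

Lemma compmx_inj m k : injective (@compmx C r f m k).
Proof.
move=> A B /matrixP AB; apply/matrixP => i j; apply: (comp_basic_inj hf).
by have := AB i j; rewrite !compmxE.
Qed.

Lemma compmx_act g m k (A : 'M[S]_(m, k)) : g \in G ->
  actmx rV g (comp A) = comp (actmx rE (coset N g) A).
Proof.
move=> Gg; apply/matrixP => i j; rewrite actmxE (compmxE f A) compmxE actmxE.
exact: (polyact_comp_basic hE).
Qed.

Lemma compmx_euler m k (A : 'M[S]_(m, k)) : E (comp A) = comp (Ew A).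
Proof.
by apply/matrixP => i j; rewrite eulermxE !compmxE eulermxE; apply: euler_comp_basic.
Qed.

Lemma compmx0 m k (A : 'M[S]_(m, k)) : mx0 (comp A) = mx0 A.
Proof.
by apply/matrixP => i j; rewrite !mx0E compmxE; apply: (comp_basic_coef0 hf hw).
Qed.

Lemma compmx_invmat m k (A : 'M[S]_(m, k)) : invmat rE A -> invmat rV (comp A).
Proof. by move=> iA g Gg; rewrite compmx_act // iA // mem_quotient. Qed.

Section Scaling.
Variables (rM : mx_representation C (G / N)%G r) (P : 'M[C]_r) (wM : r.-tuple nat).
Hypothesis uP : P \in unitmx.
Hypothesis hP : forall t l, t \in weight_group rE w l -> forall j k,
  (P *m (rM t - 1%:M) *m invmx P) j k != 0 -> tnth wM j = l /\ tnth wM k = l.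

Definition twist_scaling : 'M[C]_r := invmx P *m natdiag C (tnth wM) *m P.

(** A generator acting within weight l moves only basis vectors of weight l, on which
    the scaling is multiplication by l. *)
Lemma twist_scaling_comm g : g \in (G / N)%g -> twist_scaling *m rM g = rM g *m twist_scaling.
Proof.
have [T HT hT] := quotient_generators hG hf hE hw.
move: g; apply: (gen_ind HT) => [|g h Gg Gh eg eh|t Tt].
- by rewrite repr_mx1 mulmx1 mul1mx.
- by rewrite repr_mxM // mulmxA eg -[LHS]mulmxA eh mulmxA.
have Gt : t \in (G / N)%g by rewrite HT mem_gen.
have [_ [l tl]] := hT t Tt.
have tw : t \in weight_group rE w l by apply/within_groupP.
have [Y eY] : exists Y, Y = P *m (rM t - 1%:M) *m invmx P by eexists.
have comm : natdiag C (tnth wM) *m Y = Y *m natdiag C (tnth wM).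
  by apply: natdiag_comm => j k; rewrite eY => /(hP tw)[-> ->].
have -> : rM t = 1%:M + invmx P *m Y *m P.
  by rewrite eY !mulmxA mulVmx // mul1mx mulmxKV // addrC subrK.
rewrite mulmxDl mulmxDr mul1mx mulmx1; congr (_ + _); rewrite /twist_scaling.
by rewrite !mulmxA !mulmxK // -(mulmxA _ _ Y) comm !mulmxA.
Qed.

(** In the basis adapted to the weights, an entry of twisted weight l is fixed by
    the generators acting away from l, and [euler_within_ideal] applies to it. *)
Lemma euler_scaling_ideal (B : 'M[S]_r) : covariant rE rM B -> forall i k,
  hilbert_ideal rE ((Ew B - E B *m cmx r twist_scaling) i k).
Proof.
move=> cB i k; have [T HT hT] := quotient_generators hG hf hE hw.
have hT' t : t \in T -> exists l, acts_within rE w (pred1 l) t by move=> /hT[].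
have wE : forall g j k, g \in (G / N)%g -> rE g j k != 0 -> w j = w k.
  by move=> g j k'; apply: (quotient_weights hf hE hw).
have [B' eB'] : exists B', B' = B *m cmx r (invmx P) by eexists.
have eB : B = B' *m cmx r P by rewrite eB' -mulmxA -cmxM mulVmx // cmx1 mulmx1.
have -> : Ew B - E B *m cmx r twist_scaling =
    (Ew B' - E B' *m cmx r (natdiag C (tnth wM))) *m cmx r P.
  rewrite eB !eulermx_cmxr mulmxBl -!mulmxA -!cmxM; congr (_ - _ *m cmx r _).
  by rewrite /twist_scaling !mulmxA mulmxV // mul1mx.
rewrite mxE; apply: hilbert_ideal_sum => j _; apply: hilbert_idealMr.
have -> : (Ew B' - E B' *m cmx r (natdiag C (tnth wM))) i j =
    euler (fun a => (w a)%:R - (tnth wM j)%:R) (B' i j).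
  rewrite euler_shift !mxsE; congr (_ - _).
  rewrite (bigD1 j) //= !mxsE eqxx mulr1n big1 ?addr0 => [|l lj].
    by rewrite mulrC mul_mpolyC.
  by rewrite !mxsE (negPf lj) mulr0n mpolyC0 mulr0.
apply: (euler_within_ideal HT hT' wE) => s Ts sP.
have Gs : s \in (G / N)%g by rewrite HT mem_gen.
have [l sl] := hT' s Ts; have sw : s \in weight_group rE w l by apply/within_groupP.
(* A generator acting both within and away from one weight is trivial. *)
have [el|lN] := eqVneq l (tnth wM j).
  have -> : s = 1%g; last exact: polyact1.
  apply: (quotient_faithful hG hf hE) => //; apply/matrixP => a b; rewrite [RHS]mxE.
  apply/eqP; apply: contraT => sab; have := acts_withinP _ _ _ _ sP _ _ sab.
  have := acts_withinP _ _ _ _ sl _ _ sab; rewrite el /= => -[/eqP -> _].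
  by rewrite eqxx => -[].
have : actmx rE s B' = B' + B' *m cmx r (P *m (rM s - 1%:M) *m invmx P).
  rewrite eB' actmxM actmx_cmx cB // -!mulmxA -!cmxM -mulmxDr -cmxD.
  by rewrite mulKmx // mulmxBl mul1mx addrC subrK.
move=> /matrixP/(_ i j); rewrite actmxE => ->; rewrite mxE [X in _ + X]mxE.
rewrite big1 ?addr0 // => a _; rewrite cmxE.
have [->|/(hP sw)[_ e]] := eqVneq ((P *m (rM s - 1%:M) *m invmx P) a j) 0.
  by rewrite mpolyC0 mulr0.
by rewrite e eqxx in lN.
Qed.

End Scaling.

Let fG := reflection_group_faithful hG.
Let gG := reflection_group_generated hG.
Let fE := quotient_faithful hG hf hE.
Let gE := quotient_reflection_generated hG hf hE hw.

Lemma exponents_quotient (L : fieldType) (phi psi : {rmorphism L -> C})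
    (rM : mx_representation C (G / N)%G r) (rL : mx_representation L (G / N)%G r) eHE eGE :
  mx_rsim rE (map_repr phi rL) -> mx_rsim rM (map_repr psi rL) ->
  exponents rE rM eHE -> exponents rV (inflate nNG rM) eGE ->
  exists a b c : r.-tuple nat, [/\ perm_eq a [tuple w i | i < r], perm_eq b eHE,
    perm_eq c eGE & forall i, (tnth a i * tnth b i = tnth c i)%N].
Proof.
move=> simE simM; have [P uP [wM pwM hP]] := twist_weights simE simM w.
move=> /(exponents_basis fE gE)[h [tH [<- ch _]]].
move=> /(exponents_basis fG gG)[v [tV [<- cv _]]].
have [D eD] : exists D, D = twist_scaling P wM by eexists.
have comp_cov k (A : 'M[S]_(k, r)) : covariant rE rM A ->
    covariant rV (inflate nNG rM) (comp A).
  by move=> cA g Gg; rewrite compmx_act // cA ?mem_quotient // compmxM compmx_cmx.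
have cov_Ew : covariant rE rM (Ew h).
  move=> g Hg; have [k Nk Gk eg] := morphimP Hg; apply: compmx_inj.
  rewrite eg -compmx_act // -compmx_euler -eulermx_act compmx_act // (cb_cov ch) ?mem_quotient //.
  by rewrite compmx_euler eulermx_cmxr.
have [T iT eT] := cb_span ch cov_Ew.
have [|Th iTh eTh] := cb_span ch (_ : covariant rE rM (h *m cmx r D)).
  move=> g Hg; rewrite actmxM actmx_cmx (cb_cov ch Hg) -!mulmxA -!cmxM.
  by rewrite eD (twist_scaling_comm uP hP Hg).
have [Z iZ eZ] := cb_span cv (comp_cov _ _ (cb_cov ch)).
(* The entries of v are N-invariant, since N acts trivially on the module. *)
have [X iX eX] : exists2 X, invmat rE X & v = comp X *m comp h.
  have [v' ev'] : exists v', v = comp v'.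
    have [_ _ _ gen] := hf.
    have H i j : exists p, v i j = p \mPo f.
      apply: gen => g Ng; have Gg : g \in G by apply: (subsetP (normal_sub nNG)).
      have := cb_cov cv Gg; rewrite /inflate [X in cmx r X](_ : _ = 1%:M); last first.
        by rewrite -(repr_mx1 rM) -(coset_id Ng).
      by rewrite cmx1 mulmx1 => /matrixP/(_ i j); rewrite actmxE.
    have /fin_all_exists[v' hv'] i := fin_all_exists (H i).
    exists (\matrix_(i, j) v' i j); apply/matrixP => i j.
    by rewrite hv' compmxE mxE.
  have cv' : covariant rE rM v'.
    move=> g Hg; have [k Nk Gk eg] := morphimP Hg; apply: compmx_inj.
    by rewrite eg -compmx_act // -ev' (cb_cov cv Gk) compmxM compmx_cmx ev'.
  by have [X iX eX] := cb_span ch cv'; exists X; rewrite // ev' eX compmxM.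
have XZ : comp X *m Z = 1%:M.
  by apply: (mulmx_detI (cb_det cv)); rewrite -mulmxA -eZ -eX mul1mx.
have dZ : \det (mx0 Z) != 0.
  have := congr1 (fun A => \det (mx0 A)) XZ; rewrite mx0M det_mulmx -cmx1 mx0K det1.
  by move=> e; apply: contra_eq_neq e => ->; rewrite mulr0 eq_sym oner_eq0.
have e1 : mx0 Z *m natdiag C (tnth tV) = mx0 T *m mx0 Z.
  have e : E Z + Z *m cmx r (natdiag C (tnth tV)) = comp T *m Z.
    apply: (mulmx_detI (cb_det cv)).
    rewrite mulmxDl -(mulmxA Z) -(cb_euler cv) -eulermxM -eZ -mulmxA -eZ.
    by rewrite compmx_euler eT compmxM.
  by have := congr1 mx0 e; rewrite mx0D mx0_eulermx add0r !mx0M mx0K compmx0.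
have e2 : natdiag C (tnth tH) *m mx0 Th = mx0 Th *m natdiag C (tnth tH).
  have e : cmx r (natdiag C (tnth tH)) *m Th = E Th + Th *m cmx r (natdiag C (tnth tH)).
    apply: (mulmx_detI (cb_det ch)).
    rewrite mulmxDl -!mulmxA -(cb_euler ch) -eulermxM -eTh.
    by rewrite eulermx_cmxr (cb_euler ch) !mulmxA.
  by have := congr1 mx0 e; rewrite mx0D mx0_eulermx add0r !mx0M !mx0K.
(* Both sides are the coefficients of E_w h on h modulo the Hilbert ideal. *)
have e3 : mx0 T = natdiag C (tnth tH) *m mx0 Th.
  rewrite -[X in X *m _](mx0K r) -mx0M.
  apply: (mx0_mod_hilbert (cb_indep ch) iT) => [|i k]; first exact/invmatM/iTh/invmat_cmx.
  rewrite -eT -mulmxA -eTh mulmxA -(cb_euler ch) eD.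
  exact: (euler_scaling_ideal uP hP (cb_cov ch)).
have sT : has_spectrum (mx0 Th) (tnth wM).
  rewrite /has_spectrum (char_poly_const (cb_det ch) eTh).
  rewrite -(natdiag_spectrum C (tnth wM)) eD; apply/esym.
  apply: (@char_poly_intertwine _ _ (invmx P)).
    by rewrite -unitfE -unitmxE unitmx_inv.
  by rewrite /twist_scaling mulmxK.
have [b [a [pb pa _ sab]]] := joint_spectrum e2 (natdiag_spectrum _ _) sT.
exists a, b, [tuple tnth a i * tnth b i | i < r]%N; split=> //.
- exact: perm_trans pa pwM.
- apply: (@spectrum_perm C _ (natdiag C (tnth tV))); last exact: natdiag_spectrum.
  rewrite /has_spectrum (char_poly_intertwine dZ e1) e3 (sab : char_poly _ = _).
  by apply: eq_bigr => i _; rewrite tnth_mktuple mulnC.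
- by move=> i; rewrite tnth_mktuple.
Qed.

Lemma degrees_quotient dG dH : degrees rV dG -> degrees rE dH ->
  exists a b c : r.-tuple nat, [/\ perm_eq a [tuple w i | i < r], perm_eq b dH,
    perm_eq c dG & forall i, (tnth a i * tnth b i = tnth c i)%N].
Proof.
move=> [Phi bPhi hPhi] [theta bt ht].
have [T HT hT] := quotient_generators hG hf hE hw.
have hT' t : t \in T -> exists l, acts_within rE w (pred1 l) t by move=> /hT[].
have wE : forall g j k, g \in (G / N)%g -> rE g j k != 0 -> w j = w k.
  by move=> g j k'; apply: (quotient_weights hf hE hw).
have [_ it at_ gent] := bt.
have H i : exists c : 'I_r -> S, (forall j, invariant rE (c j)) /\
    forall k, (w k)%:R *: (tnth theta i)^`M(k) = \sum_j c j * (tnth theta j)^`M(k).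
  by have [c] := scaled_gradient_inv HT hT' wE bt (it i); exists c.
have /fin_all_exists[th hth] := H.
have [Th eTh] : exists Th, Th = \matrix_(i, j) th i j :> 'M[S]_r by eexists.
have iTh : invmat rE Th.
  by apply/invmatP => i j; rewrite eTh mxE; case: (hth i).
pose J := jacobian theta; have dJ : \det J != 0 := jacobian_det fE bt.
have eJ : J *m cmx r (natdiag C w) = Th *m J.
  apply/matrixP => i k; rewrite eTh [RHS]mxE.
  have [_ /(_ k) e] := hth i; rewrite mxE (bigD1 k) //= !mxsE eqxx mulr1n.
  rewrite big1 ?addr0 => [|j jk]; last by rewrite !mxsE (negPf jk) mulr0n mpolyC0 mulr0.
  by rewrite mulrC mul_mpolyC e; apply: eq_bigr => j _; rewrite !mxE.
pose D' := natdiag C (tnth dH) - 1%:M.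
have EJ : E J = cmx r D' *m J.
  apply/matrixP => i k; rewrite [RHS]mxE (bigD1 i) //= !mxsE eqxx mulr1n.
  rewrite big1 ?addr0 => [|j ji].
    by rewrite (euler_mderiv_homog k (ht i)) mul_mpolyC.
  by rewrite !mxsE eq_sym (negPf ji) mulr0n subrr mpolyC0 mul0r.
(* The entries of row i of J have degree one less than theta_i. *)
have e2 : mx0 Th *m natdiag C (tnth dH) = natdiag C (tnth dH) *m mx0 Th.
  have e : cmx r D' *m Th = E Th + Th *m cmx r D'.
    apply: (mulmx_detI dJ).
    by rewrite mulmxDl -!mulmxA -EJ -eulermxM -eJ eulermx_cmxr EJ mulmxA.
  have := congr1 mx0 e; rewrite mx0D mx0_eulermx add0r !mx0M !mx0K.
  rewrite /D' mulmxBl mulmxBr mul1mx mulmx1 => /(congr1 (fun X => X + mx0 Th)).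
  by rewrite !subrK.
have sTh : has_spectrum (mx0 Th) (tnth [tuple w i | i < r]).
  rewrite /has_spectrum (char_poly_const dJ eJ) (natdiag_spectrum C w : char_poly _ = _).
  by apply: eq_bigr => i _; rewrite tnth_mktuple.
have [a [b [pa pb _ sab]]] := joint_spectrum e2 sTh (natdiag_spectrum _ _).
exists a, b, [tuple tnth a i * tnth b i | i < r]%N; split=> //; last first.
  by move=> i; rewrite tnth_mktuple.
have ecp : char_poly (mx0 (comp (Th *m cmx r (natdiag C (tnth dH))))) =
    char_poly (natdiag C (tnth dG)).
  apply: (degrees_intertwine (W := [tuple tnth theta i \mPo f | i < r]) bPhi hPhi) => [i||i|q iq|i j|i].
  - by rewrite tnth_mktuple; apply/(invariant_comp_basic hf hE).
  - by move=> p q; rewrite -!comp_mpolyA => /(comp_basic_inj hf)/(alg_indep_inj at_).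
  - rewrite tnth_mktuple (comp_basic_coef0 hf hw); apply: alg_indep_coef0 at_ ht i.
  - have [_ _ _ gen] := hf.
    have [p ep] := gen q (invariant_res nNG iq).
    rewrite ep in iq; move/(invariant_comp_basic hf hE): iq => /gent[p' ep'].
    by exists p'; rewrite ep ep' comp_mpolyA.
  - move: i j; apply/invmatP/compmx_invmat/invmatM => //; exact: invmat_cmx.
  - rewrite tnth_mktuple (euler_comp_basic hw).
    have -> : euler (fun k => (w k)%:R) (tnth theta i) =
        \sum_j (Th *m cmx r (natdiag C (tnth dH))) i j * tnth theta j.
      have e j : (Th *m cmx r (natdiag C (tnth dH))) i j = th i j * ((tnth dH j)%:R)%:MP.
        rewrite mxE (bigD1 j) //= eTh !mxsE eqxx mulr1n big1 ?addr0 // => k kj.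
        by rewrite !mxsE (negPf kj) mulr0n mpolyC0 mulr0.
      under eq_bigr => j _.
        rewrite e -mulrA mul_mpolyC -(euler_homog (ht j)) /euler mulr_sumr.
        over.
      rewrite exchange_big /=; apply: eq_bigr => k _.
      have [_ /(_ k) ek] := hth i.
      rewrite [LHS]scalerAr ek mulr_sumr; apply: eq_bigr => j _.
      by rewrite scale1r mulrCA.
    rewrite (raddf_sum (comp_mpoly f)); apply: eq_bigr => j _ /=.
    by rewrite comp_mpolyM compmxE tnth_mktuple.
apply: (@spectrum_perm C _ (natdiag C (tnth dG))); last exact: natdiag_spectrum.
rewrite /has_spectrum -ecp compmx0 mx0M mx0K (sab : char_poly _ = _).
by apply: eq_bigr => i _; rewrite tnth_mktuple.
Qed.

End Quotient.

(** The case W = f, where T is diagonal, of the comparison of generators. *)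
Lemma degrees_unique (C : numClosedFieldType) (gT : finGroupType) (K : {group gT}) n
    (rK : mx_representation C K n) (f : n.-tuple {mpoly C[n]}) (w : 'I_n -> nat) d :
  basic_invariants rK f -> (forall i, tnth f i \is (w i).-homog) -> degrees rK d ->
  perm_eq d [tuple w i | i < n].
Proof.
move=> [_ iF aF genF] hw [Phi bPhi hPhi].
apply: (@spectrum_perm C _ (natdiag C (tnth d))); first exact: natdiag_spectrum.
rewrite /has_spectrum; transitivity (char_poly (natdiag C w)); last first.
  by rewrite natdiag_spectrum; apply: eq_bigr => i _; rewrite tnth_mktuple.
rewrite -{1}[natdiag C w](mx0K n); apply/esym.
apply: (degrees_intertwine (W := f) bPhi hPhi) => // [|i|i j|i].
- exact: alg_indep_inj.
- exact: alg_indep_coef0 aF hw i.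
- by rewrite cmxE; apply: invariantC.
rewrite (euler_homog (hw i)) (bigD1 i) //= big1 ?addr0 => [|j ji].
  by rewrite !mxsE eqxx mulr1n mul_mpolyC.
by rewrite !mxsE eq_sym (negPf ji) mulr0n mpolyC0 mul0r.
Qed.

Theorem theorem1p3 (R : realType) (r : nat)
    (gT : finGroupType) (G N : {group gT})
    (rV : mx_representation R[i] G r)
    (hG : complex_reflection_group rV)
    (nNG : (N <| G)%g)
    (hN : complex_reflection_group (res nNG rV))
    (f : r.-tuple {mpoly R[i][r]})
    (hf : basic_invariants (res nNG rV) f)
    (rE : mx_representation R[i] (G / N)%G r)
    (hE : quotient_module nNG rV f rE)
    (L : splittingFieldType rat) (zeta : L)
    (hzeta : #|G|.-primitive_root zeta)
    (hL : <<1; zeta>>%VS = fullv)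
    (iota : {rmorphism L -> R[i]})
    (sigma : gal_of {:L}) (hsigma : sigma \in 'Gal({:L} / 1)%g)
    (rVs : mx_representation R[i] G r)
    (hVs : galois_twist iota sigma rV rVs)
    (rEs : mx_representation R[i] (G / N)%G r)
    (hEs : galois_twist iota sigma rE rEs)
    (u : nat) (rU : mx_representation R[i] G u)
    (hU : orlik_solomon nNG rV rVs rU)
    (dG dN dH : r.-tuple nat)
    (hdG : degrees rV dG)
    (hdN : degrees (res nNG rV) dN)
    (hdH : degrees rE dH)
    (eNV eGU eGV eHE eGE : seq nat)
    (heNV : exponents (res nNG rV) (res nNG rVs) eNV)
    (heGU : exponents rV rU eGU)
    (heGV : exponents rV rVs eGV)
    (heHE : exponents rE rEs eHE)
    (heGE : exponents rV (inflate nNG rEs) eGE) :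
  exists eNV' eGU' eGV' eHE' eGE' dG' dN' dH' : r.-tuple nat,
    [/\ perm_eq eNV' eNV, perm_eq eGU' eGU & perm_eq eGV' eGV] /\
    (perm_eq eHE' eHE /\ perm_eq eGE' eGE) /\
    [/\ perm_eq dG' dG, perm_eq dN' dN & perm_eq dH' dH] /\
    forall i : 'I_r,
      [/\ (tnth eNV' i + tnth eGU' i = tnth eGV' i)%N,
          (tnth dN' i * tnth eHE' i = tnth eGE' i)%N
        & (tnth dN' i * tnth dH' i = tnth dG' i)%N].

Proof.
have [a1 [b1 [c1 [pa1 pb1 pc1 e1]]]] := exponents_orlik_solomon hG hN hU heNV heGU heGV.
have [w hw] : exists w : 'I_r -> nat, forall i, tnth f i \is (w i).-homog.
  by have [hf' _ _ _] := hf; apply: fin_all_exists hf'.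
have [rL simE simEs] := hEs.
have [a2 [b2 [c2 [pa2 pb2 pc2 e2]]]] := exponents_quotient hG hf hE hw simE simEs heHE heGE.
have [a3 [b3 [c3 [pa3 pb3 pc3 e3]]]] := degrees_quotient hG hf hE hw hdG hdH.
(* Both products list the degrees of N; the second indexing is made to follow the
   first. *)
have /tuple_permP[s es] : perm_eq a2 a3 by rewrite (perm_trans pa2) // perm_sym.
have pN : perm_eq a2 dN.
  by rewrite (perm_trans pa2) // perm_sym; apply: degrees_unique hf hw hdN.
have perm_s (t : r.-tuple nat) : perm_eq [tuple tnth t (s i) | i < r] t.
  by apply/tuple_permP; exists s.
exists a1, b1, c1, b2, c2, [tuple tnth c3 (s i) | i < r], a2, [tuple tnth b3 (s i) | i < r].
split; first by [].
split; first by [].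
split.
  by split=> //; [apply: perm_trans (perm_s c3) pc3|apply: perm_trans (perm_s b3) pb3].
move=> i; split; first exact: e1.
  exact: e2.
have -> : a2 = [tuple tnth a3 (s i) | i < r] by apply: val_inj.
by rewrite !tnth_mktuple e3.
Qed.
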